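(* Let $-1/2\le\lambda<1$ and $0\le\beta\le 2\lambda+1$. Then $C_\beta[f]\in\mathcal{S}$ for every $f\in\mathcal{S}^*(\lambda)$.
   Context: $\mathbb{D}$ is the open unit disk; $\mathcal{A}$ the class of analytic $f$ on $\mathbb{D}$ with $f(0)=0$, $f'(0)=1$; $\mathcal{S}\subset\mathcal{A}$ the univalent functions. For $\lambda<1$, $\mathcal{S}^*(\lambda)=\{f\in\mathcal{A}: f(z)\ne0 \text{ for } z\ne0,\ \mathrm{Re}\,(zf'(z)/f(z))>\lambda \text{ on }\mathbb{D}\}$. For $\beta\ge0$ and $f$ analytic on $\mathbb{D}$ with $f(0)=0$, the $\beta$-Cesàro transform is $C_\beta[f](z)=\int_0^z \frac{f(w)}{w(1-w)^\beta}\,dw$ (principal branch of $(1-w)^\beta$). *)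

(* Defs.v *)
From Stdlib Require Import Reals.
From Coquelicot Require Import Coquelicot.
Open Scope R_scope.

Definition inD (z : C) : Prop := Cmod z < 1.

Definition analytic_on_D (f : C -> C) : Prop :=
  forall z : C, inD z -> ex_derive f z.

Definition classA (f : C -> C) : Prop :=
  analytic_on_D f /\ f (RtoC 0) = RtoC 0 /\ is_derive f (RtoC 0) (RtoC 1).

Definition classS (f : C -> C) : Prop :=
  classA f /\ (forall z w : C, inD z -> inD w -> f z = f w -> z = w).

(* Starlike functions of order lambda.  The quotient z f'(z)/f(z) is
   required for z <> 0 (at z = 0 it is understood as its limit 1 > lambda). *)
Definition starlike (lam : R) (f : C -> C) : Prop :=
  classA f /\
  (forall z : C, inD z -> z <> RtoC 0 -> f z <> RtoC 0) /\
  (forall z d : C, inD z -> z <> RtoC 0 -> is_derive f z d ->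
     lam < Re (Cdiv (Cmult z d) (f z))).

Definition Carg (z : C) : R :=
  let x := Re z in let y := Im z in
  if Rlt_dec 0 x then atan (y / x)
  else if Rlt_dec x 0 then
    (if Rle_dec 0 y then atan (y / x) + PI else atan (y / x) - PI)
  else if Rlt_dec 0 y then PI / 2
  else if Rlt_dec y 0 then - (PI / 2) else 0.

Definition Clog (z : C) : C := (ln (Cmod z), Carg z).
Definition Cexp (z : C) : C := (exp (Re z) * cos (Im z), exp (Re z) * sin (Im z)).

Definition Cpow_pr (u : C) (beta : R) : C := Cexp (Cmult (RtoC beta) (Clog u)).

(* beta-Cesaro transform: C_beta[f](z) = int_0^z f(w) / (w (1-w)^beta) dw,
   the integral taken along the segment w = t z, t in [0,1] (dw = z dt). *)
Definition cesaro (beta : R) (f : C -> C) (z : C) : C :=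
  @RInt C_R_CompleteNormedModule
    (fun t : R =>
       Cmult (Cdiv (f (Cmult (RtoC t) z))
                   (Cmult (Cmult (RtoC t) z)
                          (Cpow_pr (Cminus (RtoC 1) (Cmult (RtoC t) z)) beta)))
             z)
    0 1.

(* Main.v *)
Require Import Defs.
From Stdlib Require Import Reals.
From Coquelicot Require Import Coquelicot.
From Stdlib Require Import Lra Lia List ZArith Classical IndefiniteDescription Ranalysis5.
Open Scope R_scope.

(** The derivative of [g = cesaro beta f] is [f(z) / (z (1 - z)^beta) = exp G(z)], and
    [1 + z g''/g' = z f'/f + beta z / (1 - z)] has real part [> lam - beta / 2 >= -1/2]
    (Ozaki's condition).

    Rescale so that [g] is holomorphic beyond the unit circle.  The tangent angle
    [psi t = t + Im G(e^(it))] grows by [2 PI] per turn with [psi' > -1/2], so the part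
    of its graph where [psi' <= 0] covers a set of levels of measure less than [PI], and
    some level [c] and its translates by [PI] are crossed upwards only (Umezawa).  If
    [c] and [c + PI] are crossed at [al] and [be], then
    [kap (1 - e^(-i al) z) (1 - e^(-i be) z) g'(z)] has nonnegative real part on the
    circle for a suitable unimodular [kap], hence positive real part inside.  As
    [1 / ((1 - e^(-i al) z) (1 - e^(-i be) z))] is, up to a constant, the derivative of
    a conformal map of the disk onto a strip, [g] is close to convex, and integrating
    [g'] along preimages of segments of the strip shows that it is injective.

    Goursat's theorem, with one exceptional point allowed, supplies the primitives;
    Cauchy's formula then gives the differentiability of [q'] for [q = f(z) / z]. *)

(** * Complex derivatives *)

(** The bound 1/2 and the spacing [PI] belong together: over one turn, of length 2 PI, the points
    with -1/2 < psi' <= 0 have an image of length less than 2 PI / 2 = PI, and [PI] is the distance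
    between the levels to be kept free of critical points. The bound [beta <= 2 * lam + 1] is
    exactly lam - beta / 2 >= -1/2. Rescaling provides compactness: on a closed circle the strict
    bound on psi' becomes uniform.

    The two linear factors are dictated by the boundary: at z = e^(it), 1 - e^(-i al) z is sin((t -
    al) / 2) times a phase of angle t / 2 plus a constant. The two phases together supply the t that
    turns arg g' into psi, and the product of the sines changes sign where sin(psi - c) does.

    A recurring obstacle is the difference quotient at its base point: in f(z) / z, in Cauchy's
    formula and in the Poisson argument it is at first known only to be continuous there. This is
    why Goursat's theorem admits an exceptional point; as primitives are based at that same point,
    only triangles having it as a vertex occur. *)

Definition cdiff (F : C -> C) (z d : C) : Prop :=
  forall eps : R, 0 < eps -> exists del : R, 0 < del /\
    forall w : C, Cmod (w - z) < del ->
      Cmod (F w - F z - d * (w - z)) <= eps * Cmod (w - z).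

Definition ccont (F : C -> C) (z : C) : Prop :=
  forall eps : R, 0 < eps -> exists del : R, 0 < del /\
    forall w : C, Cmod (w - z) < del -> Cmod (F w - F z) < eps.

Lemma Cmod_pos_neq (z : C) : z <> RtoC 0 -> 0 < Cmod z.
Proof. apply Cmod_gt_0. Qed.

Lemma Cmod_sym (z w : C) : Cmod (z - w) = Cmod (w - z).
Proof. rewrite <- Cmod_opp. f_equal. ring. Qed.

Lemma Cmod_le_add (z w : C) : Cmod z <= Cmod w + Cmod (z - w).
Proof.
  replace z with (w + (z - w))%C at 1 by ring. apply Cmod_triangle.
Qed.

Lemma im_le_Cmod (c : C) : Rabs (Im c) <= Cmod c.
Proof. eapply Rle_trans; [apply Rmax_r | apply Rmax_Cmod]. Qed.

Lemma Cmod_sum_le (c : C) : Cmod c <= Rabs (Re c) + Rabs (Im c).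
Proof.
  assert (E : c = (RtoC (Re c) + RtoC (Im c) * Ci)%C)
    by (destruct c; unfold RtoC, Ci, Cplus, Cmult; simpl; f_equal; ring).
  rewrite E at 1. eapply Rle_trans; [apply Cmod_triangle|].
  rewrite Cmod_mult, Cmod_Ci, !Cmod_R. lra.
Qed.

(** Bridge to the theorem, whose hypotheses and conclusion use [is_derive]. Balls of [C_AbsRing] are
    [Cmod] balls, so it is enough to unfold the filters. [cdiff] contains no quotient, hence [w = z]
    needs no exclusion. *)
Lemma is_derive_cdiff (F : C -> C) (z d : C) :
  @is_derive C_AbsRing C_NormedModule F z d <-> cdiff F z d.
Proof.
  split.
  - intros [_ H] eps He.
    assert (Hl : is_filter_lim (locally (T := AbsRing_UniformSpace C_AbsRing) z) z)
      by (intros P HP; exact HP).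
    destruct (H z Hl (mkposreal eps He)) as [del Hd].
    exists del; split; [apply cond_pos|].
    intros w Hw. specialize (Hd w Hw).
    replace (F w - F z - d * (w - z))%C with (F w - F z - (w - z) * d)%C by ring.
    exact Hd.
  - intros H. split.
    + apply is_linear_scal_l.
    + intros x Hx eps.
      apply (is_filter_lim_locally_unique (V := AbsRing_NormedModule C_AbsRing)) in Hx. subst x.
      destruct (H eps (cond_pos eps)) as [del [Hd Hw]].
      exists (mkposreal del Hd). intros w Hb.
      specialize (Hw w Hb).
      replace (F w - F z - d * (w - z))%C with (F w - F z - (w - z) * d)%C in Hw by ring.
      exact Hw.
Qed.

Lemma cdiff_ccont (F : C -> C) (z d : C) : cdiff F z d -> ccont F z.
Proof.
  intros H eps He.
  destruct (H 1 Rlt_0_1) as [del [Hd Hw]].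
  pose proof (Cmod_ge_0 d) as Hd0.
  exists (Rmin del (eps / (2 + Cmod d))). split.
  { apply Rmin_pos; [exact Hd|]. apply Rdiv_lt_0_compat; lra. }
  intros w Hm.
  assert (H1 : Cmod (w - z) < del) by (eapply Rlt_le_trans; [exact Hm|apply Rmin_l]).
  assert (H2 : Cmod (w - z) < eps / (2 + Cmod d))
    by (eapply Rlt_le_trans; [exact Hm|apply Rmin_r]).
  specialize (Hw w H1).
  pose proof (Cmod_le_add (F w - F z) (d * (w - z))) as H3.
  rewrite Cmod_mult in H3.
  apply Rle_lt_trans with ((1 + Cmod d) * Cmod (w - z)); [lra|].
  apply Rle_lt_trans with ((1 + Cmod d) * (eps / (2 + Cmod d))).
  { apply Rmult_le_compat_l; lra. }
  apply Rmult_lt_reg_r with (2 + Cmod d); [lra|]. field_simplify; [nra|lra].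
Qed.

Lemma cdiff_ext (F G : C -> C) (z d : C) (r : R) :
  0 < r -> (forall w, Cmod (w - z) < r -> F w = G w) -> cdiff F z d -> cdiff G z d.
Proof.
  intros Hr E H eps He. destruct (H eps He) as [del [Hd Hw]].
  exists (Rmin del r). split; [apply Rmin_pos; assumption|].
  intros w Hm.
  assert (E0 : F z = G z) by (apply E; replace (z - z)%C with (RtoC 0) by ring; rewrite Cmod_0; exact Hr).
  rewrite <- E0, <- E.
  - apply Hw. eapply Rlt_le_trans; [exact Hm|apply Rmin_l].
  - eapply Rlt_le_trans; [exact Hm|apply Rmin_r].
Qed.

Lemma cdiff_ext_all (F G : C -> C) (z d : C) :
  (forall w, F w = G w) -> cdiff F z d -> cdiff G z d.
Proof. intros E. apply cdiff_ext with 1; [lra|]. intros; apply E. Qed.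

Lemma cdiff_eq (F : C -> C) (z d d' : C) : d = d' -> cdiff F z d -> cdiff F z d'.
Proof. intros ->; auto. Qed.

Lemma cdiff_const (c z : C) : cdiff (fun _ => c) z 0.
Proof.
  intros eps He. exists 1. split; [lra|]. intros w _.
  replace (c - c - 0 * (w - z))%C with (RtoC 0) by ring. rewrite Cmod_0.
  apply Rmult_le_pos; [lra|apply Cmod_ge_0].
Qed.

Lemma cdiff_id (z : C) : cdiff (fun w => w) z 1.
Proof.
  intros eps He. exists 1. split; [lra|]. intros w _.
  replace (w - z - 1 * (w - z))%C with (RtoC 0) by ring. rewrite Cmod_0.
  apply Rmult_le_pos; [lra|apply Cmod_ge_0].
Qed.

Lemma cdiff_plus (F G : C -> C) (z d e : C) :
  cdiff F z d -> cdiff G z e -> cdiff (fun w => F w + G w)%C z (d + e)%C.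
Proof.
  intros HF HG eps He.
  assert (He2 : 0 < eps / 2) by lra.
  destruct (HF _ He2) as [d1 [Hd1 H1]]. destruct (HG _ He2) as [d2 [Hd2 H2]].
  exists (Rmin d1 d2). split; [apply Rmin_pos; assumption|]. intros w Hw.
  specialize (H1 w (Rlt_le_trans _ _ _ Hw (Rmin_l _ _))).
  specialize (H2 w (Rlt_le_trans _ _ _ Hw (Rmin_r _ _))).
  replace (F w + G w - (F z + G z) - (d + e) * (w - z))%C
    with ((F w - F z - d * (w - z)) + (G w - G z - e * (w - z)))%C by ring.
  eapply Rle_trans; [apply Cmod_triangle|]. lra.
Qed.

Lemma cdiff_comp (F G : C -> C) (z d e : C) :
  cdiff F (G z) d -> cdiff G z e -> cdiff (fun w => F (G w)) z (d * e)%C.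
Proof.
  intros HF HG eps He.
  pose proof (Cmod_ge_0 d) as Hd0. pose proof (Cmod_ge_0 e) as He0.
  set (k := Cmod e + 1).
  assert (Hk : 0 < eps / (2 * k)) by (apply Rdiv_lt_0_compat; unfold k; lra).
  destruct (HF _ Hk) as [d1 [Hd1 H1]].
  (* [m <= 1] bounds the increment of [G] by [k] times that of [w]; the other bound keeps the error
     of [G], magnified by [d], below half of the allowance. *)
  set (m := Rmin 1 (eps / (2 * (Cmod d + 1)))).
  assert (Hm : 0 < m) by (apply Rmin_pos; [lra|apply Rdiv_lt_0_compat; lra]).
  destruct (HG m Hm) as [d2 [Hd2 H2]].
  destruct (cdiff_ccont _ _ _ HG d1 Hd1) as [d3 [Hd3 H3]].
  exists (Rmin d2 d3). split; [apply Rmin_pos; assumption|]. intros w Hw.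
  specialize (H2 w (Rlt_le_trans _ _ _ Hw (Rmin_l _ _))).
  specialize (H3 w (Rlt_le_trans _ _ _ Hw (Rmin_r _ _))).
  specialize (H1 _ H3).
  pose proof (Cmod_ge_0 (w - z)) as Hwz.
  assert (Hg : Cmod (G w - G z) <= k * Cmod (w - z)).
  { pose proof (Cmod_le_add (G w - G z) (e * (w - z))) as H4. rewrite Cmod_mult in H4.
    assert (m <= 1) by apply Rmin_l. unfold k. nra. }
  replace (F (G w) - F (G z) - d * e * (w - z))%C
    with ((F (G w) - F (G z) - d * (G w - G z)) + d * (G w - G z - e * (w - z)))%C by ring.
  eapply Rle_trans; [apply Cmod_triangle|]. rewrite Cmod_mult.
  assert (A1 : eps / (2 * k) * Cmod (G w - G z) <= eps / 2 * Cmod (w - z)).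
  { apply Rle_trans with (eps / (2 * k) * (k * Cmod (w - z))).
    - apply Rmult_le_compat_l; lra.
    - right. field. unfold k; lra. }
  assert (A2 : Cmod d * m <= eps / 2).
  { apply Rle_trans with ((Cmod d + 1) * (eps / (2 * (Cmod d + 1)))).
    - apply Rmult_le_compat; try lra. apply Rmin_r.
    - right. field. lra. }
  assert (A3 : Cmod d * Cmod (G w - G z - e * (w - z)) <= Cmod d * (m * Cmod (w - z)))
    by (apply Rmult_le_compat_l; lra).
  nra.
Qed.

Lemma cdiff_scal (k : C) (F : C -> C) (z d : C) :
  cdiff F z d -> cdiff (fun w => k * F w)%C z (k * d)%C.
Proof.
  intros H. apply (cdiff_comp (fun u => k * u)%C F z k d); [|exact H].
  intros eps He. exists 1. split; [lra|]. intros w _.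
  replace (k * w - k * F z - k * (w - F z))%C with (RtoC 0) by ring. rewrite Cmod_0.
  apply Rmult_le_pos; [lra|apply Cmod_ge_0].
Qed.

Lemma cdiff_sqr (z : C) : cdiff (fun w => w * w)%C z (2 * z)%C.
Proof.
  intros eps He. exists eps. split; [exact He|]. intros w Hw.
  replace (w * w - z * z - 2 * z * (w - z))%C with ((w - z) * (w - z))%C by ring.
  rewrite Cmod_mult. apply Rmult_le_compat_r; [apply Cmod_ge_0|lra].
Qed.

(* Polarisation: FG = ((F + G)^2 - F^2 - G^2) / 2. *)
Lemma cdiff_mult (F G : C -> C) (z d e : C) :
  cdiff F z d -> cdiff G z e ->
  cdiff (fun w => F w * G w)%C z (d * G z + F z * e)%C.
Proof.
  intros HF HG.
  pose proof (cdiff_comp _ (fun w => F w + G w)%C _ _ _ (cdiff_sqr (F z + G z)) (cdiff_plus _ _ _ _ _ HF HG)) as H1.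
  pose proof (cdiff_comp _ F _ _ _ (cdiff_sqr (F z)) HF) as H2.
  pose proof (cdiff_comp _ G _ _ _ (cdiff_sqr (G z)) HG) as H3.
  assert (N2 : RtoC 2 <> RtoC 0) by (intros E; apply RtoC_inj in E; lra).
  pose proof (cdiff_scal (/ 2) _ _ _ (cdiff_plus _ _ _ _ _ H1
     (cdiff_scal (- (1)) _ _ _ (cdiff_plus _ _ _ _ _ H2 H3)))) as H4.
  eapply cdiff_ext_all; [|eapply cdiff_eq; [|exact H4]]; [intros w; simpl|]; field; exact N2.
Qed.

Lemma cdiff_Cinv (z : C) : z <> RtoC 0 -> cdiff Cinv z (- / (z * z))%C.
Proof.
  intros Hz eps He. pose proof (Cmod_pos_neq z Hz) as Hm.
  set (m := Cmod z) in *.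
  exists (Rmin (m / 2) (eps * (m * m * m) / 2)). split.
  { apply Rmin_pos; [lra|]. assert (0 < m * m * m) by (repeat apply Rmult_lt_0_compat; lra). nra. }
  intros w Hw.
  assert (Hw1 : Cmod (w - z) < m / 2) by (eapply Rlt_le_trans; [exact Hw|apply Rmin_l]).
  assert (Hw2 : Cmod (w - z) < eps * (m * m * m) / 2) by (eapply Rlt_le_trans; [exact Hw|apply Rmin_r]).
  pose proof (Cmod_le_add z w) as Ht. rewrite Cmod_sym in Ht. fold m in Ht.
  assert (Hwm : m / 2 < Cmod w) by lra.
  assert (Hw0 : w <> RtoC 0) by (apply Cmod_gt_0; lra).
  replace (/ w - / z - - / (z * z) * (w - z))%C with ((w - z) * (w - z) * / (z * z * w))%C
    by (field; split; assumption).
  assert (Hzz : (z * z * w)%C <> RtoC 0) by (repeat apply Cmult_neq_0; assumption).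
  rewrite Cmod_mult, Cmod_mult, Cmod_inv by exact Hzz. rewrite !Cmod_mult. fold m.
  pose proof (Cmod_ge_0 (w - z)) as H0.
  rewrite Rmult_assoc, Rmult_comm. apply Rmult_le_compat_r; [exact H0|].
  assert (Hp : 0 < m * m * Cmod w) by (repeat apply Rmult_lt_0_compat; lra).
  apply Rmult_le_reg_r with (m * m * Cmod w); [exact Hp|].
  rewrite Rmult_assoc, Rinv_l by lra. rewrite Rmult_1_r.
  assert (m * m * (m / 2) <= m * m * Cmod w) by (apply Rmult_le_compat_l; nra).
  nra.
Qed.

Lemma cdiff_inv (F : C -> C) (z d : C) :
  F z <> RtoC 0 -> cdiff F z d -> cdiff (fun w => / F w)%C z (- d / (F z * F z))%C.
Proof.
  intros H0 H. eapply cdiff_eq; [|exact (cdiff_comp _ F _ _ _ (cdiff_Cinv _ H0) H)].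
  field. exact H0.
Qed.

Lemma cdiff_div (F G : C -> C) (z d e : C) :
  G z <> RtoC 0 -> cdiff F z d -> cdiff G z e ->
  cdiff (fun w => F w / G w)%C z ((d * G z - F z * e) / (G z * G z))%C.
Proof.
  intros H0 HF HG. eapply cdiff_eq; [|exact (cdiff_mult _ _ _ _ _ HF (cdiff_inv _ _ _ H0 HG))].
  simpl. field. exact H0.
Qed.

Lemma cdiff_opp (F : C -> C) (z d : C) : cdiff F z d -> cdiff (fun w => - F w)%C z (- d)%C.
Proof.
  intros H. eapply cdiff_ext_all; [|eapply cdiff_eq; [|exact (cdiff_scal (- (1)) _ _ _ H)]];
  [intros w; simpl|]; ring.
Qed.

Lemma cdiff_minus (F G : C -> C) (z d e : C) :
  cdiff F z d -> cdiff G z e -> cdiff (fun w => F w - G w)%C z (d - e)%C.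
Proof. intros HF HG. exact (cdiff_plus _ _ _ _ _ HF (cdiff_opp _ _ _ HG)). Qed.

Lemma ccont_ext (F G : C -> C) (z : C) (r : R) :
  0 < r -> (forall w, Cmod (w - z) < r -> F w = G w) -> ccont F z -> ccont G z.
Proof.
  intros Hr E H eps He. destruct (H eps He) as [del [Hd Hw]].
  exists (Rmin del r). split; [apply Rmin_pos; assumption|].
  intros w Hm.
  assert (E0 : F z = G z) by (apply E; replace (z - z)%C with (RtoC 0) by ring; rewrite Cmod_0; exact Hr).
  rewrite <- E0, <- E.
  - apply Hw. eapply Rlt_le_trans; [exact Hm|apply Rmin_l].
  - eapply Rlt_le_trans; [exact Hm|apply Rmin_r].
Qed.

Lemma ccont_mult (F G : C -> C) (z : C) :
  ccont F z -> ccont G z -> ccont (fun w => F w * G w)%C z.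
Proof.
  intros HF HG eps He.
  set (k := Cmod (F z) + Cmod (G z) + 1).
  pose proof (Cmod_ge_0 (F z)) as h1. pose proof (Cmod_ge_0 (G z)) as h2.
  set (m := Rmin 1 (eps / (2 * k))).
  assert (Hm : 0 < m) by (apply Rmin_pos; [lra|apply Rdiv_lt_0_compat; unfold k; lra]).
  destruct (HF m Hm) as [d1 [Hd1 H1]]. destruct (HG m Hm) as [d2 [Hd2 H2]].
  exists (Rmin d1 d2). split; [apply Rmin_pos; assumption|]. intros w Hw.
  specialize (H1 w (Rlt_le_trans _ _ _ Hw (Rmin_l _ _))).
  specialize (H2 w (Rlt_le_trans _ _ _ Hw (Rmin_r _ _))).
  replace (F w * G w - F z * G z)%C
    with ((F w - F z) * (G w - G z) + (F w - F z) * G z + F z * (G w - G z))%C by ring.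
  eapply Rle_lt_trans; [eapply Rle_trans; [apply Cmod_triangle|apply Rplus_le_compat_r; apply Cmod_triangle]|].
  rewrite !Cmod_mult.
  pose proof (Cmod_ge_0 (F w - F z)) as h3. pose proof (Cmod_ge_0 (G w - G z)) as h4.
  assert (m <= 1) by apply Rmin_l.
  assert (Hmk : m * k <= eps / 2).
  { apply Rle_trans with (eps / (2 * k) * k); [apply Rmult_le_compat_r; [unfold k; lra|apply Rmin_r]|].
    right. field. unfold k; lra. }
  unfold k in Hmk. nra.
Qed.

Lemma ccont_plus (F G : C -> C) (z : C) :
  ccont F z -> ccont G z -> ccont (fun w => F w + G w)%C z.
Proof.
  intros HF HG eps He. assert (He2 : 0 < eps / 2) by lra.
  destruct (HF _ He2) as [d1 [Hd1 H1]]. destruct (HG _ He2) as [d2 [Hd2 H2]].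
  exists (Rmin d1 d2). split; [apply Rmin_pos; assumption|]. intros w Hw.
  specialize (H1 w (Rlt_le_trans _ _ _ Hw (Rmin_l _ _))).
  specialize (H2 w (Rlt_le_trans _ _ _ Hw (Rmin_r _ _))).
  replace (F w + G w - (F z + G z))%C with ((F w - F z) + (G w - G z))%C by ring.
  eapply Rle_lt_trans; [apply Cmod_triangle|]. lra.
Qed.

(** * The complex exponential, and restriction of derivatives to the real line *)

Lemma Cexp_plus (a b : C) : Cexp (a + b) = (Cexp a * Cexp b)%C.
Proof.
  destruct a as [a1 a2], b as [b1 b2]. unfold Cexp, Cmult, Cplus; simpl.
  rewrite exp_plus, cos_plus, sin_plus. f_equal; ring.
Qed.

Lemma Cexp_0 : Cexp 0 = RtoC 1.
Proof. unfold Cexp, RtoC; simpl. rewrite exp_0, cos_0, sin_0. f_equal; ring. Qed.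

Lemma Cexp_opp (a : C) : (Cexp a * Cexp (- a))%C = RtoC 1.
Proof. rewrite <- Cexp_plus. replace (a + - a)%C with (RtoC 0) by ring. apply Cexp_0. Qed.

Lemma Cexp_neq_0 (a : C) : Cexp a <> RtoC 0.
Proof.
  intros E. pose proof (Cexp_opp a) as H. rewrite E in H.
  rewrite Cmult_0_l in H. apply RtoC_inj in H. lra.
Qed.

Lemma Rderive_eps (F : R -> R) (l eps : R) :
  is_derive F 0 l -> 0 < eps -> exists del, 0 < del /\
  forall x, Rabs x < del -> Rabs (F x - F 0 - l * x) <= eps * Rabs x.
Proof.
  intros [_ H] He.
  destruct (H 0 (fun P HP => HP) (mkposreal eps He)) as [del Hd].
  exists del. split; [apply cond_pos|]. intros x Hx.
  assert (Hb : ball 0 del x).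
  { change (Rabs (x - 0) < del). rewrite Rminus_0_r. exact Hx. }
  specialize (Hd x Hb). simpl in Hd.
  change (Rabs (F x - F 0 - (x - 0) * l) <= eps * Rabs (x - 0)) in Hd.
  rewrite Rminus_0_r, (Rmult_comm x l) in Hd. exact Hd.
Qed.

Lemma cdiff_Cexp_0 : cdiff Cexp 0 1.
Proof.
  intros eps He.
  (* Each coordinate of the remainder turns out to be at most 4 e |w|, hence 8 e |w| in total.
     Requiring |w| < e as well absorbs the product of the two coordinates. *)
  set (e := Rmin 1 (eps / 10)).
  assert (Hpos : 0 < e) by (apply Rmin_pos; lra).
  assert (He1 : e <= 1) by apply Rmin_l. assert (He2 : e <= eps / 10) by apply Rmin_r.
  clearbody e.
  assert (D1 : is_derive exp 0 1) by (auto_derive; [exact I|rewrite exp_0; ring]).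
  assert (D2 : is_derive cos 0 0) by (auto_derive; [exact I|rewrite sin_0; ring]).
  assert (D3 : is_derive sin 0 1) by (auto_derive; [exact I|rewrite cos_0; ring]).
  destruct (Rderive_eps _ _ _ D1 Hpos) as [d1 [Hd1 H1]].
  destruct (Rderive_eps _ _ _ D2 Hpos) as [d2 [Hd2 H2]].
  destruct (Rderive_eps _ _ _ D3 Hpos) as [d3 [Hd3 H3]].
  exists (Rmin (Rmin d1 e) (Rmin d2 d3)).
  split; [repeat apply Rmin_pos; assumption|].
  intros w Hw. replace (w - 0)%C with w in * by ring.
  destruct w as [x y].
  pose proof (re_le_Cmod (x, y)) as Hx. pose proof (im_le_Cmod (x, y)) as Hy. simpl in Hx, Hy.
  assert (Cmod (x, y) < d1 /\ Cmod (x, y) < e /\ Cmod (x, y) < d2 /\ Cmod (x, y) < d3) as [M1 [M2 [M3 M4]]].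
  { pose proof (Rmin_l (Rmin d1 e) (Rmin d2 d3)). pose proof (Rmin_r (Rmin d1 e) (Rmin d2 d3)).
    pose proof (Rmin_l d1 e). pose proof (Rmin_r d1 e).
    pose proof (Rmin_l d2 d3). pose proof (Rmin_r d2 d3). lra. }
  set (m := Cmod (x, y)) in *.
  specialize (H1 x ltac:(lra)). specialize (H2 y ltac:(lra)). specialize (H3 y ltac:(lra)).
  rewrite exp_0 in H1. rewrite cos_0 in H2. rewrite sin_0 in H3.
  pose proof (Rabs_pos x) as px. pose proof (Rabs_pos y) as py.
  assert (B1 : Rabs (exp x - 1 - 1 * x) <= e * m) by nra.
  assert (B2 : Rabs (cos y - 1 - 0 * y) <= e * m) by nra.
  assert (B3 : Rabs (sin y - 0 - 1 * y) <= e * m) by nra.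
  apply Rabs_le_between in B1. apply Rabs_le_between in B2. apply Rabs_le_between in B3.
  apply Rabs_le_between in Hx. apply Rabs_le_between in Hy.
  eapply Rle_trans; [apply Cmod_sum_le|].
  rewrite Cexp_0. unfold Cexp, Cminus, Cplus, Copp, Cmult, RtoC, Re, Im; simpl.
  pose proof (COS_bound y) as Cb. pose proof (SIN_bound y) as Sb.
  assert (0 <= m) by apply Cmod_ge_0.
  assert (e * m <= eps / 10 * m) by nra. assert (e * m <= 1 * m) by nra. assert (m * m <= e * m) by nra.
  assert (T1 : Rabs (exp x * cos y + - (1) + - (1 * x - 0 * y)) <= 4 * (e * m)).
  { apply Rabs_le.
    replace (exp x * cos y + - (1) + - (1 * x - 0 * y))
      with ((exp x - 1 - 1 * x) * cos y + (cos y - 1 - 0 * y) * (1 + x)) by ring.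
    assert (- 1 <= x <= 1) by lra.
    assert (E1 : - (e * m) <= (exp x - 1 - 1 * x) * cos y <= e * m) by (split; nra).
    assert (E2 : - (2 * (e * m)) <= (cos y - 1 - 0 * y) * (1 + x) <= 2 * (e * m)) by (split; nra).
    lra. }
  assert (two_pi : Rabs (exp x * sin y + - 0 + - (1 * y + 0 * x)) <= 4 * (e * m)).
  { apply Rabs_le.
    replace (exp x * sin y + - 0 + - (1 * y + 0 * x))
      with ((exp x - 1 - 1 * x) * sin y + (sin y - 0 - 1 * y) * (1 + x) + x * y) by ring.
    assert (- 1 <= x <= 1) by lra.
    assert (E1 : - (e * m) <= (exp x - 1 - 1 * x) * sin y <= e * m) by (split; nra).
    assert (E2 : - (2 * (e * m)) <= (sin y - 0 - 1 * y) * (1 + x) <= 2 * (e * m)) by (split; nra).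
    assert (E3 : - (e * m) <= x * y <= e * m) by (split; nra).
    lra. }
  match goal with |- Rabs ?a + Rabs ?b <= _ =>
    replace a with (exp x * cos y + - (1) + - (1 * x - 0 * y)) by ring;
    replace b with (exp x * sin y + - 0 + - (1 * y + 0 * x)) by ring end.
  lra.
Qed.

(** The functional equation carries the derivative at 0 to [z]. *)
Lemma cdiff_Cexp (z : C) : cdiff Cexp z (Cexp z).
Proof.
  assert (H : cdiff (fun w => Cexp (w - z)) z 1).
  { eapply cdiff_eq; [|apply (cdiff_comp Cexp (fun w => w - z)%C z 1 1)].
    - ring.
    - replace (z - z)%C with (RtoC 0) by ring. apply cdiff_Cexp_0.
    - eapply cdiff_eq; [|apply cdiff_minus; [apply cdiff_id|apply cdiff_const]]. ring. }
  eapply cdiff_ext_all; [|eapply cdiff_eq; [|exact (cdiff_scal (Cexp z) _ _ _ H)]].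
  - intros w. simpl. rewrite <- Cexp_plus. f_equal. ring.
  - ring.
Qed.

Lemma cdiff_exp_comp (F : C -> C) (z d : C) :
  cdiff F z d -> cdiff (fun w => Cexp (F w)) z (Cexp (F z) * d)%C.
Proof. intros H. exact (cdiff_comp _ F _ _ _ (cdiff_Cexp (F z)) H). Qed.

Lemma cdiff_Re (F : C -> C) (t : R) (d : C) :
  cdiff F t d -> is_derive (fun x : R => Re (F x)) t (Re d).
Proof.
  intros H. split; [apply is_linear_scal_l|].
  intros x Hx eps. apply (is_filter_lim_locally_unique (V := AbsRing_NormedModule R_AbsRing)) in Hx. subst x.
  destruct (H eps (cond_pos eps)) as [del [Hd Hw]].
  exists (mkposreal del Hd). intros y Hb.
  change (Rabs (y - t) < del) in Hb.
  change (Rabs (Re (F y) - Re (F t) - (y - t) * Re d) <= eps * Rabs (y - t)).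
  specialize (Hw (RtoC y)).
  rewrite <- RtoC_minus, Cmod_R in Hw. specialize (Hw Hb).
  eapply Rle_trans; [|exact Hw].
  replace (Re (F y) - Re (F t) - (y - t) * Re d) with (Re (F y - F t - d * RtoC (y - t))%C).
  - apply re_le_Cmod.
  - destruct (F y), (F t), d. simpl. ring.
Qed.

Lemma cdiff_Im (F : C -> C) (t : R) (d : C) :
  cdiff F t d -> is_derive (fun x : R => Im (F x)) t (Im d).
Proof.
  intros H. pose proof (cdiff_Re _ _ _ (cdiff_scal (- Ci) _ _ _ H)) as H1.
  replace (Im d) with (Re (- Ci * d)) by (destruct d; simpl; ring).
  eapply is_derive_ext; [|exact H1]. intros x. simpl. destruct (F x); simpl; ring.
Qed.

(** * Integrals along segments *)

Lemma curve_continuous (k : R -> C) (t : R) :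
  (forall eps, 0 < eps -> exists del, 0 < del /\
     forall s, Rabs (s - t) < del -> Cmod (k s - k t) < eps) ->
  @continuous R_UniformSpace C_R_CompleteNormedModule k t.
Proof.
  intros H P [eps HP].
  destruct (H eps (cond_pos eps)) as [del [Hd Hw]].
  exists (mkposreal _ Hd). intros s Hs. apply HP.
  specialize (Hw s Hs).
  split.
  - change (Rabs (Re (k s - k t)) < eps).
    eapply Rle_lt_trans; [apply re_le_Cmod | exact Hw].
  - change (Rabs (Im (k s - k t)) < eps).
    eapply Rle_lt_trans; [apply im_le_Cmod | exact Hw].
Qed.

Lemma cdiff_curve (F : C -> C) (t : R) (d : C) :
  cdiff F t d ->
  @is_derive R_AbsRing C_R_NormedModule (fun x : R => F x) t d.
Proof.
  intros H. split; [apply is_linear_scal_l|].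
  intros x Hx eps.
  apply (is_filter_lim_locally_unique (V := AbsRing_NormedModule R_AbsRing)) in Hx. subst x.
  destruct (H eps (cond_pos eps)) as [del [Hd Hw]].
  exists (mkposreal del Hd). intros y Hb.
  change (Rabs (y - t) < del) in Hb.
  specialize (Hw (RtoC y)).
  rewrite <- RtoC_minus, Cmod_R in Hw. specialize (Hw Hb).
  rewrite Cmult_comm, <- scal_R_Cmult, Cmod_norm in Hw. exact Hw.
Qed.

(** Equalities of integrands arrive typed in the carrier of the real module; retyping them in [C]
    lets [ring] find its structure. *)
Ltac Ceq := match goal with |- @eq _ ?x ?y => change (@eq C x y) end.

Definition seg (a b : C) (t : R) : C := (a + t * (b - a))%C.

(** Shaped like [cesaro], which thus becomes a [segint] from 0 by comparing integrands. Circle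
    integrals are also of this form, pulled back to the real segment from 0 to 2 PI. *)
Definition segint (F : C -> C) (a b : C) : C :=
  @RInt C_R_CompleteNormedModule (fun t => F (seg a b t) * (b - a))%C 0 1.

Definition cont_seg (F : C -> C) (a b : C) : Prop :=
  forall t : R, 0 <= t <= 1 -> ccont F (seg a b t).

Lemma seg_integrand_continuous (F : C -> C) (a b : C) (t : R) :
  ccont F (seg a b t) ->
  @continuous R_UniformSpace C_R_CompleteNormedModule
    (fun t => F (seg a b t) * (b - a))%C t.
Proof.
  intros H. apply curve_continuous. intros eps He.
  set (L := Cmod (b - a) + 1).
  assert (HL : 1 <= L) by (unfold L; pose proof (Cmod_ge_0 (b - a)); lra).
  destruct (H (eps / L)) as [del [Hd Hw]]; [apply Rdiv_lt_0_compat; lra|].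
  exists (del / L). split; [apply Rdiv_lt_0_compat; lra|]. intros s Hs.
  replace (F (seg a b s) * (b - a) - F (seg a b t) * (b - a))%C
    with ((F (seg a b s) - F (seg a b t)) * (b - a))%C by ring.
  assert (Hm : Cmod (seg a b s - seg a b t) < del).
  { unfold seg. replace (a + s * (b - a) - (a + t * (b - a)))%C with (RtoC (s - t) * (b - a))%C
      by (rewrite RtoC_minus; ring).
    rewrite Cmod_mult, Cmod_R.
    apply Rle_lt_trans with (Rabs (s - t) * L).
    - apply Rmult_le_compat_l; [apply Rabs_pos|unfold L; lra].
    - apply Rmult_lt_reg_r with (/ L); [apply Rinv_0_lt_compat; lra|].
      replace (Rabs (s - t) * L * / L) with (Rabs (s - t)) by (field; lra). exact Hs. }
  specialize (Hw _ Hm). rewrite Cmod_mult.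
  pose proof (Cmod_ge_0 (F (seg a b s) - F (seg a b t))).
  apply Rle_lt_trans with (Cmod (F (seg a b s) - F (seg a b t)) * L).
  - apply Rmult_le_compat_l; [lra|unfold L; lra].
  - apply Rmult_lt_reg_r with (/ L); [apply Rinv_0_lt_compat; lra|].
    replace (Cmod (F (seg a b s) - F (seg a b t)) * L * / L)
      with (Cmod (F (seg a b s) - F (seg a b t))) by (field; lra).
    exact Hw.
Qed.

Lemma seg_ex_RInt (F : C -> C) (a b : C) (x y : R) :
  cont_seg F a b -> 0 <= x <= 1 -> 0 <= y <= 1 ->
  @ex_RInt C_R_CompleteNormedModule (fun t => F (seg a b t) * (b - a))%C x y.
Proof.
  intros H Hx Hy. apply (ex_RInt_continuous (V := C_R_CompleteNormedModule)).
  intros t Ht. apply seg_integrand_continuous, H.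
  split; [eapply Rle_trans; [|apply Ht]; apply Rmin_glb; lra|].
  eapply Rle_trans; [apply Ht|]; apply Rmax_lub; lra.
Qed.

Lemma segint_bound (F : C -> C) (a b : C) (M : R) :
  cont_seg F a b -> (forall t, 0 <= t <= 1 -> Cmod (F (seg a b t)) <= M) ->
  Cmod (segint F a b) <= M * Cmod (b - a).
Proof.
  intros Hc HM.
  pose proof (RInt_correct (V := C_R_CompleteNormedModule) _ _ _
    (seg_ex_RInt F a b 0 1 Hc ltac:(lra) ltac:(lra))) as HI.
  apply Rle_trans with ((1 - 0) * (M * Cmod (b - a))); [|lra].
  rewrite (Cmod_norm (segint F a b)).
  apply (norm_RInt_le_const (V := C_R_NormedModule)
    (fun t => F (seg a b t) * (b - a))%C 0 1 (segint F a b)); [lra| |exact HI].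
  intros t Ht. apply Rle_trans with (Cmod (F (seg a b t) * (b - a)));
    [right; symmetry; apply Cmod_norm|]. rewrite Cmod_mult. apply Rmult_le_compat_r; [apply Cmod_ge_0|]. apply HM, Ht.
Qed.

Lemma segint_refl (F : C -> C) (a : C) : ccont F a -> segint F a a = 0.
Proof.
  intros H. assert (E : forall t : R, seg a a t = a) by (intros t; unfold seg; ring).
  apply Cmod_eq_0, Rle_antisym; [|apply Cmod_ge_0].
  apply Rle_trans with (Cmod (F a) * Cmod (a - a)).
  - apply segint_bound; intros t _; rewrite E; [exact H|lra].
  - replace (a - a)%C with (RtoC 0) by ring. rewrite Cmod_0. lra.
Qed.

Lemma segint_rev (F : C -> C) (a b : C) :
  cont_seg F a b -> segint F b a = (- segint F a b)%C.
Proof.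
  intros Hc. unfold segint.
  pose proof (RInt_comp_lin (V := C_R_CompleteNormedModule)
    (fun t => F (seg a b t) * (b - a))%C (-1) 1 0 1) as H.
  replace (-1 * 0 + 1) with 1 in H by ring. replace (-1 * 1 + 1) with 0 in H by ring.
  specialize (H (seg_ex_RInt F a b 1 0 Hc ltac:(lra) ltac:(lra))).
  pose proof (opp_RInt_swap (V := C_R_CompleteNormedModule)
    (fun t => F (seg a b t) * (b - a))%C 0 1
    (seg_ex_RInt F a b 0 1 Hc ltac:(lra) ltac:(lra))) as Hs.
  etransitivity; [|symmetry; exact Hs]. etransitivity; [|exact H].
  apply (RInt_ext (V := C_R_CompleteNormedModule)). intros t _.
  rewrite scal_R_Cmult. unfold seg.
  replace (a + RtoC (-1 * t + 1) * (b - a))%C with (b + t * (a - b))%C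
    by (rewrite RtoC_plus, RtoC_mult; ring).
  replace (RtoC (-1)) with (- RtoC 1)%C by (rewrite <- RtoC_opp; f_equal; lra). Ceq. ring.
Qed.

Lemma segint_split (F : C -> C) (a b m : C) (s : R) :
  0 <= s <= 1 -> m = seg a b s -> cont_seg F a b ->
  segint F a b = (segint F a m + segint F m b)%C.
Proof.
  intros Hs -> Hc. unfold segint.
  pose proof (RInt_Chasles (V := C_R_CompleteNormedModule)
    (fun t => F (seg a b t) * (b - a))%C 0 s 1) as HC.
  etransitivity; [symmetry; apply HC; apply seg_ex_RInt; first [exact Hc|lra]|].
  apply (f_equal2 Cplus).
  - pose proof (RInt_comp_lin (V := C_R_CompleteNormedModule)
      (fun t => F (seg a b t) * (b - a))%C s 0 0 1) as H.
    replace (s * 0 + 0) with 0 in H by ring. replace (s * 1 + 0) with s in H by ring.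
    etransitivity; [symmetry; apply H; apply seg_ex_RInt; first [exact Hc|lra]|].
    symmetry.
    apply (RInt_ext (V := C_R_CompleteNormedModule)). intros t _.
    rewrite scal_R_Cmult. unfold seg.
    replace (a + RtoC (s * t + 0) * (b - a))%C with (a + t * (a + s * (b - a) - a))%C
      by (rewrite RtoC_plus, RtoC_mult; ring).
    Ceq. ring.
  - pose proof (RInt_comp_lin (V := C_R_CompleteNormedModule)
      (fun t => F (seg a b t) * (b - a))%C (1 - s) s 0 1) as H.
    replace ((1 - s) * 0 + s) with s in H by ring. replace ((1 - s) * 1 + s) with 1 in H by ring.
    etransitivity; [symmetry; apply H; apply seg_ex_RInt; first [exact Hc|lra]|].
    symmetry.
    apply (RInt_ext (V := C_R_CompleteNormedModule)). intros t _.
    rewrite scal_R_Cmult. unfold seg.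
    replace (a + RtoC ((1 - s) * t + s) * (b - a))%C with
      (a + s * (b - a) + t * (b - (a + s * (b - a))))%C
      by (rewrite RtoC_plus, RtoC_mult, RtoC_minus; ring).
    rewrite RtoC_minus. Ceq. ring.
Qed.

Lemma segint_minus (F G : C -> C) (a b : C) :
  cont_seg F a b -> cont_seg G a b ->
  segint (fun w => F w - G w)%C a b = (segint F a b - segint G a b)%C.
Proof.
  intros HF HG. unfold segint.
  etransitivity; [|apply (RInt_minus (V := C_R_CompleteNormedModule));
    apply seg_ex_RInt; first [assumption|lra]].
  apply (RInt_ext (V := C_R_CompleteNormedModule)). intros t _.
  change ((F (seg a b t) - G (seg a b t)) * (b - a)
    = F (seg a b t) * (b - a) - G (seg a b t) * (b - a))%C. ring.
Qed.

Lemma segint_primitive (F Phi : C -> C) (a b : C) :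
  cont_seg F a b ->
  (forall t, 0 <= t <= 1 -> cdiff Phi (seg a b t) (F (seg a b t))) ->
  segint F a b = (Phi b - Phi a)%C.
Proof.
  intros HF HD. unfold segint.
  apply (is_RInt_unique (V := C_R_CompleteNormedModule)).
  replace (Phi b) with (Phi (seg a b 1)) by (f_equal; unfold seg; ring).
  replace (Phi a) with (Phi (seg a b 0)) by (f_equal; unfold seg; ring).
  apply (is_RInt_derive (V := C_R_CompleteNormedModule) (fun t => Phi (seg a b t))).
  - intros t Ht. rewrite Rmin_left, Rmax_right in Ht by lra.
    apply (cdiff_curve (fun w => Phi (a + w * (b - a))%C)).
    apply (cdiff_comp Phi (fun w => a + w * (b - a))%C); [apply HD, Ht|].
    eapply cdiff_eq; [|apply cdiff_plus; [apply cdiff_const|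
      apply cdiff_mult; [apply cdiff_id|apply cdiff_const]]]. cbv beta. ring.
  - intros t Ht. rewrite Rmin_left, Rmax_right in Ht by lra.
    apply seg_integrand_continuous, HF, Ht.
Qed.

Definition tri (F : C -> C) (a b c : C) : C :=
  (segint F a b + segint F b c + segint F c a)%C.

Definition mid (a b : C) : C := seg a b (1 / 2).

(** The tail of the geometric series from [n] on is 2 M / 2^n, so the intervals from [v n] to [w n]
    are nested. The supremum of their left ends is the limit, with an explicit rate. *)
Lemma geometric_limit_R (u : nat -> R) (M : R) :
  0 <= M -> (forall n, Rabs (u (S n) - u n) <= M * (/ 2) ^ n) ->
  exists p, forall n, Rabs (u n - p) <= 2 * M * (/ 2) ^ n.
Proof.
  intros HM Hu.
  set (v := fun n => u n - 2 * M * (/ 2) ^ n).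
  set (w := fun n => u n + 2 * M * (/ 2) ^ n).
  assert (Hv : forall n, v n <= v (S n)).
  { intros n. specialize (Hu n). apply Rabs_le_between in Hu. unfold v. simpl. lra. }
  assert (Hw : forall n, w (S n) <= w n).
  { intros n. specialize (Hu n). apply Rabs_le_between in Hu. unfold w. simpl. lra. }
  assert (Hvk : forall n k, v n <= v (n + k)%nat).
  { intros n k. induction k as [|k IH]; [rewrite Nat.add_0_r; lra|].
    rewrite Nat.add_succ_r. specialize (Hv (n + k)%nat). lra. }
  assert (Hwk : forall n k, w (n + k)%nat <= w n).
  { intros n k. induction k as [|k IH]; [rewrite Nat.add_0_r; lra|].
    rewrite Nat.add_succ_r. specialize (Hw (n + k)%nat). lra. }
  assert (Hvw : forall n m, v n <= w m).
  { intros n m. specialize (Hvk n m). specialize (Hwk m n). rewrite Nat.add_comm in Hwk.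
    assert (v (n + m)%nat <= w (n + m)%nat); [|lra].
    unfold v, w. assert (0 <= M * (/ 2) ^ (n + m)); [|lra].
    apply Rmult_le_pos; [lra|]. apply pow_le. lra. }
  destruct (completeness (fun x => exists n, x = v n)) as [p [Hp1 Hp2]].
  - exists (w 0%nat). intros x [n ->]. apply Hvw.
  - exists (v 0%nat), 0%nat. reflexivity.
  - exists p. intros n. apply Rabs_le_between.
    assert (v n <= p) by (apply Hp1; exists n; reflexivity).
    assert (p <= w n) by (apply Hp2; intros x [m ->]; apply Hvw).
    unfold v, w in *. lra.
Qed.

Lemma geometric_limit (u : nat -> C) (M : R) :
  0 <= M -> (forall n, Cmod (u (S n) - u n) <= M * (/ 2) ^ n) ->
  exists p, forall n, Cmod (u n - p) <= 4 * M * (/ 2) ^ n.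
Proof.
  intros HM Hu.
  destruct (geometric_limit_R (fun n => Re (u n)) M HM) as [x Hx].
  { intros n. eapply Rle_trans; [|apply Hu]. apply (re_le_Cmod (u (S n) - u n)). }
  destruct (geometric_limit_R (fun n => Im (u n)) M HM) as [y Hy].
  { intros n. eapply Rle_trans; [|apply Hu]. apply (im_le_Cmod (u (S n) - u n)). }
  exists (x, y). intros n. eapply Rle_trans; [apply Cmod_sum_le|].
  specialize (Hx n). specialize (Hy n).
  change (Rabs (Re (u n) - x) + Rabs (Im (u n) - y) <= 4 * M * (/ 2) ^ n). lra.
Qed.

(** * Goursat's theorem *)

Definition convex_set (S : C -> Prop) : Prop :=
  forall u v t, S u -> S v -> 0 <= t <= 1 -> S (seg u v t).

Lemma cont_seg_convex (S : C -> Prop) (F : C -> C) (a b : C) :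
  convex_set S -> (forall z, S z -> ccont F z) -> S a -> S b -> cont_seg F a b.
Proof. intros HS HF Ha Hb t Ht. apply HF, HS; assumption. Qed.

Lemma mid_half (a b : C) : mid a b = ((a + b) / 2)%C.
Proof.
  unfold mid, seg. rewrite RtoC_div by lra. field.
Qed.

Lemma tri_subdivide (S : C -> Prop) (F : C -> C) (a b c : C) :
  convex_set S -> (forall z, S z -> ccont F z) -> S a -> S b -> S c ->
  tri F a b c =
    (tri F a (mid a b) (mid c a) + tri F (mid a b) b (mid b c)
     + tri F (mid c a) (mid b c) c + tri F (mid a b) (mid b c) (mid c a))%C.
Proof.
  intros HS HF Ha Hb Hc.
  assert (Hm1 : S (mid a b)) by (apply HS; first [assumption|lra]).
  assert (Hm2 : S (mid b c)) by (apply HS; first [assumption|lra]).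
  assert (Hm3 : S (mid c a)) by (apply HS; first [assumption|lra]).
  pose proof (cont_seg_convex S F) as K.
  unfold tri.
  rewrite (segint_split F a b (mid a b) (1 / 2)) by first [lra|reflexivity|auto].
  rewrite (segint_split F b c (mid b c) (1 / 2)) by first [lra|reflexivity|auto].
  rewrite (segint_split F c a (mid c a) (1 / 2)) by first [lra|reflexivity|auto].
  rewrite (segint_rev F (mid c a) (mid a b)) by auto.
  rewrite (segint_rev F (mid a b) (mid b c)) by auto.
  rewrite (segint_rev F (mid b c) (mid c a)) by auto.
  ring.
Qed.

Definition perimeter (t : C * C * C) : R :=
  let '(a, b, c) := t in Cmod (b - a) + Cmod (c - b) + Cmod (a - c).

Definition tri_triple (F : C -> C) (t : C * C * C) : C :=
  let '(a, b, c) := t in tri F a b c.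

Definition first_vertex (t : C * C * C) : C := let '(a, _, _) := t in a.

Definition inside (S : C -> Prop) (t : C * C * C) : Prop :=
  let '(a, b, c) := t in S a /\ S b /\ S c.

Lemma Cmod_half (z : C) : Cmod (z / 2) = Cmod z / 2.
Proof.
  rewrite Cmod_div, Cmod_R, Rabs_right; [reflexivity|lra|].
  intros E; apply RtoC_inj in E; lra.
Qed.

(** One of the four midpoint triangles carries at least a quarter of the integral. The bound on the
    move of the first vertex makes these vertices converge under iteration. *)
Lemma tri_step (S : C -> Prop) (F : C -> C) (t : C * C * C) :
  convex_set S -> (forall z, S z -> ccont F z) -> inside S t ->
  exists t', inside S t' /\ perimeter t' = perimeter t / 2 /\
    Cmod (first_vertex t' - first_vertex t) <= perimeter t /\ Cmod (tri_triple F t) <= 4 * Cmod (tri_triple F t').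
Proof.
  intros HS HF. destruct t as [[a b] c]. intros [Ha [Hb Hc]].
  assert (Hm1 : S (mid a b)) by (apply HS; first [assumption|lra]).
  assert (Hm2 : S (mid b c)) by (apply HS; first [assumption|lra]).
  assert (Hm3 : S (mid c a)) by (apply HS; first [assumption|lra]).
  pose proof (tri_subdivide S F a b c HS HF Ha Hb Hc) as E.
  set (T1 := tri F a (mid a b) (mid c a)) in *.
  set (two_pi := tri F (mid a b) b (mid b c)) in *.
  set (T3 := tri F (mid c a) (mid b c) c) in *.
  set (T4 := tri F (mid a b) (mid b c) (mid c a)) in *.
  assert (Hsum : Cmod (tri F a b c) <= Cmod T1 + Cmod two_pi + Cmod T3 + Cmod T4).
  { rewrite E. eapply Rle_trans; [apply Cmod_triangle|]. apply Rplus_le_compat_r.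
    eapply Rle_trans; [apply Cmod_triangle|]. apply Rplus_le_compat_r. apply Cmod_triangle. }
  assert (N2 : RtoC 2 <> RtoC 0) by (intros E0; apply RtoC_inj in E0; lra).
  pose proof (Cmod_ge_0 (b - a)). pose proof (Cmod_ge_0 (c - b)). pose proof (Cmod_ge_0 (a - c)).
  assert (S1 : Cmod (mid a b - a) = Cmod (b - a) / 2)
    by (rewrite <- Cmod_half, mid_half; f_equal; field; exact N2).
  assert (S2 : Cmod (b - mid a b) = Cmod (b - a) / 2)
    by (rewrite <- Cmod_half, mid_half; f_equal; field; exact N2).
  assert (S3 : Cmod (mid b c - b) = Cmod (c - b) / 2)
    by (rewrite <- Cmod_half, mid_half; f_equal; field; exact N2).
  assert (S4 : Cmod (c - mid b c) = Cmod (c - b) / 2)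
    by (rewrite <- Cmod_half, mid_half; f_equal; field; exact N2).
  assert (S5 : Cmod (mid c a - c) = Cmod (a - c) / 2)
    by (rewrite <- Cmod_half, mid_half; f_equal; field; exact N2).
  assert (S6 : Cmod (a - mid c a) = Cmod (a - c) / 2)
    by (rewrite <- Cmod_half, mid_half; f_equal; field; exact N2).
  assert (S7 : Cmod (mid b c - mid a b) = Cmod (a - c) / 2)
    by (rewrite Cmod_sym, <- Cmod_half, !mid_half; f_equal; field; exact N2).
  assert (S8 : Cmod (mid c a - mid b c) = Cmod (b - a) / 2)
    by (rewrite Cmod_sym, <- Cmod_half, !mid_half; f_equal; field; exact N2).
  assert (S9 : Cmod (mid a b - mid c a) = Cmod (c - b) / 2)
    by (rewrite Cmod_sym, <- Cmod_half, !mid_half; f_equal; field; exact N2).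
  pose proof (Cmod_sym (mid c a) a). pose proof (Cmod_sym (mid b c) (mid a b)).
  pose proof (Cmod_sym (mid c a) (mid b c)). pose proof (Cmod_sym (mid a b) (mid c a)).
  assert (S0 : Cmod (a - a) = 0) by (replace (a - a)%C with (RtoC 0) by ring; apply Cmod_0).
  simpl.
  destruct (Rle_dec (Cmod (tri F a b c)) (4 * Cmod T1)) as [L1|L1].
  { exists (a, mid a b, mid c a). simpl. fold T1. repeat split; first [assumption|lra]. }
  destruct (Rle_dec (Cmod (tri F a b c)) (4 * Cmod two_pi)) as [L2|L2].
  { exists (mid a b, b, mid b c). simpl. fold two_pi. repeat split; first [assumption|lra]. }
  destruct (Rle_dec (Cmod (tri F a b c)) (4 * Cmod T3)) as [L3|L3].
  { exists (mid c a, mid b c, c). simpl. fold T3. repeat split; first [assumption|lra]. }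
  (* If the three corner triangles all fall short of a quarter, [Hsum] leaves more than a quarter to
     the medial one. *)
  exists (mid a b, mid b c, mid c a). simpl. fold T4. repeat split; first [assumption|lra].
Qed.

(** Choice is applied on the subtype of triangles with vertices in [S], so that the chosen step is a
    total map and can be iterated. *)
Lemma nested_triangles (S : C -> Prop) (F : C -> C) (t : C * C * C) :
  convex_set S -> (forall z, S z -> ccont F z) -> inside S t ->
  exists u : nat -> C * C * C, forall n, inside S (u n) /\
    perimeter (u n) = perimeter t * (/ 2) ^ n /\ Cmod (tri_triple F t) <= 4 ^ n * Cmod (tri_triple F (u n)) /\
    Cmod (first_vertex (u (Datatypes.S n)) - first_vertex (u n)) <= perimeter t * (/ 2) ^ n.
Proof.
  intros HS HF Ht.
  assert (HE : forall x : {x | inside S x}, exists y : {y | inside S y},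
    perimeter (proj1_sig y) = perimeter (proj1_sig x) / 2 /\
    Cmod (first_vertex (proj1_sig y) - first_vertex (proj1_sig x)) <= perimeter (proj1_sig x) /\
    Cmod (tri_triple F (proj1_sig x)) <= 4 * Cmod (tri_triple F (proj1_sig y))).
  { intros [x Hx]. destruct (tri_step S F x HS HF Hx) as [y [Hy H]].
    exists (exist _ y Hy). exact H. }
  apply functional_choice in HE. destruct HE as [step Hstep].
  set (u := fun n => Nat.iter n step (exist _ t Ht)).
  exists (fun n => proj1_sig (u n)).
  assert (P : forall n, perimeter (proj1_sig (u n)) = perimeter t * (/ 2) ^ n).
  { intros n. induction n as [|n IH]; [simpl; ring|].
    destruct (Hstep (u n)) as [H1 _]. change (u (Datatypes.S n)) with (step (u n)).
    rewrite H1, IH. simpl. field. }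
  intros n. split; [apply (proj2_sig (u n))|]. split; [apply P|]. split.
  - induction n as [|n IH]; [simpl; lra|].
    destruct (Hstep (u n)) as [_ [_ H3]]. change (u (Datatypes.S n)) with (step (u n)).
    simpl. assert (0 < 4 ^ n) by (apply pow_lt; lra). nra.
  - destruct (Hstep (u n)) as [_ [H2 _]]. rewrite <- P. exact H2.
Qed.

Lemma seg_dist (a b : C) (t : R) : 0 <= t <= 1 -> Cmod (seg a b t - a) <= Cmod (b - a).
Proof.
  intros Ht. unfold seg. replace (a + t * (b - a) - a)%C with (t * (b - a))%C by ring.
  rewrite Cmod_mult, Cmod_R, Rabs_right by lra. pose proof (Cmod_ge_0 (b - a)). nra.
Qed.

Lemma tri_bound (F : C -> C) (a b c : C) (M : R) :
  cont_seg F a b -> cont_seg F b c -> cont_seg F c a ->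
  (forall t, 0 <= t <= 1 -> Cmod (F (seg a b t)) <= M) ->
  (forall t, 0 <= t <= 1 -> Cmod (F (seg b c t)) <= M) ->
  (forall t, 0 <= t <= 1 -> Cmod (F (seg c a t)) <= M) ->
  Cmod (tri F a b c) <= M * perimeter (a, b, c).
Proof.
  intros H1 H2 H3 B1 B2 B3. unfold tri, perimeter.
  pose proof (segint_bound F a b M H1 B1). pose proof (segint_bound F b c M H2 B2).
  pose proof (segint_bound F c a M H3 B3).
  eapply Rle_trans; [apply Cmod_triangle|].
  eapply Rle_trans; [apply Rplus_le_compat_r; apply Cmod_triangle|]. lra.
Qed.

Lemma cdiff_affine (c k z : C) : cdiff (fun w => c + k * w)%C z k.
Proof.
  eapply cdiff_eq; [|apply cdiff_plus; [apply cdiff_const|apply cdiff_scal, cdiff_id]].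
  cbv beta. ring.
Qed.

Lemma tri_affine (c k a b d : C) : tri (fun w => c + k * w)%C a b d = 0.
Proof.
  assert (E : forall x y, segint (fun w => c + k * w)%C x y =
    ((c * y + k / 2 * (y * y)) - (c * x + k / 2 * (x * x)))%C).
  { intros x y. apply (segint_primitive _ (fun w => c * w + k / 2 * (w * w))%C).
    - intros t _. eapply cdiff_ccont, cdiff_affine.
    - intros t _. eapply cdiff_eq; [|apply cdiff_plus; [apply cdiff_scal, cdiff_id|
        apply cdiff_scal, cdiff_sqr]]. cbv beta. field. }
  unfold tri. rewrite !E. ring.
Qed.

Lemma tri_minus (F G : C -> C) (a b c : C) :
  cont_seg F a b -> cont_seg F b c -> cont_seg F c a ->
  cont_seg G a b -> cont_seg G b c -> cont_seg G c a ->
  tri (fun w => F w - G w)%C a b c = (tri F a b c - tri G a b c)%C.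
Proof. intros. unfold tri. rewrite !segint_minus by assumption. ring. Qed.

(** Closedness of [S], the second hypothesis, puts the limit point of the nested triangles into [S],
    where [F] is known to be differentiable. Near that point [F] is an affine function, with zero
    integral, up to a small multiple of the diameter; perimeter times diameter compensates the
    factor 4^n. *)
Lemma goursat (S : C -> Prop) (F : C -> C) (a b c : C) :
  convex_set S ->
  (forall p, (forall eps, 0 < eps -> exists w, S w /\ Cmod (w - p) < eps) -> S p) ->
  (forall z, S z -> exists d, cdiff F z d) ->
  S a -> S b -> S c -> tri F a b c = 0.
Proof.
  intros HS Hcl HD Ha Hb Hc.
  assert (HF : forall z, S z -> ccont F z).
  { intros z Hz. destruct (HD z Hz) as [d Hd]. eapply cdiff_ccont, Hd. }
  set (t := (a, b, c)).
  destruct (nested_triangles S F t HS HF) as [u Hu]; [repeat split; assumption|].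
  set (L := perimeter t) in *.
  assert (HL : 0 <= L).
  { unfold L, t, perimeter. pose proof (Cmod_ge_0 (b - a)). pose proof (Cmod_ge_0 (c - b)).
    pose proof (Cmod_ge_0 (a - c)). lra. }
  destruct (geometric_limit (fun n => first_vertex (u n)) L HL) as [p Hp].
  { intros n. apply Hu. }
  (* The first vertex is within 4 L / 2^n of [p]; a further L / 2^n reaches every point of the
     sides, whence the factor 5. *)
  assert (Hsmall : forall e, 0 < e -> exists n, 5 * L * (/ 2) ^ n < e).
  { intros e He.
    destruct (pow_lt_1_zero (/ 2)) with (y := e / (5 * L + 1)) as [N HN].
    - rewrite Rabs_right; lra.
    - apply Rdiv_lt_0_compat; lra.
    - exists N. specialize (HN N (Nat.le_refl _)).
      assert (0 < (/ 2) ^ N) by (apply pow_lt; lra).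
      rewrite Rabs_right in HN by lra.
      apply Rle_lt_trans with ((5 * L + 1) * (/ 2) ^ N); [nra|].
      apply Rmult_lt_reg_r with (/ (5 * L + 1)); [apply Rinv_0_lt_compat; lra|].
      replace ((5 * L + 1) * (/ 2) ^ N * / (5 * L + 1)) with ((/ 2) ^ N) by (field; lra).
      exact HN. }
  assert (Sp : S p).
  { apply Hcl. intros e He. destruct (Hsmall e He) as [n Hn].
    exists (first_vertex (u n)). split.
    - destruct (Hu n) as [Hin _]. destruct (u n) as [[x y] z]. apply Hin.
    - eapply Rle_lt_trans; [apply Hp|]. assert (0 <= (/ 2) ^ n) by (apply pow_le; lra). nra. }
  destruct (HD p Sp) as [d Hd].
  apply Cmod_eq_0. apply Rle_antisym; [|apply Cmod_ge_0].
  apply le_epsilon. intros eps He. rewrite Rplus_0_l.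
  set (e := eps / (5 * (L * L) + 1)).
  assert (HeL : 0 < 5 * (L * L) + 1) by nra.
  assert (Hpe : 0 < e) by (apply Rdiv_lt_0_compat; lra).
  destruct (Hd e Hpe) as [del [Hdel Hw]].
  destruct (Hsmall del Hdel) as [n Hn].
  destruct (Hu n) as [Hin [Hper [Hbig _]]]. specialize (Hp n).
  assert (Hq : 0 < (/ 2) ^ n) by (apply pow_lt; lra).
  set (q := (/ 2) ^ n) in *.
  destruct (u n) as [[x y] z]. destruct Hin as [Hx [Hy Hz]]. simpl in Hp, Hbig.
  (* The first-order Taylor polynomial of [F] at [p]. *)
  set (Af := fun w => (F p - d * p + d * w)%C).
  assert (Hb0 : Cmod (tri (fun w => F w - Af w)%C x y z) <= (e * (5 * L * q)) * perimeter (x, y, z)).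
  { assert (KA : forall w, ccont Af w) by (intros w; eapply cdiff_ccont, cdiff_affine).
    assert (KS : forall v w, S v -> S w -> cont_seg (fun w => F w - Af w)%C v w).
    { intros v w Hv Hw'. apply (cont_seg_convex S); try assumption.
      intros r Hr. destruct (HD r Hr) as [dr Hdr]. eapply cdiff_ccont.
      apply cdiff_minus; [exact Hdr|apply cdiff_affine]. }
    assert (KB : forall w, Cmod (w - x) <= L * q -> Cmod (F w - Af w) <= e * (5 * L * q)).
    { intros w Hwx.
      assert (Hwp : Cmod (w - p) <= 5 * L * q).
      { replace (w - p)%C with ((w - x) + (x - p))%C by ring.
        eapply Rle_trans; [apply Cmod_triangle|]. lra. }
      unfold Af. replace (F w - (F p - d * p + d * w))%C with (F w - F p - d * (w - p))%C by ring.
      eapply Rle_trans; [apply Hw; lra|]. apply Rmult_le_compat_l; lra. }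
    unfold perimeter in Hper.
    pose proof (Cmod_ge_0 (y - x)). pose proof (Cmod_ge_0 (z - y)). pose proof (Cmod_ge_0 (x - z)).
    apply tri_bound; auto; intros s Hs; apply KB.
    - eapply Rle_trans; [apply seg_dist, Hs|]. lra.
    - replace (seg y z s - x)%C with ((seg y z s - y) + (y - x))%C by ring.
      eapply Rle_trans; [apply Cmod_triangle|]. pose proof (seg_dist y z s Hs). lra.
    - replace (seg z x s - x)%C with ((seg z x s - z) + (z - x))%C by ring.
      eapply Rle_trans; [apply Cmod_triangle|]. pose proof (seg_dist z x s Hs).
      rewrite (Cmod_sym z x). rewrite (Cmod_sym x z) in *.
      assert (Cmod (z - x) <= Cmod (y - x) + Cmod (z - y)).
      { replace (z - x)%C with ((y - x) + (z - y))%C by ring. apply Cmod_triangle. }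
      lra. }
  rewrite tri_minus in Hb0;
    try (apply (cont_seg_convex S); assumption);
    try (intros r _; eapply cdiff_ccont, cdiff_affine).
  unfold Af in Hb0. rewrite tri_affine in Hb0.
  replace (tri F x y z - 0)%C with (tri F x y z) in Hb0 by ring.
  rewrite Hper in Hb0.
  apply Rle_trans with (4 ^ n * (e * (5 * L * q) * (L * q))).
  - eapply Rle_trans; [exact Hbig|]. apply Rmult_le_compat_l; [apply pow_le; lra|exact Hb0].
  - assert (Hq4 : 4 ^ n * (q * q) = 1).
    { unfold q. rewrite <- !Rpow_mult_distr. replace (4 * (/ 2 * / 2)) with 1 by field. apply pow1. }
    replace (4 ^ n * (e * (5 * L * q) * (L * q))) with (e * (5 * (L * L)) * (4 ^ n * (q * q))) by ring.
    rewrite Hq4, Rmult_1_r.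
    apply Rle_trans with (e * (5 * (L * L) + 1)); [apply Rmult_le_compat_l; lra|].
    unfold e. right. field. lra.
Qed.

(** * Primitives on a disk *)

Lemma Cmod_seg (a b : C) (t r : R) :
  0 <= t <= 1 -> Cmod a <= r -> Cmod b <= r -> Cmod (seg a b t) <= r.
Proof.
  intros Ht Ha Hb. unfold seg.
  replace (a + t * (b - a))%C with (RtoC (1 - t) * a + t * b)%C by (rewrite RtoC_minus; ring).
  eapply Rle_trans; [apply Cmod_triangle|].
  rewrite !Cmod_mult, !Cmod_R, !Rabs_right by lra. nra.
Qed.

Lemma Cmod_seg_lt (a b : C) (t r : R) :
  0 <= t <= 1 -> Cmod a < r -> Cmod b < r -> Cmod (seg a b t) < r.
Proof.
  intros Ht Ha Hb.
  apply Rle_lt_trans with (Rmax (Cmod a) (Cmod b)).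
  - apply Cmod_seg; [exact Ht|apply Rmax_l|apply Rmax_r].
  - apply Rmax_lub_lt; assumption.
Qed.

Definition dotC (u v : C) : R := Re u * Re v + Im u * Im v.

Lemma dotC_le (u v : C) : Rabs (dotC u v) <= Cmod u * Cmod v.
Proof.
  replace (dotC u v) with (Re (u * Cconj v)) by (unfold dotC; destruct u, v; simpl; ring).
  eapply Rle_trans; [apply re_le_Cmod|]. rewrite Cmod_mult, Cmod_conj. lra.
Qed.

Lemma dotC_self (u : C) : dotC u u = Cmod u * Cmod u.
Proof.
  unfold dotC. replace (Cmod u * Cmod u) with (Cmod u ^ 2) by ring. rewrite Cmod2_alt. ring.
Qed.

Lemma dotC_plus_l (u v w : C) : dotC (u + v) w = dotC u w + dotC v w.
Proof. unfold dotC. destruct u, v, w; simpl; ring. Qed.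

(** A closed disk cut by the closed half plane at height [eta] above [a] in direction [n] is convex
    and closed and does not contain [a], so [goursat] applies on it. *)
Lemma halfdisk_triangle (F : C -> C) (a n x y z : C) (r eta : R) :
  0 < eta ->
  (forall w, Cmod w <= r -> w <> a -> exists d, cdiff F w d) ->
  Cmod x <= r -> Cmod y <= r -> Cmod z <= r ->
  eta <= dotC (x - a) n -> eta <= dotC (y - a) n -> eta <= dotC (z - a) n ->
  tri F x y z = 0.
Proof.
  intros He HD Hx Hy Hz Ex Ey Ez.
  apply (goursat (fun w => Cmod w <= r /\ eta <= dotC (w - a) n)); try (split; assumption).
  - intros u v t [Hu Eu] [Hv Ev] Ht. split; [apply Cmod_seg; assumption|].
    replace (dotC (seg u v t - a) n) with ((1 - t) * dotC (u - a) n + t * dotC (v - a) n)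
      by (unfold dotC, seg; destruct u, v, a, n; simpl; ring).
    nra.
  - intros p Hp. split; apply le_epsilon; intros e Hpe.
    + destruct (Hp e Hpe) as [w [[Hw _] Hd]]. pose proof (Cmod_le_add p w) as Ht.
      rewrite (Cmod_sym p w) in Ht. lra.
    + pose proof (Cmod_ge_0 n) as Hn.
      destruct (Hp (e / (Cmod n + 1))) as [w [[_ Hw] Hd]]; [apply Rdiv_lt_0_compat; lra|].
      assert (E : dotC (w - a) n = dotC (p - a) n + dotC (w - p) n).
      { rewrite <- dotC_plus_l. f_equal. ring. }
      pose proof (dotC_le (w - p) n) as Hc. apply Rabs_le_between in Hc.
      assert (Cmod (w - p) * Cmod n <= e); [|lra].
      apply Rle_trans with (e / (Cmod n + 1) * (Cmod n + 1)); [|right; field; lra].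
      apply Rmult_le_compat; try lra. apply Cmod_ge_0.
  - intros w [Hw Ew]. apply HD; [exact Hw|]. intros ->.
    replace (dotC (a - a) n) with 0 in Ew by (unfold dotC; destruct a, n; simpl; ring). lra.
Qed.

Lemma perimeter_ge_0 (t : C * C * C) : 0 <= perimeter t.
Proof.
  destruct t as [[a b] c]. unfold perimeter. pose proof (Cmod_ge_0 (b - a)).
  pose proof (Cmod_ge_0 (c - b)). pose proof (Cmod_ge_0 (a - c)). lra.
Qed.

(* Cutting off a small corner at the exceptional vertex reduces to [goursat]. *)
Lemma exceptional_vertex_triangle (F : C -> C) (a z w : C) (R0 : R) :
  (forall v, Cmod v < R0 -> ccont F v) ->
  (forall v, Cmod v < R0 -> v <> a -> exists d, cdiff F v d) ->
  Cmod a < R0 -> Cmod z < R0 -> Cmod w < R0 ->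
  0 < dotC (z - a) (z - a) -> 0 < dotC (w - a) (z - a) ->
  tri F a z w = 0.
Proof.
  intros HF HD Ha Hz Hw Ez Ew.
  assert (HC : forall x y, Cmod x < R0 -> Cmod y < R0 -> cont_seg F x y).
  { intros x y Hx Hy t Ht. apply HF, Cmod_seg_lt; assumption. }
  set (r := Rmax (Cmod a) (Rmax (Cmod z) (Cmod w))).
  assert (Hr : r < R0) by (repeat apply Rmax_lub_lt; assumption).
  assert (Hra : Cmod a <= r) by apply Rmax_l.
  assert (Hrz : Cmod z <= r) by (eapply Rle_trans; [apply Rmax_l|apply Rmax_r]).
  assert (Hrw : Cmod w <= r) by (eapply Rle_trans; [apply Rmax_r|apply Rmax_r]).
  assert (Hcorner : forall s, 0 < s <= 1 -> tri F a z w = tri F a (seg a z s) (seg a w s)).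
  { intros s Hs. set (zs := seg a z s). set (ws := seg a w s).
    assert (Hzs : Cmod zs <= r) by (apply Cmod_seg; lra).
    assert (Hws : Cmod ws <= r) by (apply Cmod_seg; lra).
    set (eta := s * Rmin (dotC (z - a) (z - a)) (dotC (w - a) (z - a))).
    assert (Hmin : 0 < Rmin (dotC (z - a) (z - a)) (dotC (w - a) (z - a))) by (apply Rmin_pos; assumption).
    pose proof (Rmin_l (dotC (z - a) (z - a)) (dotC (w - a) (z - a))) as Hl.
    pose proof (Rmin_r (dotC (z - a) (z - a)) (dotC (w - a) (z - a))) as Hr'.
    assert (Heta : 0 < eta) by (unfold eta; nra).
    assert (E1 : eta <= dotC (zs - a) (z - a)).
    { replace (dotC (zs - a) (z - a)) with (s * dotC (z - a) (z - a))
        by (unfold zs, dotC, seg; destruct a, z; simpl; ring).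
      unfold eta; nra. }
    assert (E2 : eta <= dotC (ws - a) (z - a)).
    { replace (dotC (ws - a) (z - a)) with (s * dotC (w - a) (z - a))
        by (unfold ws, dotC, seg; destruct a, z, w; simpl; ring).
      unfold eta; nra. }
    assert (E3 : eta <= dotC (z - a) (z - a)) by (unfold eta; nra).
    assert (E4 : eta <= dotC (w - a) (z - a)) by (unfold eta; nra).
    assert (HD' : forall v, Cmod v <= r -> v <> a -> exists d, cdiff F v d)
      by (intros v Hv; apply HD; lra).
    (* The diagonal from [zs] to [w] splits the triangle without its corner into two triangles, both
       at height at least [eta] above [a]. *)
    pose proof (halfdisk_triangle F a (z - a) zs z w r eta Heta HD' Hzs Hrz Hrw E1 E3 E4) as T1.
    pose proof (halfdisk_triangle F a (z - a) zs w ws r eta Heta HD' Hzs Hrw Hws E1 E4 E2) as two_pi.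
    unfold tri in *.
    rewrite (segint_split F a z zs s) by first [lra|reflexivity|apply HC; assumption].
    rewrite (segint_rev F a w) by (apply HC; assumption).
    rewrite (segint_split F a w ws s) by first [lra|reflexivity|apply HC; assumption].
    rewrite (segint_rev F zs w) in T1 by (apply HC; lra).
    rewrite (segint_rev F ws w) in two_pi by (apply HC; lra).
    rewrite (segint_rev F zs ws) in two_pi by (apply HC; lra).
    rewrite (segint_rev F a ws) by (apply HC; lra).
    replace (segint F zs z) with (- segint F z w + segint F zs w)%C.
    2:{ transitivity (segint F zs z - (segint F zs z + segint F z w + - segint F zs w))%C; [ring|].
        rewrite T1. ring. }
    replace (segint F ws w) with (segint F zs w - segint F zs ws)%C.
    2:{ transitivity (segint F ws w + (segint F zs w + - segint F ws w + - segint F zs ws))%C; [ring|].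
        rewrite two_pi. ring. }
    ring. }
  apply Cmod_eq_0, Rle_antisym; [|apply Cmod_ge_0].
  apply le_epsilon. intros eps He. rewrite Rplus_0_l.
  destruct (HF a Ha 1 Rlt_0_1) as [del [Hdel Hnear]].
  set (P := perimeter (a, z, w)). pose proof (perimeter_ge_0 (a, z, w)) as HP. fold P in HP.
  set (M := Cmod (F a) + 1). assert (HM : 1 <= M) by (unfold M; pose proof (Cmod_ge_0 (F a)); lra).
  (* The corner has perimeter s P: the second bound places it where |F| <= M, the third makes M s P
     at most [eps]. *)
  set (s := Rmin 1 (Rmin (del / (P + 1)) (eps / (M * P + 1)))).
  assert (HMP : 0 <= M * P) by nra.
  assert (Hs1 : s <= 1) by apply Rmin_l.
  assert (Hs2 : s <= del / (P + 1)) by (eapply Rle_trans; [apply Rmin_r|apply Rmin_l]).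
  assert (Hs3 : s <= eps / (M * P + 1)) by (eapply Rle_trans; [apply Rmin_r|apply Rmin_r]).
  assert (Hs0 : 0 < s) by (repeat apply Rmin_pos; try apply Rdiv_lt_0_compat; lra).
  clearbody s.
  rewrite (Hcorner s) by lra.
  assert (Hd : s * P < del).
  { apply Rlt_le_trans with (s * (P + 1)); [nra|].
    apply Rle_trans with (del / (P + 1) * (P + 1)); [apply Rmult_le_compat_r; lra|].
    right. field. lra. }
  set (zs := seg a z s). set (ws := seg a w s).
  assert (Hzs : Cmod zs < R0) by (apply Cmod_seg_lt; lra).
  assert (Hws : Cmod ws < R0) by (apply Cmod_seg_lt; lra).
  assert (L1 : Cmod (zs - a) = s * Cmod (z - a)).
  { unfold zs, seg. replace (a + s * (z - a) - a)%C with (s * (z - a))%C by ring.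
    rewrite Cmod_mult, Cmod_R, Rabs_right; lra. }
  assert (L2 : Cmod (a - ws) = s * Cmod (a - w)).
  { unfold ws, seg. replace (a - (a + s * (w - a)))%C with (s * (a - w))%C by ring.
    rewrite Cmod_mult, Cmod_R, Rabs_right; lra. }
  assert (L3 : Cmod (ws - zs) = s * Cmod (w - z)).
  { unfold zs, ws, seg. replace (a + s * (w - a) - (a + s * (z - a)))%C with (s * (w - z))%C by ring.
    rewrite Cmod_mult, Cmod_R, Rabs_right; lra. }
  assert (Hper : perimeter (a, zs, ws) = s * P) by (unfold P, perimeter; rewrite L1, L2, L3; ring).
  assert (Hsides : Cmod (z - a) + Cmod (w - z) + Cmod (a - w) = P) by reflexivity.
  pose proof (Cmod_ge_0 (z - a)). pose proof (Cmod_ge_0 (w - z)). pose proof (Cmod_ge_0 (a - w)).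
  assert (KB : forall v, Cmod (v - a) < del -> Cmod (F v) <= M).
  { intros v Hv. specialize (Hnear v Hv). pose proof (Cmod_le_add (F v) (F a)). unfold M. lra. }
  apply Rle_trans with (M * perimeter (a, zs, ws)).
  - apply tri_bound; try (apply HC; assumption); intros t Ht; apply KB.
    + eapply Rle_lt_trans; [apply seg_dist, Ht|]. rewrite L1. nra.
    + replace (seg zs ws t - a)%C with ((seg zs ws t - zs) + (zs - a))%C by ring.
      eapply Rle_lt_trans; [apply Cmod_triangle|]. pose proof (seg_dist zs ws t Ht).
      rewrite L3 in *. rewrite L1. nra.
    + replace (seg ws a t - a)%C with (RtoC (1 - t) * (ws - a))%C
        by (unfold seg; rewrite RtoC_minus; ring).
      rewrite Cmod_mult, Cmod_R, Rabs_right by lra. rewrite (Cmod_sym ws a), L2.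
      assert (0 <= s * Cmod (a - w)) by nra. nra.
  - rewrite Hper. apply Rle_trans with (s * (M * P + 1)); [nra|].
    apply Rle_trans with (eps / (M * P + 1) * (M * P + 1)); [apply Rmult_le_compat_r; lra|].
    right. field. lra.
Qed.

Lemma segint_const (c a b : C) : segint (fun _ => c) a b = (c * (b - a))%C.
Proof.
  rewrite (segint_primitive (fun _ => c) (fun w => c * w)%C).
  - ring.
  - intros t _. eapply cdiff_ccont, cdiff_const.
  - intros t _. eapply cdiff_eq; [|apply cdiff_scal, cdiff_id]. ring.
Qed.

(** The integral is based at the exceptional point itself, which is therefore a vertex of every
    triangle [a], [z], [w] used for the increment. When [w] is closer to [z] than [a] is, [w - a]
    and [z - a] form an acute angle, as [exceptional_vertex_triangle] demands. *)
Lemma disk_primitive (F : C -> C) (a : C) (R0 : R) :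
  Cmod a < R0 ->
  (forall v, Cmod v < R0 -> ccont F v) ->
  (forall v, Cmod v < R0 -> v <> a -> exists d, cdiff F v d) ->
  forall z, Cmod z < R0 -> cdiff (segint F a) z (F z).
Proof.
  intros Ha HF HD z Hz.
  assert (HC : forall x y, Cmod x < R0 -> Cmod y < R0 -> cont_seg F x y).
  { intros x y Hx Hy t Ht. apply HF, Cmod_seg_lt; assumption. }
  assert (Hinc : exists r, 0 < r /\ forall w, Cmod (w - z) < r ->
     Cmod w < R0 /\ (segint F a w - segint F a z)%C = segint F z w).
  { destruct (Ceq_dec z a) as [->|Hza].
    - exists (R0 - Cmod a). split; [lra|]. intros w Hw.
      pose proof (Cmod_le_add w a) as Ht. split; [lra|].
      rewrite (segint_refl F a (HF a Ha)). ring.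
    - assert (Hm : 0 < Cmod (z - a)).
      { apply Cmod_pos_neq. intros E. apply Hza. replace z with (z - a + a)%C by ring.
        rewrite E. ring. }
      exists (Rmin (R0 - Cmod z) (Cmod (z - a))). split; [apply Rmin_pos; lra|].
      intros w Hw.
      assert (Hw1 : Cmod (w - z) < R0 - Cmod z) by (eapply Rlt_le_trans; [exact Hw|apply Rmin_l]).
      assert (Hw2 : Cmod (w - z) < Cmod (z - a)) by (eapply Rlt_le_trans; [exact Hw|apply Rmin_r]).
      pose proof (Cmod_le_add w z) as Ht.
      assert (HwR : Cmod w < R0) by lra. split; [exact HwR|].
      assert (HT : tri F a z w = 0).
      { apply (exceptional_vertex_triangle F a z w R0); try assumption.
        - rewrite dotC_self. nra.
        - replace (w - a)%C with ((z - a) + (w - z))%C by ring. rewrite dotC_plus_l, dotC_self.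
          pose proof (dotC_le (w - z) (z - a)) as Hc. apply Rabs_le_between in Hc. nra. }
      unfold tri in HT. rewrite (segint_rev F a w) in HT by (apply HC; assumption).
      transitivity (segint F z w - (segint F a z + segint F z w + - segint F a w))%C; [ring|].
      rewrite HT. ring. }
  destruct Hinc as [r [Hr Hinc]].
  intros eps He.
  destruct (HF z Hz eps He) as [del [Hdel Hnear]].
  exists (Rmin r del). split; [apply Rmin_pos; assumption|]. intros w Hw.
  destruct (Hinc w) as [HwR E]; [eapply Rlt_le_trans; [exact Hw|apply Rmin_l]|].
  assert (Hwd : Cmod (w - z) < del) by (eapply Rlt_le_trans; [exact Hw|apply Rmin_r]).
  rewrite E, <- segint_const.
  rewrite <- segint_minus; [|apply HC; assumption|intros t _; eapply cdiff_ccont, cdiff_const].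
  apply segint_bound.
  - intros t Ht. apply (ccont_plus F (fun _ => - F z)%C); [apply HC; assumption|].
    eapply cdiff_ccont, cdiff_const.
  - intros t Ht. left. apply Hnear. eapply Rle_lt_trans; [apply seg_dist, Ht|exact Hwd].
Qed.

(** * Cauchy's integral formula *)

(** The integral is taken in a real vector space, so a complex factor is moved out by way of the
    real and imaginary parts. *)
Lemma segint_scal (c : C) (F : C -> C) (a b : C) :
  cont_seg F a b -> segint (fun w => c * F w)%C a b = (c * segint F a b)%C.
Proof.
  intros Hc. unfold segint at 1.
  pose proof (RInt_correct (V := C_R_CompleteNormedModule) _ _ _
    (seg_ex_RInt F a b 0 1 Hc ltac:(lra) ltac:(lra))) as HI.
  fold (segint F a b) in HI. set (I := segint F a b) in *.
  pose proof (is_RInt_fct_extend_fst (U := R_NormedModule) (V := R_NormedModule) _ _ _ _ HI) as H1.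
  pose proof (is_RInt_fct_extend_snd (U := R_NormedModule) (V := R_NormedModule) _ _ _ _ HI) as H2.
  apply (is_RInt_unique (V := C_R_CompleteNormedModule)).
  destruct c as [x y].
  pose proof (is_RInt_minus (V := R_NormedModule) _ _ _ _ _ _
    (is_RInt_scal (V := R_NormedModule) _ _ _ x _ H1) (is_RInt_scal (V := R_NormedModule) _ _ _ y _ H2)) as H3.
  pose proof (is_RInt_plus (V := R_NormedModule) _ _ _ _ _ _
    (is_RInt_scal (V := R_NormedModule) _ _ _ x _ H2) (is_RInt_scal (V := R_NormedModule) _ _ _ y _ H1)) as H4.
  pose proof (is_RInt_fct_extend_pair (U := R_NormedModule) (V := R_NormedModule)
    (fun t => (x, y) * F (seg a b t) * (b - a))%C 0 1) as HP.
  apply HP.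
  - eapply is_RInt_ext; [|exact H3]. intros t _.
    change (x * fst (F (seg a b t) * (b - a))%C - y * snd (F (seg a b t) * (b - a))%C
      = fst ((x, y) * F (seg a b t) * (b - a))%C).
    destruct (F (seg a b t)), a, b; simpl; ring.
  - eapply is_RInt_ext; [|exact H4]. intros t _.
    change (x * snd (F (seg a b t) * (b - a))%C + y * fst (F (seg a b t) * (b - a))%C
      = snd ((x, y) * F (seg a b t) * (b - a))%C).
    destruct (F (seg a b t)), a, b; simpl; ring.
Qed.

Lemma cdiff_unique (F : C -> C) (z d e : C) : cdiff F z d -> cdiff F z e -> d = e.
Proof.
  intros H1 H2.
  assert (E : (d - e)%C = 0).
  { apply Cmod_eq_0, Rle_antisym; [|apply Cmod_ge_0].
    apply le_epsilon. intros eps He. rewrite Rplus_0_l.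
    assert (He2 : 0 < eps / 2) by lra.
    destruct (H1 _ He2) as [d1 [Hd1 K1]]. destruct (H2 _ He2) as [d2 [Hd2 K2]].
    set (h := Rmin d1 d2 / 2).
    pose proof (Rmin_pos d1 d2 Hd1 Hd2) as Hm.
    pose proof (Rmin_l d1 d2). pose proof (Rmin_r d1 d2).
    assert (Hh : 0 < h) by (unfold h; lra).
    assert (Eh : (z + h - z)%C = RtoC h) by ring.
    specialize (K1 (z + h)%C). specialize (K2 (z + h)%C).
    rewrite Eh, Cmod_R, Rabs_right in K1, K2 by lra.
    specialize (K1 ltac:(unfold h; lra)). specialize (K2 ltac:(unfold h; lra)).
    apply Rmult_le_reg_r with h; [exact Hh|].
    apply Rle_trans with (Cmod ((d - e) * h)).
    - rewrite Cmod_mult, Cmod_R, Rabs_right by lra. lra.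
    - replace ((d - e) * h)%C with ((F (z + h) - F z - e * h) + - (F (z + h) - F z - d * h))%C by ring.
      eapply Rle_trans; [apply Cmod_triangle|]. rewrite Cmod_opp. lra. }
  replace d with (d - e + e)%C by ring. rewrite E. ring.
Qed.

Lemma cdiff_zero_const (F : C -> C) (R0 : R) :
  (forall v, Cmod v < R0 -> cdiff F v 0) ->
  forall z w, Cmod z < R0 -> Cmod w < R0 -> F z = F w.
Proof.
  intros HD z w Hz Hw.
  assert (E : segint (fun _ => RtoC 0) w z = (F z - F w)%C).
  { apply segint_primitive.
    - intros t _. eapply cdiff_ccont, cdiff_const.
    - intros t Ht. apply HD, Cmod_seg_lt; assumption. }
  rewrite segint_const in E.
  replace (F z) with (F z - F w + F w)%C by ring. rewrite <- E. ring.
Qed.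

(** Differentiation under the integral sign: the remainder is quadratic in the parameter, uniformly
    along the segment, so the length estimate suffices. *)
Lemma segint_param (k : C -> C -> C) (k2 : C -> C) (x y b : C) (M r : R) :
  0 < r -> 0 <= M ->
  (forall b', Cmod (b' - b) < r -> cont_seg (k b') x y) -> cont_seg k2 x y ->
  (forall b' t, Cmod (b' - b) < r -> 0 <= t <= 1 ->
     Cmod (k b' (seg x y t) - k b (seg x y t) - (b' - b) * k2 (seg x y t))
       <= M * (Cmod (b' - b) * Cmod (b' - b))) ->
  cdiff (fun b => segint (k b) x y) b (segint k2 x y).
Proof.
  intros Hr HM Hk Hk2 HB eps He.
  set (L := M * Cmod (y - x) + 1).
  pose proof (Cmod_ge_0 (y - x)) as Hxy.
  assert (HL : 0 < L) by (unfold L; nra).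
  exists (Rmin r (eps / L)). split; [apply Rmin_pos; [assumption|apply Rdiv_lt_0_compat; lra]|].
  intros b' Hb.
  assert (Hb1 : Cmod (b' - b) < r) by (eapply Rlt_le_trans; [exact Hb|apply Rmin_l]).
  assert (Hb2 : Cmod (b' - b) < eps / L) by (eapply Rlt_le_trans; [exact Hb|apply Rmin_r]).
  assert (C0 : cont_seg (k b) x y).
  { apply Hk. replace (b - b)%C with (RtoC 0) by ring. rewrite Cmod_0. exact Hr. }
  assert (C1 : cont_seg (fun s => (b' - b) * k2 s)%C x y).
  { intros t Ht. apply (ccont_mult (fun _ => b' - b)%C k2); [eapply cdiff_ccont, cdiff_const|apply Hk2, Ht]. }
  assert (C2 : forall P Q, cont_seg P x y -> cont_seg Q x y -> cont_seg (fun s => P s - Q s)%C x y).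
  { intros P Q HP HQ t Ht. apply (ccont_ext (fun s => P s + (- (1)) * Q s)%C _ _ 1); [lra|intros; ring|].
    apply ccont_plus; [apply HP, Ht|]. apply (ccont_mult (fun _ => - (1))%C Q); [eapply cdiff_ccont, cdiff_const|apply HQ, Ht]. }
  rewrite (Cmult_comm (segint k2 x y)), <- segint_scal by exact Hk2.
  rewrite <- segint_minus by auto. rewrite <- segint_minus by auto.
  pose proof (Cmod_ge_0 (b' - b)) as Hp.
  apply Rle_trans with (M * (Cmod (b' - b) * Cmod (b' - b)) * Cmod (y - x)).
  - apply segint_bound; [auto|]. intros t Ht. apply HB; assumption.
  - apply Rle_trans with (L * Cmod (b' - b) * Cmod (b' - b)).
    + unfold L. nra.
    + apply Rmult_le_compat_r; [exact Hp|].
      apply Rle_trans with (L * (eps / L)); [apply Rmult_le_compat_l; lra|].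
      right. field. lra.
Qed.

(** The parameter is complex so that the chain rule for [cdiff] applies; real parameters run over
    the circle of radius [r]. *)
Definition circ (r : R) (s : C) : C := (r * Cexp (Ci * s))%C.

Lemma Cmod_Cexp (z : C) : Cmod (Cexp z) = exp (Re z).
Proof.
  unfold Cmod, Cexp; simpl.
  replace (exp (Re z) * cos (Im z) * (exp (Re z) * cos (Im z) * 1) +
    exp (Re z) * sin (Im z) * (exp (Re z) * sin (Im z) * 1))
    with (exp (Re z) * exp (Re z) * (Rsqr (sin (Im z)) + Rsqr (cos (Im z)))) by (unfold Rsqr; ring).
  rewrite sin2_cos2, Rmult_1_r. apply sqrt_square. left. apply exp_pos.
Qed.

Lemma Cmod_circ (r : R) (t : R) : 0 <= r -> Cmod (circ r t) = r.
Proof.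
  intros Hr. unfold circ. rewrite Cmod_mult, Cmod_R, Cmod_Cexp, Rabs_right by lra.
  replace (Re (Ci * t)) with 0 by (simpl; ring). rewrite exp_0. ring.
Qed.

Lemma circ_period (r : R) (t : R) : circ r (t + 2 * PI)%R = circ r t.
Proof.
  unfold circ, Cexp. f_equal. simpl.
  replace (0 * (t + 2 * PI) - 1 * 0) with (0 * t - 1 * 0) by ring.
  replace (0 * 0 + 1 * (t + 2 * PI)) with (0 * 0 + 1 * t + 2 * PI) by ring.
  set (x := 0 * 0 + 1 * t).
  rewrite (cos_plus x), (sin_plus x), cos_2PI, sin_2PI. apply (f_equal2 pair); ring.
Qed.

Lemma cdiff_circ (r : R) (s : C) : cdiff (circ r) s (Ci * circ r s)%C.
Proof.
  unfold circ. eapply cdiff_eq; [|apply cdiff_scal, cdiff_exp_comp, cdiff_scal, cdiff_id].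
  ring.
Qed.

Lemma cont_seg_bounded (F : C -> C) (a b : C) :
  a <> b -> cont_seg F a b ->
  exists M, 0 <= M /\ forall t, 0 <= t <= 1 -> Cmod (F (seg a b t)) <= M.
Proof.
  intros Hab Hc.
  destruct (bounded_continuity (V := C_R_NormedModule)
    (fun t => F (seg a b t) * (b - a))%C 0 1) as [M HM].
  { intros t Ht. apply seg_integrand_continuous, Hc, Ht. }
  assert (Hd : 0 < Cmod (b - a)).
  { apply Cmod_pos_neq. intros E. apply Hab. replace b with (b - a + a)%C by ring. rewrite E. ring. }
  assert (K : forall t, 0 <= t <= 1 -> Cmod (F (seg a b t)) <= M / Cmod (b - a)).
  { intros t Ht. specialize (HM t Ht).
    apply Rmult_le_reg_r with (Cmod (b - a)); [exact Hd|].
    rewrite <- Cmod_mult. replace (M / Cmod (b - a) * Cmod (b - a)) with M by (field; lra).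
    rewrite (Cmod_norm (F (seg a b t) * (b - a))). left. exact HM. }
  exists (M / Cmod (b - a)). split; [|exact K].
  eapply Rle_trans; [apply Cmod_ge_0|apply (K 0); lra].
Qed.

Definition two_pi : C := RtoC (2 * PI).

Lemma two_pi_neq_0 : RtoC 0 <> two_pi.
Proof. intros E. apply RtoC_inj in E. pose proof PI_RGT_0. lra. Qed.

Lemma seg_two_pi (t : R) : seg 0 two_pi t = RtoC (2 * PI * t).
Proof. unfold seg, two_pi. rewrite !RtoC_mult. ring. Qed.

Lemma circ_sub_lb (r : R) (b : C) (t : R) : 0 <= r -> r - Cmod b <= Cmod (circ r t - b).
Proof. intros Hr. pose proof (Cmod_le_add (circ r t) b). rewrite Cmod_circ in H by exact Hr. lra. Qed.

Lemma circ_sub_neq (r : R) (b : C) (t : R) : Cmod b < r -> (circ r t - b)%C <> RtoC 0.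
Proof.
  intros Hb. pose proof (Cmod_ge_0 b).
  apply Cmod_gt_0. pose proof (circ_sub_lb r b t ltac:(lra)). lra.
Qed.

Lemma ccont_kernel (rho : C -> C) (r : R) (b : C) (t : R) (n : nat) :
  Cmod b < r -> ccont rho t -> ccont (fun s => rho s / (circ r s - b) ^ n)%C t.
Proof.
  intros Hb Hr. apply ccont_mult; [exact Hr|].
  assert (E : exists d, cdiff (fun s => (circ r s - b) ^ n)%C t d).
  { induction n as [|n [d IH]].
    - exists (RtoC 0). exact (cdiff_const 1 t).
    - eexists. apply (cdiff_mult (fun s => circ r s - b)%C (fun s => (circ r s - b) ^ n)%C); [|exact IH].
      apply cdiff_minus; [apply cdiff_circ|apply cdiff_const]. }
  destruct E as [d Hd].
  eapply cdiff_ccont, (cdiff_inv _ _ _ (Cpow_nz _ _ (circ_sub_neq r b t Hb)) Hd).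
Qed.

(** The Cauchy integral over |v| = r in the angle parameter. The factor from dv is part of [rho]. *)
Definition cauchy_int (rho : C -> C) (r : R) (n : nat) (b : C) : C :=
  segint (fun s => rho s / (circ r s - b) ^ n)%C 0 two_pi.

(** The remainder equals h^2 / (u^2 (u - h)), and |h| <= d / 2 keeps |u - h| above d / 2. In use,
    [u] joins the parameter to a point of the circle and [h] is the increment of the parameter. *)
Lemma kernel_bound_1 (u h : C) (d : R) :
  0 < d -> d <= Cmod u -> Cmod h <= d / 2 ->
  Cmod (/ (u - h) ^ 1 - / u ^ 1 - h * / u ^ 2) <= 2 / (d * d * d) * (Cmod h * Cmod h).
Proof.
  intros Hd Hu Hh.
  assert (Huh : d / 2 <= Cmod (u - h)).
  { pose proof (Cmod_le_add u (u - h)). replace (u - (u - h))%C with h in H by ring. lra. }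
  assert (N1 : u <> RtoC 0) by (apply Cmod_gt_0; lra).
  assert (N2 : (u - h)%C <> RtoC 0) by (apply Cmod_gt_0; lra).
  replace (/ (u - h) ^ 1 - / u ^ 1 - h * / u ^ 2)%C with (h * h * / (u * u * (u - h)))%C
    by (simpl; field; split; assumption).
  rewrite !Cmod_mult, Cmod_inv, !Cmod_mult by (repeat apply Cmult_neq_0; assumption).
  rewrite (Rmult_comm (2 / (d * d * d))).
  apply Rmult_le_compat_l; [pose proof (Cmod_ge_0 h); nra|].
  replace (2 / (d * d * d)) with (/ (d * d * (d / 2))) by (field; lra).
  apply Rinv_le_contravar; [repeat apply Rmult_lt_0_compat; lra|].
  apply Rmult_le_compat; try nra.
Qed.

(** The remainder equals h^2 (3 - 2 h / u) / (u^2 (u - h)^2). The bracket has modulus at most 4 and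
    |u - h|^2 >= d^2 / 4, which gives 16. *)
Lemma kernel_bound_2 (u h : C) (d : R) :
  0 < d -> d <= Cmod u -> Cmod h <= d / 2 ->
  Cmod (/ (u - h) ^ 2 - / u ^ 2 - h * (2 * / u ^ 3)) <= 16 / (d * d * d * d) * (Cmod h * Cmod h).
Proof.
  intros Hd Hu Hh.
  assert (Huh : d / 2 <= Cmod (u - h)).
  { pose proof (Cmod_le_add u (u - h)). replace (u - (u - h))%C with h in H by ring. lra. }
  assert (N1 : u <> RtoC 0) by (apply Cmod_gt_0; lra).
  assert (N2 : (u - h)%C <> RtoC 0) by (apply Cmod_gt_0; lra).
  replace (/ (u - h) ^ 2 - / u ^ 2 - h * (2 * / u ^ 3))%C
    with (h * h * ((3 - 2 * (h / u)) * / (u * u * ((u - h) * (u - h)))))%C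
    by (simpl; field; split; assumption).
  rewrite !Cmod_mult, Cmod_inv, !Cmod_mult by (repeat apply Cmult_neq_0; assumption).
  rewrite (Rmult_comm (16 / (d * d * d * d))).
  apply Rmult_le_compat_l; [pose proof (Cmod_ge_0 h); nra|].
  replace (16 / (d * d * d * d)) with (4 * / (d * d * (d / 2 * (d / 2)))) by (field; lra).
  apply Rmult_le_compat; [apply Cmod_ge_0| | |].
  - left. apply Rinv_0_lt_compat. repeat apply Rmult_lt_0_compat; lra.
  - eapply Rle_trans; [apply Cmod_triangle|]. rewrite Cmod_opp, Cmod_mult, Cmod_div by exact N1.
    rewrite !Cmod_R, !Rabs_right by lra.
    assert (Cmod h / Cmod u <= / 2); [|lra].
    apply Rmult_le_reg_r with (Cmod u); [lra|].
    replace (Cmod h / Cmod u * Cmod u) with (Cmod h) by (field; lra). lra.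
  - apply Rinv_le_contravar; [repeat apply Rmult_lt_0_compat; lra|].
    apply Rmult_le_compat; nra.
Qed.

Lemma cdiff_cauchy_int_1 (rho : C -> C) (r : R) (b : C) :
  Cmod b < r -> (forall t : R, ccont rho t) ->
  cdiff (cauchy_int rho r 1) b (cauchy_int rho r 2 b).
Proof.
  intros Hb Hrho. pose proof (Cmod_ge_0 b) as Hb0.
  assert (Hcr : cont_seg rho 0 two_pi) by (intros t _; rewrite seg_two_pi; apply Hrho).
  destruct (cont_seg_bounded rho 0 two_pi two_pi_neq_0 Hcr) as [B [HB0 HB]].
  set (d := r - Cmod b). assert (Hd : 0 < d) by (unfold d; lra).
  assert (Hnear : forall b', Cmod (b' - b) < d / 2 -> Cmod b' < r).
  { intros b' H. pose proof (Cmod_le_add b' b). unfold d in H. lra. }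
  apply (segint_param (fun b s => rho s / (circ r s - b) ^ 1)%C _ 0 two_pi b (B * (2 / (d * d * d))) (d / 2)).
  - lra.
  - apply Rmult_le_pos; [exact HB0|]. left. apply Rdiv_lt_0_compat; [lra|].
    repeat apply Rmult_lt_0_compat; lra.
  - intros b' H t _. rewrite seg_two_pi. apply ccont_kernel; [apply Hnear, H|apply Hrho].
  - intros t _. rewrite seg_two_pi. apply ccont_kernel; [exact Hb|apply Hrho].
  - intros b' t H Ht. specialize (HB t Ht). rewrite seg_two_pi in *.
    set (u := (circ r (2 * PI * t)%R - b)%C).
    replace (circ r (2 * PI * t)%R - b')%C with (u - (b' - b))%C by (unfold u; ring).
    replace (rho (2 * PI * t)%R / (u - (b' - b)) ^ 1 - rho (2 * PI * t)%R / u ^ 1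
        - (b' - b) * (rho (2 * PI * t)%R / u ^ 2))%C
      with (rho (2 * PI * t)%R * (/ (u - (b' - b)) ^ 1 - / u ^ 1 - (b' - b) * / u ^ 2))%C
      by (unfold Cdiv; ring).
    rewrite Cmod_mult, (Rmult_assoc B).
    apply Rmult_le_compat; [apply Cmod_ge_0|apply Cmod_ge_0|exact HB|].
    apply kernel_bound_1; [exact Hd|apply circ_sub_lb; lra|lra].
Qed.

Lemma cdiff_cauchy_int_2 (rho : C -> C) (r : R) (b : C) :
  Cmod b < r -> (forall t : R, ccont rho t) ->
  exists e, cdiff (cauchy_int rho r 2) b e.
Proof.
  intros Hb Hrho. pose proof (Cmod_ge_0 b) as Hb0.
  assert (Hcr : cont_seg rho 0 two_pi) by (intros t _; rewrite seg_two_pi; apply Hrho).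
  destruct (cont_seg_bounded rho 0 two_pi two_pi_neq_0 Hcr) as [B [HB0 HB]].
  set (d := r - Cmod b). assert (Hd : 0 < d) by (unfold d; lra).
  assert (Hnear : forall b', Cmod (b' - b) < d / 2 -> Cmod b' < r).
  { intros b' H. pose proof (Cmod_le_add b' b). unfold d in H. lra. }
  eexists.
  apply (segint_param (fun b s => rho s / (circ r s - b) ^ 2)%C
    (fun s => 2 * (rho s / (circ r s - b) ^ 3))%C 0 two_pi b (B * (16 / (d * d * d * d))) (d / 2)).
  - lra.
  - apply Rmult_le_pos; [exact HB0|]. left. apply Rdiv_lt_0_compat; [lra|].
    repeat apply Rmult_lt_0_compat; lra.
  - intros b' H t _. rewrite seg_two_pi. apply ccont_kernel; [apply Hnear, H|apply Hrho].
  - intros t _. rewrite seg_two_pi. apply (ccont_mult (fun _ => RtoC 2)); [eapply cdiff_ccont, cdiff_const|].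
    apply ccont_kernel; [exact Hb|apply Hrho].
  - intros b' t H Ht. specialize (HB t Ht). rewrite seg_two_pi in *.
    set (u := (circ r (2 * PI * t)%R - b)%C).
    replace (circ r (2 * PI * t)%R - b')%C with (u - (b' - b))%C by (unfold u; ring).
    replace (rho (2 * PI * t)%R / (u - (b' - b)) ^ 2 - rho (2 * PI * t)%R / u ^ 2
        - (b' - b) * (2 * (rho (2 * PI * t)%R / u ^ 3)))%C
      with (rho (2 * PI * t)%R * (/ (u - (b' - b)) ^ 2 - / u ^ 2 - (b' - b) * (2 * / u ^ 3)))%C
      by (unfold Cdiv; ring).
    rewrite Cmod_mult, (Rmult_assoc B).
    apply Rmult_le_compat; [apply Cmod_ge_0|apply Cmod_ge_0|exact HB|].
    apply kernel_bound_2; [exact Hd|apply circ_sub_lb; lra|lra].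
Qed.

Definition circ_deriv (r : R) (s : C) : C := (Ci * circ r s)%C.

(** The value does not depend on [b]: its derivative in [b] integrates the derivative of the
    periodic function -1 / (circ - b). At b = 0 the integrand is the constant [Ci]. *)
Lemma winding_int (r : R) (b : C) : Cmod b < r -> cauchy_int (circ_deriv r) r 1 b = (Ci * two_pi)%C.
Proof.
  intros Hb. pose proof (Cmod_ge_0 b) as Hb0.
  assert (Hc : forall t : R, ccont (circ_deriv r) t).
  { intros t. unfold circ_deriv. eapply cdiff_ccont, cdiff_scal, cdiff_circ. }
  assert (HD : forall v, Cmod v < r -> cdiff (cauchy_int (circ_deriv r) r 1) v 0).
  { intros v Hv. eapply cdiff_eq; [|apply cdiff_cauchy_int_1; assumption].
    unfold cauchy_int. rewrite (segint_primitive _ (fun s => - / (circ r s - v))%C).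
    - replace two_pi with (RtoC (0 + 2 * PI)) by (unfold two_pi; f_equal; ring).
      rewrite circ_period. ring.
    - intros t _. rewrite seg_two_pi. apply ccont_kernel; [exact Hv|apply Hc].
    - intros t _. rewrite seg_two_pi.
      pose proof (circ_sub_neq r v (2 * PI * t) Hv) as N.
      eapply cdiff_eq; [|apply cdiff_opp, cdiff_inv; [exact N|
        apply cdiff_minus; [apply cdiff_circ|apply cdiff_const]]].
      unfold circ_deriv. simpl. field. exact N. }
  rewrite (cdiff_zero_const _ r HD b 0) by (try rewrite Cmod_0; lra).
  unfold cauchy_int. rewrite (segint_primitive _ (fun s => Ci * s)%C).
  - ring.
  - intros t _. rewrite seg_two_pi. apply ccont_kernel; [rewrite Cmod_0; lra|apply Hc].
  - intros t _. rewrite seg_two_pi. eapply cdiff_eq; [|apply cdiff_scal, cdiff_id].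
    unfold circ_deriv. simpl. field. intros E. pose proof (circ_sub_neq r 0 (2 * PI * t)) as N.
    apply N; [rewrite Cmod_0; lra|]. rewrite E. ring.
Qed.

(** [q] stands for the derivative of [Q] and fills the hole at [b]. This makes the quotient
    continuous there, which is all that [disk_primitive] asks of its exceptional point. *)
Definition diffquot (Q q : C -> C) (b v : C) : C :=
  if Ceq_dec v b then q b else ((Q v - Q b) / (v - b))%C.

Lemma Csub_neq (a b : C) : a <> b -> (a - b)%C <> RtoC 0.
Proof. intros H E. apply H. replace a with (a - b + b)%C by ring. rewrite E. ring. Qed.

Lemma diffquot_diff (Q q : C -> C) (b v d : C) :
  v <> b -> cdiff Q v d -> exists e, cdiff (diffquot Q q b) v e.
Proof.
  intros Hv HQ. pose proof (Csub_neq _ _ Hv) as N.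
  eexists. apply (cdiff_ext (fun v => (Q v - Q b) / (v - b))%C _ _ _ (Cmod (v - b))).
  - apply Cmod_pos_neq, N.
  - intros w Hw. unfold diffquot. destruct (Ceq_dec w b) as [->|]; [|reflexivity].
    rewrite Cmod_sym in Hw. lra.
  - apply cdiff_div; [exact N| |].
    + apply cdiff_minus; [exact HQ|apply cdiff_const].
    + apply cdiff_minus; [apply cdiff_id|apply cdiff_const].
Qed.

Lemma diffquot_cont (Q q : C -> C) (b : C) :
  cdiff Q b (q b) -> ccont (diffquot Q q b) b.
Proof.
  intros HQ eps He. assert (He2 : 0 < eps / 2) by lra.
  destruct (HQ _ He2) as [del [Hd H]]. exists del. split; [exact Hd|]. intros w Hw.
  unfold diffquot. destruct (Ceq_dec b b) as [_|N]; [|congruence].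
  destruct (Ceq_dec w b) as [->|Hwb].
  - replace (q b - q b)%C with (RtoC 0) by ring. rewrite Cmod_0. exact He.
  - pose proof (Csub_neq _ _ Hwb) as N. pose proof (Cmod_pos_neq _ N) as P.
    replace ((Q w - Q b) / (w - b) - q b)%C with ((Q w - Q b - q b * (w - b)) / (w - b))%C
      by (field; exact N).
    rewrite Cmod_div by exact N. specialize (H w Hw).
    apply Rle_lt_trans with (eps / 2); [|lra].
    apply Rmult_le_reg_r with (Cmod (w - b)); [exact P|].
    replace (Cmod (Q w - Q b - q b * (w - b)) / Cmod (w - b) * Cmod (w - b))
      with (Cmod (Q w - Q b - q b * (w - b))) by (field; lra). exact H.
Qed.

(** The difference quotient of [Q] at [b] has a primitive on the whole disk, so its integral over
    the circle vanishes; what remains is [Q b] times [winding_int]. *)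
Lemma cauchy_formula (Q q : C -> C) (R0 r : R) (b : C) :
  (forall v, Cmod v < R0 -> cdiff Q v (q v)) -> Cmod b < r -> r < R0 ->
  cauchy_int (fun s => Q (circ r s) * circ_deriv r s)%C r 1 b = (Q b * (Ci * two_pi))%C.
Proof.
  intros HQ Hb Hr. pose proof (Cmod_ge_0 b) as Hb0.
  assert (Hcirc : forall t : R, Cmod (circ r t) < R0) by (intros t; rewrite Cmod_circ; lra).
  set (F := diffquot Q q b).
  assert (HFd : forall v, Cmod v < R0 -> v <> b -> exists d, cdiff F v d).
  { intros v Hv Hvb. eapply diffquot_diff; [exact Hvb|apply HQ, Hv]. }
  assert (HFc : forall v, Cmod v < R0 -> ccont F v).
  { intros v Hv. destruct (Ceq_dec v b) as [->|Hvb]; [apply diffquot_cont, HQ, Hv|].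
    destruct (HFd v Hv Hvb) as [d Hd]. eapply cdiff_ccont, Hd. }
  pose proof (disk_primitive F b R0 ltac:(lra) HFc HFd) as HP.
  assert (Hid : forall t : R, ccont (circ_deriv r) t).
  { intros t. unfold circ_deriv. eapply cdiff_ccont, cdiff_scal, cdiff_circ. }
  assert (HQc : forall t : R, ccont (fun s => Q (circ r s) * circ_deriv r s)%C t).
  { intros t. apply (ccont_mult (fun s => Q (circ r s)) (circ_deriv r)); [|apply Hid].
    eapply cdiff_ccont, (cdiff_comp Q (circ r)); [apply HQ, Hcirc|apply cdiff_circ]. }
  rewrite <- (winding_int r b Hb). unfold cauchy_int.
  rewrite <- segint_scal by (intros t _; rewrite seg_two_pi; apply ccont_kernel; [exact Hb|apply Hid]).
  transitivity (segint (fun s => (Q (circ r s) * circ_deriv r s / (circ r s - b) ^ 1) -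
    (Q b * (circ_deriv r s / (circ r s - b) ^ 1)))%C 0 two_pi + segint (fun s => (Q b * (circ_deriv r s / (circ r s - b) ^ 1)))%C 0 two_pi)%C.
  { rewrite segint_minus.
    - ring.
    - intros t _. rewrite seg_two_pi. apply ccont_kernel; [exact Hb|apply HQc].
    - intros t _. rewrite seg_two_pi. apply (ccont_mult (fun _ => Q b)); [eapply cdiff_ccont, cdiff_const|].
      apply ccont_kernel; [exact Hb|apply Hid]. }
  rewrite (segint_primitive _ (fun s => segint F b (circ r s))).
  - replace two_pi with (RtoC (0 + 2 * PI)) by (unfold two_pi; f_equal; ring).
    rewrite circ_period. ring.
  - intros t _. rewrite seg_two_pi.
    apply (ccont_ext (fun s => (Q (circ r s) * circ_deriv r s / (circ r s - b) ^ 1)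
      + (- Q b) * (circ_deriv r s / (circ r s - b) ^ 1))%C _ _ 1); [lra|intros; ring|].
    apply ccont_plus; [apply ccont_kernel; [exact Hb|apply HQc]|].
    apply (ccont_mult (fun _ => - Q b)%C); [eapply cdiff_ccont, cdiff_const|].
    apply ccont_kernel; [exact Hb|apply Hid].
  - intros t _. rewrite seg_two_pi.
    pose proof (circ_sub_neq r b (2 * PI * t) Hb) as N.
    eapply cdiff_eq; [|apply (cdiff_comp (segint F b) (circ r)); [apply HP, Hcirc|apply cdiff_circ]].
    unfold F, diffquot, circ_deriv. destruct (Ceq_dec (circ r (2 * PI * t)%R) b) as [E|_].
    + exfalso. apply N. rewrite E. ring.
    + simpl. field. exact N.
Qed.

(** Inside a slightly larger circle [Q] is its Cauchy integral of order 1. By uniqueness of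
    derivatives [q] is then the one of order 2, which can be differentiated again under the integral
    sign. *)
Theorem holomorphic_derivative (Q q : C -> C) (R0 : R) :
  (forall v, Cmod v < R0 -> cdiff Q v (q v)) ->
  forall z, Cmod z < R0 -> exists d, cdiff q z d.
Proof.
  intros HQ z Hz. pose proof (Cmod_ge_0 z) as Hz0.
  set (r := (Cmod z + R0) / 2).
  assert (Hr : Cmod z < r < R0) by (unfold r; lra).
  set (rho := (fun s => Q (circ r s) * circ_deriv r s)%C).
  assert (Hrho : forall t : R, ccont rho t).
  { intros t. apply (ccont_mult (fun s => Q (circ r s)) (circ_deriv r)).
    - eapply cdiff_ccont, (cdiff_comp Q (circ r)); [apply HQ; rewrite Cmod_circ; lra|apply cdiff_circ].
    - unfold circ_deriv. eapply cdiff_ccont, cdiff_scal, cdiff_circ. }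
  assert (N : (Ci * two_pi)%C <> RtoC 0).
  { apply Cmult_neq_0; [|apply not_eq_sym, two_pi_neq_0].
    intros E. pose proof Cmod_Ci as M. rewrite E, Cmod_0 in M. lra. }
  assert (Hq : forall v, Cmod v < r -> q v = (/ (Ci * two_pi) * cauchy_int rho r 2 v)%C).
  { intros v Hv. apply (cdiff_unique Q v); [apply HQ; lra|].
    apply (cdiff_ext (fun v => / (Ci * two_pi) * cauchy_int rho r 1 v)%C _ _ _ (r - Cmod v)); [lra| |].
    - intros w Hw. pose proof (Cmod_le_add w v).
      unfold rho. rewrite (cauchy_formula Q q R0) by first [exact HQ|lra]. field.
      split; [apply not_eq_sym, two_pi_neq_0|].
      intros E. pose proof Cmod_Ci as M. rewrite E, Cmod_0 in M. lra.
    - apply cdiff_scal, cdiff_cauchy_int_1; assumption. }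
  destruct (cdiff_cauchy_int_2 rho r z (proj1 Hr) Hrho) as [e He].
  eexists. apply (cdiff_ext (fun v => / (Ci * two_pi) * cauchy_int rho r 2 v)%C _ _ _ (r - Cmod z)); [lra| |].
  - intros w Hw. symmetry. apply Hq. pose proof (Cmod_le_add w z). lra.
  - apply cdiff_scal, He.
Qed.

(** * Level crossings of the tangent angle *)

(** Greedy search: if [x] lies in one of the intervals, discard that interval and restart just
    beyond its right end, which costs at most [ell]. *)
Lemma interval_cover_gap (n : nat) : forall (l : list R) (ell x y : R),
  length l = n -> 0 <= ell -> x + INR n * ell < y ->
  exists c, x <= c <= y /\ forall a, In a l -> ~ (a <= c <= a + ell).
Proof.
  induction n as [|n IH]; intros l ell x y Hl He Hxy.
  - exists x. simpl in Hxy. split; [lra|]. apply length_zero_iff_nil in Hl. subst l. intros a [].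
  - destruct (Classical_Prop.classic (exists a, In a l /\ a <= x <= a + ell)) as [[a [Ha Hx]]|Hno].
    + destruct (in_split _ _ Ha) as [l1 [l2 ->]].
      rewrite S_INR in Hxy.
      (* Half of the slack: positive, so that the new start is strictly outside the discarded
         interval, yet small enough for the induction hypothesis. *)
      set (eta := (y - x - (INR n + 1) * ell) / 2).
      assert (Heta : 0 < eta) by (unfold eta; lra).
      destruct (IH (l1 ++ l2) ell (a + ell + eta) y) as [c [Hc Hout]].
      * rewrite length_app in *. simpl in Hl. lia.
      * exact He.
      * unfold eta in *. lra.
      * exists c. split; [lra|]. intros b Hb. apply in_app_or in Hb.
        destruct Hb as [Hb|[<-|Hb]].
        -- apply Hout, in_or_app. left; exact Hb.
        -- lra.
        -- apply Hout, in_or_app. right; exact Hb.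
    + exists x. pose proof (pos_INR (S n)). split; [nra|].
      intros a Ha Hx. apply Hno. exists a. split; assumption.
Qed.

Lemma derive_pos_local (f : R -> R) (t d : R) :
  is_derive f t d -> 0 < d -> exists del, 0 < del /\
    forall s, (t < s < t + del -> f t < f s) /\ (t - del < s < t -> f s < f t).
Proof.
  intros H Hd. apply is_derive_Reals in H.
  destruct (H (d / 2) ltac:(lra)) as [del Hdel].
  exists del. split; [apply cond_pos|]. intros s.
  assert (K : s <> t -> Rabs (s - t) < del -> 0 < (f s - f t) / (s - t)).
  { intros Hs Ha. specialize (Hdel (s - t) ltac:(lra) Ha).
    replace (t + (s - t)) with s in Hdel by ring. apply Rabs_lt_between in Hdel. lra. }
  split; intros Hs.
  - assert (P : 0 < (f s - f t) / (s - t)) by (apply K; [lra|rewrite Rabs_right; lra]).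
    assert (0 < (f s - f t) / (s - t) * (s - t)) by (apply Rmult_lt_0_compat; lra).
    replace ((f s - f t) / (s - t) * (s - t)) with (f s - f t) in H0 by (field; lra). lra.
  - assert (P : 0 < (f s - f t) / (s - t)) by (apply K; [lra|rewrite Rabs_left; lra]).
    assert (0 < (f s - f t) / (s - t) * (t - s)) by (apply Rmult_lt_0_compat; lra).
    replace ((f s - f t) / (s - t) * (t - s)) with (- (f s - f t)) in H0 by (field; lra). lra.
Qed.

(** Let [m] be the supremum of the points up to which [f] stays above [c] after [al]. There f < c
    contradicts continuity from the left, f = c would be an upcrossing with values below [c] just
    before it, and f > c lets the stretch be prolonged. *)
Lemma upcrossing_right (f df : R -> R) (c al : R) :
  (forall t, is_derive f t (df t)) -> (forall u, f u = c -> 0 < df u) ->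
  f al = c -> forall th, al < th -> c < f th.
Proof.
  intros HD Hup Hal th Hth.
  destruct (Rlt_dec c (f th)) as [|Hle]; [assumption|exfalso].
  apply Rnot_lt_le in Hle.
  assert (Hcont : forall t, continuity_pt f t).
  { intros t. apply derivable_continuous_pt. exists (df t). apply is_derive_Reals, HD. }
  destruct (derive_pos_local f al (df al) (HD al) (Hup al Hal)) as [d0 [Hd0 H0]].
  set (E := fun t => al <= t <= th /\ forall s, al < s <= t -> c < f s).
  destruct (completeness E) as [m [Hm1 Hm2]].
  { exists th. intros t [[_ Ht] _]. exact Ht. }
  { exists al. split; [lra|]. intros s Hs. lra. }
  set (t1 := Rmin (al + d0 / 2) th).
  assert (Ht1 : al < t1 <= th /\ t1 < al + d0).
  { unfold t1. pose proof (Rmin_l (al + d0 / 2) th). pose proof (Rmin_r (al + d0 / 2) th).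
    split; [split; [apply Rmin_glb_lt; lra|lra]|lra]. }
  assert (HE1 : E t1).
  { split; [lra|]. intros s Hs. rewrite <- Hal. apply (proj1 (H0 s)). lra. }
  assert (Hm : t1 <= m <= th).
  { split; [apply Hm1, HE1|]. apply Hm2. intros t [[_ Ht] _]. exact Ht. }
  assert (Hbelow : forall s, al < s < m -> c < f s).
  { intros s Hs. destruct (Rlt_dec c (f s)) as [|N]; [assumption|exfalso].
    assert (m <= s); [|lra]. apply Hm2. intros t [Ht1' Ht2].
    destruct (Rle_dec t s) as [|Hts]; [assumption|exfalso].
    apply N, Ht2. lra. }
  destruct (Rtotal_order (f m) c) as [Hlt|[Heq|Hgt]].
  - destruct (Hcont m (c - f m) ltac:(lra)) as [d [Hd Hw]].
    set (s := Rmax (m - d / 2) ((al + m) / 2)).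
    assert (Hs : al < s < m /\ m - d < s).
    { unfold s. pose proof (Rmax_l (m - d / 2) ((al + m) / 2)). pose proof (Rmax_r (m - d / 2) ((al + m) / 2)).
      split; [split; [lra|apply Rmax_lub_lt; lra]|lra]. }
    assert (Hfs : Rabs (f s - f m) < c - f m).
    { apply Hw. split; [split; [exact I|lra]|].
      unfold dist; simpl; unfold Rdist. rewrite Rabs_left; lra. }
    apply Rabs_lt_between in Hfs. specialize (Hbelow s (proj1 Hs)). lra.
  - destruct (derive_pos_local f m (df m) (HD m) (Hup m Heq)) as [d [Hd H1]].
    set (s := Rmax (m - d / 2) ((al + m) / 2)).
    assert (Hs : al < s < m /\ m - d < s).
    { unfold s. pose proof (Rmax_l (m - d / 2) ((al + m) / 2)). pose proof (Rmax_r (m - d / 2) ((al + m) / 2)).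
      split; [split; [lra|apply Rmax_lub_lt; lra]|lra]. }
    pose proof (proj2 (H1 s) ltac:(lra)). specialize (Hbelow s (proj1 Hs)). lra.
  - assert (Hmth : m < th) by (destruct (Req_dec m th) as [->|]; lra).
    destruct (Hcont m (f m - c) ltac:(lra)) as [d [Hd Hw]].
    set (t2 := Rmin (m + d / 2) th).
    assert (Ht2 : m < t2 <= th /\ t2 < m + d).
    { unfold t2. pose proof (Rmin_l (m + d / 2) th). pose proof (Rmin_r (m + d / 2) th).
      split; [split; [apply Rmin_glb_lt; lra|lra]|lra]. }
    assert (E t2).
    { split; [lra|]. intros s Hs. destruct (Rlt_dec s m) as [Hsm|Hsm]; [apply Hbelow; lra|].
      destruct (Req_dec s m) as [->|Hne]; [exact Hgt|].
      assert (Hfs : Rabs (f s - f m) < f m - c).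
      { apply Hw. split; [split; [exact I|lra]|].
        unfold dist; simpl; unfold Rdist. rewrite Rabs_right; lra. }
      apply Rabs_lt_between in Hfs. lra. }
    pose proof (Hm1 t2 H). lra.
Qed.

(** The previous lemma for t -> - f(-t), again a function with upcrossings only. *)
Lemma upcrossing_left (f df : R -> R) (c al : R) :
  (forall t, is_derive f t (df t)) -> (forall u, f u = c -> 0 < df u) ->
  f al = c -> forall th, th < al -> f th < c.
Proof.
  intros HD Hup Hal th Hth.
  assert (K : - c < - f (- (- th))).
  { apply (upcrossing_right (fun t => - f (- t)) (fun t => df (- t)) (- c) (- al)).
    - intros t. pose proof (HD (- t)) as H.
      assert (H2 : is_derive (fun s => - f (- s)) t (- (-1 * df (- t)))).
      { apply (is_derive_opp (fun s => f (- s))).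
        apply (is_derive_comp f (fun s => - s)); [exact H|]. auto_derive; [exact I|ring]. }
      replace (df (- t)) with (- (-1 * df (- t))) by ring. exact H2.
    - intros u Hu. apply Hup. lra.
    - rewrite Ropp_involutive. lra.
    - lra. }
  rewrite Ropp_involutive in K. lra.
Qed.

Lemma slope_bound (f df : R -> R) (x y s : R) :
  (forall t, is_derive f t (df t)) ->
  (forall t, Rmin x y <= t <= Rmax x y -> Rabs (df t) <= s) ->
  Rabs (f y - f x) <= s * Rabs (y - x).
Proof.
  intros HD HB.
  destruct (MVT_gen f x y df) as [m [Hm E]].
  - intros t _. apply HD.
  - intros t _. apply derivable_continuous_pt. exists (df t). apply is_derive_Reals, HD.
  - rewrite E, Rabs_mult. apply Rmult_le_compat_r; [apply Rabs_pos|]. apply HB, Hm.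
Qed.

Lemma period_shift (f : R -> R) (T : R) :
  (forall t, f (t + T) = f t + T) -> forall (p : Z) t, f (t + IZR p * T) = f t + IZR p * T.
Proof.
  intros H.
  assert (HN : forall (n : nat) t, f (t + INR n * T) = f t + INR n * T).
  { induction n as [|n IH]; intros t; [simpl; rewrite Rmult_0_l, !Rplus_0_r; reflexivity|].
    rewrite S_INR. replace (t + (INR n + 1) * T) with (t + INR n * T + T) by ring.
    rewrite H, IH. ring. }
  intros p t. destruct (Z_le_gt_dec 0 p) as [Hp|Hp].
  - rewrite <- (Z2Nat.id p Hp), <- INR_IZR_INZ. apply HN.
  - specialize (HN (Z.to_nat (- p)) (t + IZR p * T)).
    rewrite INR_IZR_INZ, Z2Nat.id, opp_IZR in HN by lia.
    replace (t + IZR p * T + - IZR p * T) with t in HN by ring. lra.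
Qed.

(* The critical part of the graph has total height < PI, so it misses some level modulo PI. *)
Lemma regular_level (psi dpsi : R -> R) :
  (forall t, is_derive psi t (dpsi t)) -> (forall t, continuity_pt dpsi t) ->
  (forall t, - (1 / 2) < dpsi t) ->
  (forall t, psi (t + 2 * PI) = psi t + 2 * PI) ->
  (forall t, dpsi (t + 2 * PI) = dpsi t) ->
  exists c, forall (n : Z) u, psi u = c + IZR n * PI -> 0 < dpsi u.
Proof.
  intros HD HC Hlow Hper Hdper.
  pose proof PI_RGT_0 as Hpi.
  destruct (continuity_ab_min dpsi 0 (2 * PI)) as [tm [Hmin _]]; [lra|intros; apply HC|].
  (* By compactness the slope is at least -sg with sg < 1/2. The value 1/4 merely keeps [sg]
     positive, as it also serves as a modulus of oscillation. *)
  set (sg := Rmax (1 / 4) (- dpsi tm)).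
  assert (Hsg : 1 / 4 <= sg < 1 / 2).
  { unfold sg. split; [apply Rmax_l|]. apply Rmax_lub_lt; [lra|]. specialize (Hlow tm). lra. }
  assert (Hsgl : forall t, 0 <= t <= 2 * PI -> - sg <= dpsi t).
  { intros t Ht. specialize (Hmin t Ht). pose proof (Rmax_r (1 / 4) (- dpsi tm)). unfold sg. lra. }
  assert (Hpsc : forall t, continuity_pt psi t).
  { intros t. apply derivable_continuous_pt. exists (dpsi t). apply is_derive_Reals, HD. }
  assert (HK : exists K : nat, forall t, 0 <= t <= 2 * PI -> Rabs (psi t) <= INR K * PI).
  { destruct (continuity_ab_maj (fun t => Rabs (psi t)) 0 (2 * PI)) as [tx [Hmax _]]; [lra| |].
    { intros t _. apply (continuity_pt_comp psi Rabs); [apply Hpsc|apply Rcontinuity_abs]. }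
    destruct (INR_unbounded (Rabs (psi tx) / PI)) as [K HK]. exists K. intros t Ht.
    specialize (Hmax t Ht). apply Rle_trans with (Rabs (psi tx)); [exact Hmax|].
    apply Rmult_lt_compat_r with (r := PI) in HK; [|lra].
    replace (Rabs (psi tx) / PI * PI) with (Rabs (psi tx)) in HK by (field; lra). lra. }
  destruct HK as [K HK].
  (* On cells shorter than [del] the slope varies by less than [sg]. A cell with a critical point
     thus has |dpsi| <= sg throughout, and its critical values lie within sg w / 2 of the value of
     [psi] at its midpoint. *)
  destruct (Heine dpsi (fun t => 0 <= t <= 2 * PI) (compact_P3 0 (2 * PI))
    (fun t _ => HC t) (mkposreal sg ltac:(lra))) as [del Hunif].
  destruct (INR_unbounded (2 * PI / del)) as [N HN].
  pose proof (cond_pos del) as Hdel.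
  assert (HN0 : 0 < INR N) by (eapply Rlt_trans; [|exact HN]; apply Rdiv_lt_0_compat; lra).
  set (w := 2 * PI / INR N).
  assert (Hw : 0 < w < del).
  { unfold w. split; [apply Rdiv_lt_0_compat; lra|].
    apply Rmult_lt_reg_r with (INR N / del); [apply Rdiv_lt_0_compat; lra|].
    replace (2 * PI / INR N * (INR N / del)) with (2 * PI / del) by (field; lra).
    replace (del * (INR N / del)) with (INR N) by (field; lra). exact HN. }
  assert (HwN : INR N * w = 2 * PI) by (unfold w; field; lra).
  (* Instead of working modulo PI, the level is sought in the long interval from 0 to m PI. The
     forbidden intervals there have total length 2 PI sg (m + 2 K + 1), and [m] is chosen large
     enough to make this less than m PI. *)
  destruct (INR_unbounded ((2 * INR K + 1) / (1 - 2 * sg))) as [m Hm].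
  assert (Hm' : 2 * INR K + 1 < INR m * (1 - 2 * sg)).
  { apply Rmult_lt_compat_r with (r := 1 - 2 * sg) in Hm; [|lra].
    replace ((2 * INR K + 1) / (1 - 2 * sg) * (1 - 2 * sg)) with (2 * INR K + 1) in Hm by (field; lra).
    exact Hm. }
  set (midp := fun k : nat => (INR k + 1 / 2) * w).
  (* Since |psi| <= K PI over one period, only translates by j PI with -K <= j <= m + K can meet the
     long interval: m + 2 K + 1 of them, indexed by j + K. *)
  set (J := (m + 2 * K + 1)%nat).
  set (left_end := fun ki : nat * nat =>
    psi (midp (fst ki)) - sg * (w / 2) + (INR (snd ki) - INR K) * PI).
  set (l := map left_end (list_prod (seq 0 N) (seq 0 J))).
  destruct (interval_cover_gap (length l) l (sg * w) 0 (INR m * PI)) as [c [Hc Hgap]].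
  - reflexivity.
  - apply Rmult_le_pos; lra.
  - unfold l. rewrite length_map, length_prod, !length_seq, mult_INR.
    replace (0 + INR N * INR J * (sg * w)) with (INR J * sg * (INR N * w)) by ring.
    rewrite HwN. unfold J. rewrite !plus_INR, mult_INR. simpl (INR 2). simpl (INR 1).
    pose proof (pos_INR K) as HK0. pose proof (pos_INR m) as Hm0.
    replace ((INR m + (1 + 1) * INR K + 1) * sg * (2 * PI))
      with ((2 * sg * INR m + 2 * sg * (2 * INR K + 1)) * PI) by ring.
    apply Rmult_lt_compat_r; [lra|]. nra.
  - exists c. intros n u Hu.
    set (p := Int_part (u / (2 * PI))).
    set (u0 := u - IZR p * (2 * PI)).
    assert (Hu0 : 0 <= u0 < 2 * PI).
    { unfold u0, p. pose proof (base_Int_part (u / (2 * PI))) as [B1 B2].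
      set (q := IZR (Int_part (u / (2 * PI)))) in *.
      assert (E : u = u / (2 * PI) * (2 * PI)) by (field; lra).
      split; [rewrite E at 1|rewrite E at 1]; nra. }
    assert (Eu : u = u0 + IZR p * (2 * PI)) by (unfold u0; ring).
    assert (Ed : dpsi u = dpsi u0).
    { rewrite Eu. pose proof (period_shift (fun t => dpsi t + t) (2 * PI)) as PS.
      assert (H1 : forall t, dpsi (t + 2 * PI) + (t + 2 * PI) = dpsi t + t + 2 * PI)
        by (intros t; rewrite Hdper; ring).
      specialize (PS H1 p u0). simpl in PS. lra. }
    assert (Ep : psi u = psi u0 + IZR p * (2 * PI)).
    { rewrite Eu at 1. apply (period_shift psi (2 * PI) Hper). }
    rewrite Ed.
    destruct (Rlt_dec 0 (dpsi u0)) as [|Hneg]; [assumption|exfalso].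
    set (j := (2 * p - n)%Z).
    assert (Ec : c = psi u0 + IZR j * PI).
    { unfold j. rewrite minus_IZR, mult_IZR. rewrite Ep in Hu. lra. }
    assert (Hj : (- Z.of_nat K <= j <= Z.of_nat K + Z.of_nat m)%Z).
    { specialize (HK u0 ltac:(lra)). apply Rabs_le_between in HK.
      split; apply le_IZR.
      - rewrite opp_IZR, <- INR_IZR_INZ. apply Rmult_le_reg_r with PI; lra.
      - rewrite plus_IZR, <- !INR_IZR_INZ. apply Rmult_le_reg_r with PI; lra. }
    set (k := Z.to_nat (Int_part (u0 / w))).
    pose proof (base_Int_part (u0 / w)) as [B1 B2].
    set (zi := Int_part (u0 / w)) in *.
    assert (Hq : 0 <= u0 / w) by (apply Rdiv_le_0_compat; lra).
    assert (Hzi : (0 <= zi)%Z).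
    { assert (-1 < zi)%Z; [|lia]. apply lt_IZR. lra. }
    assert (Ek : INR k = IZR zi) by (unfold k; rewrite INR_IZR_INZ, Z2Nat.id by exact Hzi; reflexivity).
    assert (Hku : INR k * w <= u0 < (INR k + 1) * w).
    { rewrite Ek. assert (E : u0 = u0 / w * w) by (field; lra).
      split; [rewrite E at 1|rewrite E at 1]; nra. }
    assert (HkN : (k < N)%nat).
    { apply INR_lt. apply Rmult_lt_reg_r with w; lra. }
    assert (HkN1 : INR k + 1 <= INR N).
    { rewrite <- S_INR. apply le_INR. lia. }
    assert (Hkw : (INR k + 1) * w <= 2 * PI) by (rewrite <- HwN; apply Rmult_le_compat_r; lra).
    pose proof (pos_INR k) as Hk0.
    assert (Hclose : Rabs (psi u0 - psi (midp k)) <= sg * (w / 2)).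
    { apply Rle_trans with (sg * Rabs (u0 - midp k)).
      - apply (slope_bound psi dpsi); [exact HD|]. intros t Ht.
        assert (Htk : INR k * w <= t <= (INR k + 1) * w).
        { unfold midp in Ht. revert Ht. unfold Rmin, Rmax. destruct (Rle_dec _ _); intros; lra. }
        assert (Ht2 : 0 <= t <= 2 * PI) by nra.
        specialize (Hunif t u0 Ht2 ltac:(lra)). simpl in Hunif.
        assert (Htu : Rabs (t - u0) < del) by (apply Rabs_lt_between; lra).
        specialize (Hunif Htu). apply Rabs_lt_between in Hunif.
        specialize (Hsgl t Ht2). apply Rabs_le_between. lra.
      - apply Rmult_le_compat_l; [lra|]. apply Rabs_le_between. unfold midp. lra. }
    apply Rabs_le_between in Hclose.
    set (i := Z.to_nat (j + Z.of_nat K)).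
    assert (Ei : INR i = IZR j + INR K).
    { unfold i. rewrite INR_IZR_INZ, Z2Nat.id by lia. rewrite plus_IZR, <- INR_IZR_INZ. reflexivity. }
    apply (Hgap (left_end (k, i))).
    + unfold l. apply in_map, in_prod; apply in_seq; [lia|]. unfold J, i. lia.
    + unfold left_end. simpl. rewrite Ei. lra.
Qed.

(** A level crossed upwards only is crossed once, with smaller values before and larger ones after.
    Hence [psi] is confined between consecutive levels on each of the two arcs. The point [t0] will
    supply the one strictly positive boundary value that the minimum argument needs. *)
Lemma level_arcs (psi dpsi : R -> R) :
  (forall t, is_derive psi t (dpsi t)) -> (forall t, continuity_pt dpsi t) ->
  (forall t, - (1 / 2) < dpsi t) ->
  (forall t, psi (t + 2 * PI) = psi t + 2 * PI) ->
  (forall t, dpsi (t + 2 * PI) = dpsi t) ->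
  exists c al be, al < be < al + 2 * PI /\
    (forall t, al <= t <= be -> c <= psi t <= c + PI) /\
    (forall t, be <= t <= al + 2 * PI -> c + PI <= psi t <= c + 2 * PI) /\
    exists t0, al < t0 < be /\ psi t0 = c + PI / 2.
Proof.
  intros HD HC Hlow Hper Hdper. pose proof PI_RGT_0 as Hpi.
  destruct (regular_level psi dpsi HD HC Hlow Hper Hdper) as [c Hreg].
  assert (Hup0 : forall u, psi u = c -> 0 < dpsi u).
  { intros u Hu. apply (Hreg 0%Z). rewrite Hu. simpl. ring. }
  assert (Hup1 : forall u, psi u = c + PI -> 0 < dpsi u).
  { intros u Hu. apply (Hreg 1%Z). rewrite Hu. simpl. ring. }
  assert (Hpsc : Ranalysis1.continuity psi).
  { intros t. apply derivable_continuous_pt. exists (dpsi t). apply is_derive_Reals, HD. }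
  assert (Hsurj : forall y, exists x, psi x = y).
  { intros y. destruct (INR_unbounded ((Rabs (psi 0) + Rabs y) / (2 * PI))) as [n Hn].
    assert (Hn2 : Rabs (psi 0) + Rabs y < INR n * (2 * PI)).
    { apply Rmult_lt_compat_r with (r := 2 * PI) in Hn; [|lra].
      replace ((Rabs (psi 0) + Rabs y) / (2 * PI) * (2 * PI)) with (Rabs (psi 0) + Rabs y) in Hn
        by (field; lra). exact Hn. }
    pose proof (period_shift psi (2 * PI) Hper (Z.of_nat n) 0) as P1.
    pose proof (period_shift psi (2 * PI) Hper (- Z.of_nat n) 0) as P2.
    rewrite opp_IZR in P2. rewrite <- INR_IZR_INZ in P1, P2.
    pose proof (Rle_abs (psi 0)). pose proof (Rle_abs (- psi 0)). rewrite Rabs_Ropp in *.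
    pose proof (Rle_abs y). pose proof (Rle_abs (- y)). rewrite (Rabs_Ropp y) in *.
    destruct (IVT_gen psi (0 + - INR n * (2 * PI)) (0 + INR n * (2 * PI)) y Hpsc) as [x [_ Hx]].
    - rewrite P1, P2. rewrite Rmin_left, Rmax_right by lra. lra.
    - exists x. exact Hx. }
  destruct (Hsurj c) as [al Hal]. destruct (Hsurj (c + PI)) as [be Hbe].
  pose proof (upcrossing_right psi dpsi c al HD Hup0 Hal) as R0.
  pose proof (upcrossing_left psi dpsi c al HD Hup0 Hal) as L0.
  pose proof (upcrossing_right psi dpsi (c + PI) be HD Hup1 Hbe) as R1.
  pose proof (upcrossing_left psi dpsi (c + PI) be HD Hup1 Hbe) as L1.
  assert (Hab : al < be).
  { destruct (Rtotal_order al be) as [|[E|Hlt]]; [assumption| |].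
    - rewrite E in Hal. lra.
    - specialize (L0 be Hlt). lra. }
  assert (Hal2 : psi (al + 2 * PI) = c + 2 * PI) by (rewrite Hper, Hal; ring).
  assert (Hba : be < al + 2 * PI).
  { destruct (Rtotal_order be (al + 2 * PI)) as [|[E|Hlt]]; [assumption| |].
    - rewrite E in Hbe. lra.
    - specialize (L1 (al + 2 * PI) Hlt). lra. }
  exists c, al, be. split; [lra|]. split; [|split].
  - intros t Ht. split.
    + destruct (Req_dec al t) as [<-|]; [lra|]. left. apply R0. lra.
    + destruct (Req_dec be t) as [<-|]; [lra|]. left. apply L1. lra.
  - intros t Ht. split.
    + destruct (Req_dec be t) as [<-|]; [lra|]. left. apply R1. lra.
    + destruct (Req_dec t (al + 2 * PI)) as [->|]; [lra|].
      pose proof (Hper (t - 2 * PI)) as P. replace (t - 2 * PI + 2 * PI) with t in P by ring.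
      pose proof (L0 (t - 2 * PI) ltac:(lra)). lra.
  - destruct (IVT_gen psi al be (c + PI / 2) Hpsc) as [x [Hx Ex]].
    + rewrite Hal, Hbe, Rmin_left, Rmax_right; lra.
    + rewrite Rmin_left, Rmax_right in Hx by lra. exists x. split; [|exact Ex].
      split; destruct Hx as [[H1|H1] [H2|H2]]; try lra; subst; lra.
Qed.

(** * Positive real part from boundary values *)

Lemma Cexp_Clog (u : C) : 0 < Re u -> Cexp (Clog u) = u.
Proof.
  intros Hu. destruct u as [x y]. simpl in Hu.
  unfold Cexp, Clog, Carg. simpl. destruct (Rlt_dec 0 x) as [_|N]; [|lra].
  assert (Hm : 0 < Cmod (x, y)) by (pose proof (re_le_Cmod (x, y)) as H; simpl in H; rewrite Rabs_right in H; lra).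
  rewrite exp_ln by exact Hm. rewrite sin_atan, cos_atan.
  assert (E : sqrt (1 + (y / x)²) = Cmod (x, y) / x).
  { replace (1 + (y / x)²) with ((x ^ 2 + y ^ 2) / x ^ 2) by (unfold Rsqr; field; lra).
    rewrite sqrt_div_alt by nra. rewrite sqrt_pow2 by lra. reflexivity. }
  rewrite E. apply (f_equal2 pair); field; lra.
Qed.

Lemma Clog_Im_bound (u : C) : 0 < Re u -> - (PI / 2) < Im (Clog u) < PI / 2.
Proof.
  intros Hu. unfold Clog, Carg. simpl. destruct (Rlt_dec 0 (Re u)) as [_|N]; [|lra].
  pose proof (atan_bound (Im u / Re u)). lra.
Qed.

Lemma Clog_Cexp (w : C) : - (PI / 2) < Im w < PI / 2 -> Clog (Cexp w) = w.
Proof.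
  intros Hw. unfold Clog. rewrite Cmod_Cexp, ln_exp.
  pose proof (cos_gt_0 (Im w) (proj1 Hw) (proj2 Hw)) as Hc. pose proof (exp_pos (Re w)) as He.
  unfold Carg. simpl. destruct (Rlt_dec 0 (exp (Re w) * cos (Im w))) as [_|N]; [|nra].
  replace (exp (Re w) * sin (Im w) / (exp (Re w) * cos (Im w))) with (tan (Im w))
    by (unfold tan; field; lra).
  rewrite atan_tan by lra. destruct w; reflexivity.
Qed.

Definition cis (x : R) : C := (cos x, sin x).

Lemma cis_plus (x y : R) : cis (x + y) = (cis x * cis y)%C.
Proof. unfold cis, Cmult; simpl. rewrite cos_plus, sin_plus. f_equal; ring. Qed.

Lemma Cexp_polar (w : C) : Cexp w = (RtoC (exp (Re w)) * cis (Im w))%C.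
Proof. unfold Cexp, cis, RtoC, Cmult; simpl. f_equal; ring. Qed.

Lemma circ_cis (t : R) : circ 1 t = cis t.
Proof.
  unfold circ. rewrite Cexp_polar. simpl.
  replace (0 * t - 1 * 0) with 0 by ring. replace (0 * 0 + 1 * t) with t by ring.
  rewrite exp_0. ring.
Qed.

Lemma Cmod_cis (x : R) : Cmod (cis x) = 1.
Proof. rewrite <- circ_cis. apply Cmod_circ. lra. Qed.

(** The half-angle form isolates a real factor, which carries the sign, from a phase that is linear
    in [x]. *)
Lemma one_minus_cis (x : R) : (1 - cis x)%C = (-2 * Ci * RtoC (sin (x / 2)) * cis (x / 2))%C.
Proof.
  unfold cis. replace (cos x) with (1 - 2 * (sin (x / 2) * sin (x / 2))).
  2:{ replace (cos x) with (cos (2 * (x / 2))) by (f_equal; field). rewrite cos_2a_sin. ring. }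
  replace (sin x) with (2 * sin (x / 2) * cos (x / 2)).
  2:{ rewrite <- sin_2a. f_equal. field. }
  unfold RtoC, Ci, Cminus, Cplus, Copp, Cmult; simpl. f_equal; ring.
Qed.

Lemma ccont_Re (F : C -> C) (t : R) : ccont F t -> continuity_pt (fun x : R => Re (F x)) t.
Proof.
  intros H eps He. destruct (H eps He) as [del [Hd Hw]]. exists del. split; [exact Hd|].
  intros x [_ Hx]. unfold dist in *; simpl in *; unfold Rdist in *.
  eapply Rle_lt_trans; [apply (re_le_Cmod (F x - F t))|]. apply Hw.
  rewrite <- RtoC_minus, Cmod_R. exact Hx.
Qed.

Lemma nondecreasing_of_derive (f df : R -> R) (x y : R) :
  (forall t, is_derive f t (df t)) -> x <= y -> (forall t, x <= t <= y -> 0 <= df t) -> f x <= f y.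
Proof.
  intros HD Hxy Hpos.
  destruct (MVT_gen f x y df) as [m [Hm E]].
  - intros t _. apply HD.
  - intros t _. apply derivable_continuous_pt. exists (df t). apply is_derive_Reals, HD.
  - rewrite Rmin_left, Rmax_right in Hm by exact Hxy. specialize (Hpos m Hm). nra.
Qed.

(* The primitive of the Poisson-weighted difference quotient is periodic along the
   circle, so its derivative, a positive multiple of Re P - Re P(a), must change sign. *)
Lemma Re_pos_of_boundary (P p : C -> C) (R0 al t0 : R) :
  1 < R0 -> (forall v, Cmod v < R0 -> cdiff P v (p v)) ->
  (forall t, al <= t <= al + 2 * PI -> 0 <= Re (P (circ 1 t))) ->
  al < t0 < al + 2 * PI -> 0 < Re (P (circ 1 t0)) ->
  forall a, Cmod a < 1 -> 0 < Re (P a).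
Proof.
  intros HR HP Hbd Ht0 Hp0 a Ha.
  destruct (Rlt_dec 0 (Re (P a))) as [|Hneg]; [assumption|exfalso].
  pose proof (Cmod_ge_0 a) as Ha0.
  (* The second bound keeps the zero of 1 - conj(a) v outside while still going beyond the unit
     circle. *)
  set (R1 := Rmin R0 (2 / (1 + Cmod a))).
  assert (HR1 : 1 < R1).
  { apply Rmin_glb_lt; [exact HR|]. apply Rmult_lt_reg_r with (1 + Cmod a); [lra|].
    replace (2 / (1 + Cmod a) * (1 + Cmod a)) with 2 by (field; lra). lra. }
  assert (HR10 : R1 <= R0) by apply Rmin_l.
  assert (Hden : forall v, Cmod v < R1 -> (1 - Cconj a * v)%C <> RtoC 0).
  { intros v Hv E. assert (E2 : (Cconj a * v)%C = RtoC 1).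
    { replace (Cconj a * v)%C with (1 - (1 - Cconj a * v))%C by ring. rewrite E. ring. }
    assert (M : Cmod a * Cmod v = 1).
    { rewrite <- (Cmod_conj a), <- Cmod_mult, E2. apply Cmod_1. }
    assert (Hv2 : Cmod v < 2 / (1 + Cmod a)) by (eapply Rlt_le_trans; [exact Hv|apply Rmin_r]).
    assert (Hv3 : Cmod v * (1 + Cmod a) < 2).
    { apply Rmult_lt_compat_r with (r := 1 + Cmod a) in Hv2; [|lra].
      replace (2 / (1 + Cmod a) * (1 + Cmod a)) with 2 in Hv2 by (field; lra). exact Hv2. }
    pose proof (Cmod_ge_0 v). nra. }
  set (k := 1 - Cmod a * Cmod a). assert (Hk : 0 < k) by (unfold k; nra).
  (* At e on the unit circle 1 - conj(a) e = e conj(e - a). Multiplied by the tangent i e, [F] thus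
     becomes i (P e - P a) times the Poisson kernel k / |e - a|^2. *)
  set (F := fun v => (diffquot P p a v * (RtoC k / (1 - Cconj a * v)))%C).
  assert (HQ : forall v, Cmod v < R1 -> exists e, cdiff (fun v => RtoC k / (1 - Cconj a * v))%C v e).
  { intros v Hv. eexists. apply cdiff_div; [apply Hden, Hv|apply cdiff_const|].
    apply cdiff_minus; [apply cdiff_const|apply cdiff_scal, cdiff_id]. }
  assert (HFd : forall v, Cmod v < R1 -> v <> a -> exists d, cdiff F v d).
  { intros v Hv Hva. destruct (diffquot_diff P p a v (p v) Hva) as [e He]; [apply HP; lra|].
    destruct (HQ v Hv) as [e2 He2]. eexists. apply cdiff_mult; [exact He|exact He2]. }
  assert (HFc : forall v, Cmod v < R1 -> ccont F v).
  { intros v Hv. destruct (Ceq_dec v a) as [->|Hva].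
    - destruct (HQ a Hv) as [e2 He2]. apply ccont_mult; [apply diffquot_cont, HP; lra|].
      eapply cdiff_ccont, He2.
    - destruct (HFd v Hv Hva) as [d Hd]. eapply cdiff_ccont, Hd. }
  pose proof (disk_primitive F a R1 ltac:(lra) HFc HFd) as HPhi.
  assert (Hcirc : forall t : R, Cmod (circ 1 t) = 1) by (intros t; apply Cmod_circ; lra).
  set (Af := fun t : R => Im (segint F a (circ 1 t))).
  set (dA := fun t : R => (Re (P (circ 1 t)) - Re (P a)) * (k / Cmod (circ 1 t - a) ^ 2)).
  assert (Hne : forall t : R, (circ 1 t - a)%C <> RtoC 0) by (intros t; apply circ_sub_neq, Ha).
  assert (HdA : forall t, is_derive Af t (dA t)).
  { intros t. unfold Af.
    replace (dA t) with (Im (F (circ 1 t) * (Ci * circ 1 t))%C).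
    { apply (cdiff_Im (fun s => segint F a (circ 1 s))).
      apply (cdiff_comp (segint F a) (circ 1)); [apply HPhi; rewrite Hcirc; exact HR1|apply cdiff_circ]. }
    specialize (Hne t). specialize (Hcirc t). unfold dA. set (e := circ 1 t) in *.
    assert (Ee : (e * Cconj e)%C = RtoC 1).
    { rewrite <- Cmod2_conj, Hcirc. f_equal. ring. }
    assert (E1 : (1 - Cconj a * e)%C = (e * Cconj (e - a))%C).
    { rewrite <- Ee, Cminus_conj. ring. }
    assert (Ne : e <> RtoC 0) by (apply Cmod_gt_0; lra).
    assert (Nc : Cconj (e - a) <> RtoC 0) by (apply Cmod_gt_0; rewrite Cmod_conj; apply Cmod_gt_0, Hne).
    assert (E2 : (F e * (Ci * e))%C = (Ci * ((P e - P a) * RtoC (k / Cmod (e - a) ^ 2)))%C).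
    { unfold F, diffquot. destruct (Ceq_dec e a) as [E|_]; [exfalso; apply Hne; rewrite E; ring|].
      rewrite E1, RtoC_div, Cmod2_conj.
      - field. repeat split; assumption.
      - apply Rgt_not_eq, pow_lt, Cmod_gt_0, Hne. }
    rewrite E2. destruct (P e), (P a). simpl. ring. }
  assert (Hpos : forall t, al <= t <= al + 2 * PI -> 0 <= dA t).
  { intros t Ht. unfold dA. apply Rmult_le_pos; [specialize (Hbd t Ht); lra|].
    left. apply Rdiv_lt_0_compat; [exact Hk|]. apply pow_lt, Cmod_gt_0, Hne. }
  assert (Hpos0 : 0 < dA t0).
  { unfold dA. apply Rmult_lt_0_compat; [lra|].
    apply Rdiv_lt_0_compat; [exact Hk|]. apply pow_lt, Cmod_gt_0, Hne. }
  destruct (derive_pos_local Af t0 (dA t0) (HdA t0) Hpos0) as [del [Hdel Hloc]].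
  set (s := Rmin (t0 + del / 2) (al + 2 * PI)).
  assert (Hs : t0 < s <= al + 2 * PI /\ s < t0 + del).
  { unfold s. pose proof (Rmin_l (t0 + del / 2) (al + 2 * PI)). pose proof (Rmin_r (t0 + del / 2) (al + 2 * PI)).
    split; [split; [apply Rmin_glb_lt; lra|lra]|lra]. }
  pose proof (proj1 (Hloc s) ltac:(lra)) as H1.
  assert (H2 : Af al <= Af t0).
  { apply (nondecreasing_of_derive Af dA); [exact HdA|lra|]. intros t Ht. apply Hpos. lra. }
  assert (H3 : Af s <= Af (al + 2 * PI)).
  { apply (nondecreasing_of_derive Af dA); [exact HdA|lra|]. intros t Ht. apply Hpos. lra. }
  assert (H4 : Af (al + 2 * PI) = Af al) by (unfold Af; rewrite circ_period; reflexivity).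
  lra.
Qed.

(** * Univalence under the Ozaki condition *)

Lemma Cmod_lt_sqr (z w : C) :
  Re z * Re z + Im z * Im z < Re w * Re w + Im w * Im w -> Cmod z < Cmod w.
Proof.
  intros H. pose proof (Cmod_ge_0 z). pose proof (Cmod_ge_0 w).
  pose proof (Cmod2_alt z). pose proof (Cmod2_alt w). nra.
Qed.

(** The zero [D] and the pole 1 / D of this Moebius map both lie on the unit circle, so the circle
    goes to a line. The sign comes from Re (i (D - w) conj(1 - D w)) = - Im D (1 - |w|^2), valid for
    |D| = 1. *)
Lemma disk_to_halfplane (D w : C) :
  Cmod D = 1 -> Im D < 0 -> Cmod w < 1 ->
  (1 - D * w)%C <> RtoC 0 /\ 0 < Re (Ci * (D - w) / (1 - D * w))%C.
Proof.
  intros HD HI Hw.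
  assert (N : (1 - D * w)%C <> RtoC 0).
  { intros E. assert (M : Cmod (D * w) = 1).
    { replace (D * w)%C with (1 - (1 - D * w))%C by ring. rewrite E.
      replace (1 - 0)%C with (RtoC 1) by ring. apply Cmod_1. }
    rewrite Cmod_mult, HD in M. lra. }
  split; [exact N|].
  set (Y := (1 - D * w)%C) in *.
  assert (NY : Cconj Y <> RtoC 0) by (apply Cmod_gt_0; rewrite Cmod_conj; apply Cmod_gt_0, N).
  pose proof (proj1 (Cmod_gt_0 Y) N) as HY.
  replace (Ci * (D - w) / Y)%C with (RtoC (/ (Cmod Y ^ 2)) * (Ci * (D - w) * Cconj Y))%C.
  2:{ rewrite RtoC_inv by (apply Rgt_not_eq, pow_lt, HY). rewrite Cmod2_conj. field. split; assumption. }
  assert (E : Re (Ci * (D - w) * Cconj Y)%C = - Im D * (1 - Cmod w ^ 2)).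
  { pose proof (Cmod2_alt D) as HD2. rewrite HD in HD2. rewrite (Cmod2_alt w). unfold Y.
    destruct D as [p q], w as [x y]. simpl in *.
    transitivity (- q + (1 - (p * p + q * q)) * y + q * (x * x + y * y)).
    - ring.
    - replace (p * p + q * q) with 1 by lra. ring. }
  replace (Re (RtoC (/ Cmod Y ^ 2) * (Ci * (D - w) * Cconj Y))%C)
    with (/ Cmod Y ^ 2 * Re (Ci * (D - w) * Cconj Y)%C)
    by (destruct (Ci * (D - w) * Cconj Y)%C; simpl; ring).
  rewrite E. apply Rmult_lt_0_compat; [apply Rinv_0_lt_compat, pow_lt, HY|].
  pose proof (Cmod_ge_0 w). apply Rmult_lt_0_compat; [lra|]. nra.
Qed.

(** The inverse of the preceding map. For |D| = 1 the squared moduli of denominator and numerator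
    differ by -4 Im D Re u, which is positive. *)
Lemma halfplane_to_disk (D u : C) :
  Cmod D = 1 -> Im D < 0 -> 0 < Re u ->
  (u * D - Ci)%C <> RtoC 0 /\ Cmod ((u - Ci * D) / (u * D - Ci)) < 1.
Proof.
  intros HD HI Hu.
  assert (Hlt : Cmod (u - Ci * D) < Cmod (u * D - Ci)).
  { apply Cmod_lt_sqr. pose proof (Cmod2_alt D) as HD2. rewrite HD in HD2.
    destruct D as [p q], u as [x y]. simpl in *.
    assert (E : p * p + q * q = 1) by lra.
    match goal with |- ?l < ?r => replace r with (l + (x * x + y * y - 1) * (p * p + q * q - 1) - 4 * q * x) by ring end.
    rewrite E. nra. }
  assert (N : (u * D - Ci)%C <> RtoC 0).
  { apply Cmod_gt_0. eapply Rle_lt_trans; [apply Cmod_ge_0|exact Hlt]. }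
  split; [exact N|]. rewrite Cmod_div by exact N.
  pose proof (Cmod_ge_0 (u - Ci * D)).
  apply Rmult_lt_reg_r with (Cmod (u * D - Ci)); [lra|].
  replace (Cmod (u - Ci * D) / Cmod (u * D - Ci) * Cmod (u * D - Ci)) with (Cmod (u - Ci * D))
    by (field; lra). lra.
Qed.

Lemma Ci_neq_0 : Ci <> RtoC 0.
Proof. apply Cmod_gt_0. rewrite Cmod_Ci. lra. Qed.

(* [v |-> log ((1 - mu v / D) / (1 - mu D v))] maps the disk onto a strip; along the
   preimage of a segment of the strip the derivative of [kap g] stays in a half plane. *)
Lemma strip_injective (g dg : C -> C) (kap mu D : C) :
  Cmod D = 1 -> Im D < 0 -> Cmod mu = 1 ->
  (forall v, Cmod v < 1 -> cdiff g v (dg v)) ->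
  (forall v, Cmod v < 1 -> 0 < Re (kap * (1 - mu / D * v) * (1 - mu * D * v) * dg v)%C) ->
  forall z1 z2, Cmod z1 < 1 -> Cmod z2 < 1 -> g z1 = g z2 -> z1 = z2.
Proof.
  intros HD HI Hmu Hg HP z1 z2 Hz1 Hz2 Eg.
  assert (ND : D <> RtoC 0) by (apply Cmod_gt_0; lra).
  assert (Nmu : mu <> RtoC 0) by (apply Cmod_gt_0; lra).
  assert (ND2 : (D * D - 1)%C <> RtoC 0).
  { intros E. pose proof (Cmod2_alt D) as HD2. rewrite HD in HD2.
    destruct D as [p q]. unfold RtoC, Cminus, Cplus, Copp, Cmult in E. simpl in *.
    injection E as E1 E2. nra. }
  set (toU := fun z => (Ci * (D - mu * z) / (1 - D * (mu * z)))%C).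
  set (ofU := fun u => ((u - Ci * D) / (u * D - Ci))%C).
  assert (HmuD : forall z, Cmod z < 1 -> Cmod (mu * z) < 1) by (intros z Hz; rewrite Cmod_mult, Hmu; lra).
  assert (Hof : forall z, Cmod z < 1 -> (ofU (toU z) / mu)%C = z).
  { intros z Hz. destruct (disk_to_halfplane D (mu * z) HD HI (HmuD z Hz)) as [N HU].
    destruct (halfplane_to_disk D _ HD HI HU) as [N2 _].
    unfold ofU, toU.
    replace (Ci * (D - mu * z) / (1 - D * (mu * z)) - Ci * D)%C
      with (Ci * (D * D - 1) * (mu * z) / (1 - D * (mu * z)))%C by (field; exact N).
    replace (Ci * (D - mu * z) / (1 - D * (mu * z)) * D - Ci)%C
      with (Ci * (D * D - 1) / (1 - D * (mu * z)))%C by (field; exact N).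
    field. repeat split; try assumption. apply Ci_neq_0. }
  set (u1 := toU z1). set (u2 := toU z2).
  assert (Hu1 : 0 < Re u1) by (apply disk_to_halfplane; auto).
  assert (Hu2 : 0 < Re u2) by (apply disk_to_halfplane; auto).
  (* The logarithm takes the half plane to the strip |Im| < PI / 2, where the two image points can
     be joined by a segment. *)
  set (L1 := Clog u1). set (L2 := Clog u2).
  destruct (Ceq_dec L1 L2) as [EL|NL].
  { rewrite <- (Hof z1 Hz1), <- (Hof z2 Hz2). fold u1 u2.
    rewrite <- (Cexp_Clog u1 Hu1), <- (Cexp_Clog u2 Hu2). fold L1 L2. rewrite EL. reflexivity. }
  exfalso.
  assert (NL' : (L2 - L1)%C <> RtoC 0) by (apply Csub_neq; congruence).
  set (u := fun s => Cexp (L1 + s * (L2 - L1))).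
  set (zt := fun s => (ofU (u s) / mu)%C).
  (* The velocity of [zt] is a constant times (1 - mu z / D) (1 - mu D z). The factor [k] normalises
     that constant, so that the derivative of k g along the path is exactly the expression assumed
     to have positive real part. *)
  set (k := (kap * mu * (D - / D) / (L2 - L1))%C).
  assert (Hpos : forall t : R, 0 <= t <= 1 -> 0 < Re (u t)).
  { intros t Ht.
    assert (EI : forall a b : C, Im (a + t * (b - a))%C = Im a + t * (Im b - Im a))
      by (intros [a1 a2] [b1 b2]; simpl; ring).
    unfold u, Cexp. cbn [Re fst]. apply Rmult_lt_0_compat; [apply exp_pos|]. rewrite EI.
    pose proof (Clog_Im_bound u1 Hu1) as B1. pose proof (Clog_Im_bound u2 Hu2) as B2.
    fold L1 in B1. fold L2 in B2. set (b1 := Im L1) in *. set (b2 := Im L2) in *.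
    assert (HB : Rmin b1 b2 <= b1 + t * (b2 - b1) <= Rmax b1 b2)
      by (unfold Rmin, Rmax; destruct (Rle_dec b1 b2); split; nra).
    pose proof (Rmin_glb_lt b1 b2 (- (PI / 2)) ltac:(lra) ltac:(lra)).
    pose proof (Rmax_lub_lt b1 b2 (PI / 2) ltac:(lra) ltac:(lra)).
    apply cos_gt_0; lra. }
  assert (Hin : forall t : R, 0 <= t <= 1 -> Cmod (zt t) < 1).
  { intros t Ht. unfold zt. rewrite Cmod_div, Hmu by exact Nmu.
    destruct (halfplane_to_disk D (u t) HD HI (Hpos t Ht)) as [_ K]. fold (ofU (u t)) in K. lra. }
  assert (Hder : forall t : R, 0 <= t <= 1 ->
    cdiff (fun s => k * g (zt s))%C t
      (kap * (1 - mu / D * zt t) * (1 - mu * D * zt t) * dg (zt t))%C).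
  { intros t Ht. destruct (halfplane_to_disk D (u t) HD HI (Hpos t Ht)) as [N _].
    assert (Hu : cdiff u t (u t * (L2 - L1))%C).
    { unfold u. eapply cdiff_eq; [|apply cdiff_exp_comp, cdiff_plus; [apply cdiff_const|
        apply cdiff_mult; [apply cdiff_id|apply cdiff_const]]]. cbv beta. ring. }
    assert (Hz : cdiff zt t (Ci * (D * D - 1) / ((u t * D - Ci) * (u t * D - Ci)) * (u t * (L2 - L1)) / mu)%C).
    { unfold zt, ofU. eapply cdiff_eq; [|apply (cdiff_div (fun s => ofU (u s)) (fun _ => mu)); [exact Nmu| |apply cdiff_const]].
      2:{ unfold ofU. apply (cdiff_div (fun s => u s - Ci * D)%C (fun s => u s * D - Ci)%C); [exact N| |].
          - apply cdiff_minus; [exact Hu|apply cdiff_const].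
          - apply cdiff_minus; [apply cdiff_mult; [exact Hu|apply cdiff_const]|apply cdiff_const]. }
      cbv beta. unfold ofU. field. split; assumption. }
    eapply cdiff_eq; [|apply cdiff_scal, (cdiff_comp g zt); [apply Hg, Hin, Ht|exact Hz]].
    set (zz := zt t). unfold k.
    replace (1 - mu / D * zz)%C with (u t * (D * D - 1) / (D * (u t * D - Ci)))%C
      by (unfold zz, zt, ofU; field; repeat split; assumption).
    replace (1 - mu * D * zz)%C with (Ci * (D * D - 1) / (u t * D - Ci))%C
      by (unfold zz, zt, ofU; field; repeat split; assumption).
    field. repeat split; assumption. }
  set (f := fun t : R => Re (k * g (zt t))%C).
  set (df := fun t : R => Re (kap * (1 - mu / D * zt t) * (1 - mu * D * zt t) * dg (zt t))%C).
  assert (Hf : forall t, 0 <= t <= 1 -> is_derive f t (df t)).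
  { intros t Ht. apply (cdiff_Re (fun s => k * g (zt s))%C), Hder, Ht. }
  destruct (MVT_gen f 0 1 df) as [m [Hm E]].
  - intros t Ht. rewrite Rmin_left, Rmax_right in Ht by lra. apply Hf. lra.
  - intros t Ht. rewrite Rmin_left, Rmax_right in Ht by lra.
    apply derivable_continuous_pt. exists (df t). apply is_derive_Reals, Hf, Ht.
  - rewrite Rmin_left, Rmax_right in Hm by lra.
    assert (Hdf : 0 < df m) by (apply HP, Hin, Hm).
    assert (E0 : zt 0%R = z1).
    { unfold zt, u. replace (L1 + 0 * (L2 - L1))%C with L1 by ring. unfold L1.
      rewrite Cexp_Clog by exact Hu1. apply Hof, Hz1. }
    assert (E1 : zt 1%R = z2).
    { unfold zt, u. replace (L1 + 1 * (L2 - L1))%C with L2 by ring. unfold L2.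
      rewrite Cexp_Clog by exact Hu2. apply Hof, Hz2. }
    unfold f in E. rewrite E0, E1, Eg in E. lra.
Qed.

Lemma cis_0 : cis 0 = RtoC 1.
Proof. unfold cis. rewrite cos_0, sin_0. reflexivity. Qed.

Lemma cis_inv (x : R) : (/ cis x)%C = cis (- x).
Proof.
  assert (E : (cis (- x) * cis x)%C = RtoC 1) by (rewrite <- cis_plus, Rplus_opp_l; apply cis_0).
  assert (N : cis x <> RtoC 0) by (apply Cmod_gt_0; rewrite Cmod_cis; lra).
  replace (/ cis x)%C with (cis (- x) * cis x * / cis x)%C by (rewrite E; ring). field. exact N.
Qed.

(** The half-angle phases add up to t - (al + be) / 2 and two factors -2i give -4. The first factor
    cancels (al + be) / 2, subtracts [c] and shifts by PI / 2, which turns the cosine into the sine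
    of the angle above level [c]. *)
Lemma boundary_identity (al be c t : R) (w : C) :
  Re (cis ((al + be) / 2 - c - PI / 2) * (1 - cis (- al) * cis t) * (1 - cis (- be) * cis t) * Cexp w)%C
  = -4 * sin ((t - al) / 2) * sin ((t - be) / 2) * exp (Re w) * sin (t + Im w - c).
Proof.
  rewrite <- !cis_plus, !one_minus_cis, Cexp_polar.
  replace ((- al + t) / 2) with ((t - al) / 2) by (f_equal; ring).
  replace ((- be + t) / 2) with ((t - be) / 2) by (f_equal; ring).
  set (s1 := sin ((t - al) / 2)). set (s2 := sin ((t - be) / 2)).
  set (E0 := cis ((al + be) / 2 - c - PI / 2)).
  set (E1 := cis ((t - al) / 2)). set (E2 := cis ((t - be) / 2)). set (E3 := cis (Im w)).
  replace (E0 * (-2 * Ci * RtoC s1 * E1) * (-2 * Ci * RtoC s2 * E2) * (RtoC (exp (Re w)) * E3))%C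
    with (4 * (Ci * Ci) * RtoC s1 * RtoC s2 * RtoC (exp (Re w)) * (E0 * E1 * E2 * E3))%C.
  2:{ replace (RtoC (-2)) with (- RtoC 2)%C by (rewrite <- RtoC_opp; f_equal; lra).
      replace (RtoC 4) with (RtoC 2 * RtoC 2)%C by (rewrite <- RtoC_mult; f_equal; lra). ring. }
  replace (E0 * E1 * E2 * E3)%C with (cis (t + Im w - c - PI / 2)).
  2:{ unfold E0, E1, E2, E3. rewrite <- !cis_plus. f_equal. field. }
  replace (sin (t + Im w - c)) with (cos (t + Im w - c - PI / 2)).
  2:{ rewrite <- (cos_shift (t + Im w - c)), <- cos_neg. f_equal. ring. }
  simpl. ring.
Qed.

Lemma ozaki_injective_extended (g G G1 : C -> C) (R0 : R) :
  1 < R0 ->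
  (forall v, Cmod v < R0 -> cdiff g v (Cexp (G v))) ->
  (forall v, Cmod v < R0 -> cdiff G v (G1 v)) ->
  (forall v, Cmod v < R0 -> ccont G1 v) ->
  (forall v, Cmod v < R0 -> - (1 / 2) < Re (1 + v * G1 v)%C) ->
  forall z1 z2, Cmod z1 < 1 -> Cmod z2 < 1 -> g z1 = g z2 -> z1 = z2.
Proof.
  intros HR Hg HG HG1 HRe.
  assert (Hcirc : forall t : R, Cmod (circ 1 t) < R0) by (intros t; rewrite Cmod_circ; lra).
  (* The tangent of the image curve is i e^(it) Cexp(G), so [psi] is its angle up to the constant PI
     / 2. *)
  set (psi := fun t : R => t + Im (G (circ 1 t))).
  set (dpsi := fun t : R => Re (1 + circ 1 t * G1 (circ 1 t))%C).
  assert (H1 : forall t, is_derive psi t (dpsi t)).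
  { intros t.
    replace (dpsi t) with (1 + Im (G1 (circ 1 t) * (Ci * circ 1 t))%C)
      by (unfold dpsi; destruct (G1 (circ 1 t)), (circ 1 t); simpl; ring).
    apply (is_derive_plus (fun t : R => t)); [exact (is_derive_id (K := R_AbsRing) t)|].
    apply (cdiff_Im (fun s => G (circ 1 s))), (cdiff_comp G (circ 1)); [apply HG, Hcirc|apply cdiff_circ]. }
  assert (Hcc : forall t : R, ccont (circ 1) t) by (intros t; eapply cdiff_ccont, cdiff_circ).
  assert (H2 : forall t, continuity_pt dpsi t).
  { intros t. apply (ccont_Re (fun s => 1 + circ 1 s * G1 (circ 1 s))%C).
    apply (ccont_plus (fun _ => RtoC 1)); [eapply cdiff_ccont, cdiff_const|].
    apply (ccont_mult (circ 1) (fun s => G1 (circ 1 s))); [apply Hcc|].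
    intros eps He. destruct (HG1 _ (Hcirc t) eps He) as [d1 [Hd1 K1]].
    destruct (Hcc t d1 Hd1) as [d2 [Hd2 K2]]. exists d2. split; [exact Hd2|].
    intros w Hw. apply K1, K2, Hw. }
  destruct (level_arcs psi dpsi H1 H2) as [c [al [be [Hab [Hlo [Hhi [t0 [Ht0 Et0]]]]]]]].
  { intros t. apply HRe, Hcirc. }
  { intros t. unfold psi. rewrite circ_period. ring. }
  { intros t. unfold dpsi. rewrite circ_period. reflexivity. }
  pose proof PI_RGT_0 as Hpi.
  set (kap := cis ((al + be) / 2 - c - PI / 2)).
  set (A := cis (- al)). set (B := cis (- be)).
  set (P := fun v => (kap * (1 - A * v) * (1 - B * v) * Cexp (G v))%C).
  set (p := fun v => (kap * (- A * (1 - B * v) + (1 - A * v) * - B + (1 - A * v) * (1 - B * v) * G1 v) * Cexp (G v))%C).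
  assert (HPd : forall v, Cmod v < R0 -> cdiff P v (p v)).
  { intros v Hv. unfold P, p.
    assert (HA : forall X, cdiff (fun v => 1 - X * v)%C v (- X)%C).
    { intros X. eapply cdiff_eq; [|apply cdiff_minus; [apply cdiff_const|apply cdiff_scal, cdiff_id]]. ring. }
    eapply cdiff_eq; [|apply cdiff_mult; [apply (cdiff_mult (fun v => kap * (1 - A * v))%C); [apply cdiff_scal, HA|apply HA]|
      apply cdiff_exp_comp, HG, Hv]]. cbv beta. ring. }
  assert (HPc : forall t : R, Re (P (circ 1 t)) =
    -4 * sin ((t - al) / 2) * sin ((t - be) / 2) * exp (Re (G (circ 1 t))) * sin (psi t - c)).
  { intros t. unfold P, kap, A, B, psi. rewrite <- boundary_identity, circ_cis. reflexivity. }
  assert (HP : forall v, Cmod v < 1 -> 0 < Re (P v)).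
  { apply (Re_pos_of_boundary P p R0 al t0 HR HPd).
    - intros t Ht. rewrite HPc. pose proof (exp_pos (Re (G (circ 1 t)))) as He.
      assert (S1 : 0 <= sin ((t - al) / 2)) by (apply sin_ge_0; lra).
      destruct (Rle_dec t be) as [Hb|Hb].
      + pose proof (Hlo t ltac:(lra)) as Hps.
        assert (S2 : sin ((t - be) / 2) <= 0).
        { replace ((t - be) / 2) with (- ((be - t) / 2)) by field. rewrite sin_neg.
          assert (0 <= sin ((be - t) / 2)) by (apply sin_ge_0; lra). lra. }
        assert (S3 : 0 <= sin (psi t - c)) by (apply sin_ge_0; lra).
        replace (-4 * sin ((t - al) / 2) * sin ((t - be) / 2) * exp (Re (G (circ 1 t))) * sin (psi t - c))
          with (4 * sin ((t - al) / 2) * (- sin ((t - be) / 2)) * exp (Re (G (circ 1 t))) * sin (psi t - c)) by ring.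
        repeat apply Rmult_le_pos; lra.
      + pose proof (Hhi t ltac:(lra)) as Hps.
        assert (S2 : 0 <= sin ((t - be) / 2)) by (apply sin_ge_0; lra).
        assert (S3 : sin (psi t - c) <= 0) by (apply sin_le_0; lra).
        replace (-4 * sin ((t - al) / 2) * sin ((t - be) / 2) * exp (Re (G (circ 1 t))) * sin (psi t - c))
          with (4 * sin ((t - al) / 2) * sin ((t - be) / 2) * exp (Re (G (circ 1 t))) * (- sin (psi t - c))) by ring.
        repeat apply Rmult_le_pos; lra.
    - lra.
    - rewrite HPc, Et0. replace (c + PI / 2 - c) with (PI / 2) by ring. rewrite sin_PI2.
      assert (S1 : 0 < sin ((t0 - al) / 2)) by (apply sin_gt_0; lra).
      assert (S2 : 0 < sin ((be - t0) / 2)) by (apply sin_gt_0; lra).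
      replace ((t0 - be) / 2) with (- ((be - t0) / 2)) by field. rewrite sin_neg.
      replace (-4 * sin ((t0 - al) / 2) * - sin ((be - t0) / 2) * exp (Re (G (circ 1 t0))) * 1)
        with (4 * sin ((t0 - al) / 2) * sin ((be - t0) / 2) * exp (Re (G (circ 1 t0)))) by ring.
      repeat apply Rmult_lt_0_compat; try lra. apply exp_pos. }
  (* With these values mu / D = e^(-i al) and mu D = e^(-i be); Im D < 0 because (be - al) / 2 lies
     strictly between 0 and PI. *)
  apply (strip_injective g (fun v => Cexp (G v)) kap (cis (- (al + be) / 2)) (cis (- (be - al) / 2))).
  - apply Cmod_cis.
  - unfold cis. simpl. replace (- (be - al) / 2) with (- ((be - al) / 2)) by field. rewrite sin_neg.
    assert (0 < sin ((be - al) / 2)) by (apply sin_gt_0; lra). lra.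
  - apply Cmod_cis.
  - intros v Hv. apply Hg. lra.
  - intros v Hv. unfold Cdiv. rewrite cis_inv, <- !cis_plus.
    replace (- (al + be) / 2 + - (- (be - al) / 2)) with (- al) by field.
    replace (- (al + be) / 2 + - (be - al) / 2) with (- be) by field.
    apply HP, Hv.
Qed.

(** Two given points leave room for a radius r < 1 beyond both, and g(r v) is then holomorphic on
    |v| < 1 / r. The factor [r] in its derivative is absorbed as exp(ln r), which keeps the
    derivative an exponential; the quantity v G1(v) is merely evaluated at r v. *)
Lemma ozaki_injective (g G G1 : C -> C) :
  (forall v, Cmod v < 1 -> cdiff g v (Cexp (G v))) ->
  (forall v, Cmod v < 1 -> cdiff G v (G1 v)) ->
  (forall v, Cmod v < 1 -> ccont G1 v) ->
  (forall v, Cmod v < 1 -> - (1 / 2) < Re (1 + v * G1 v)%C) ->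
  forall z1 z2, Cmod z1 < 1 -> Cmod z2 < 1 -> g z1 = g z2 -> z1 = z2.
Proof.
  intros Hg HG HG1 HRe z1 z2 Hz1 Hz2 E.
  set (m := Rmax (Cmod z1) (Cmod z2)). set (r := (1 + m) / 2).
  assert (Hm : m < 1) by (apply Rmax_lub_lt; assumption).
  pose proof (Rmax_l (Cmod z1) (Cmod z2)) as M1. pose proof (Rmax_r (Cmod z1) (Cmod z2)) as M2.
  fold m in M1, M2. pose proof (Cmod_ge_0 z1) as M0.
  assert (Hr : 0 < r < 1) by (unfold r; lra).
  assert (Nr : RtoC r <> RtoC 0) by (intros K; apply RtoC_inj in K; lra).
  assert (Hdom : forall v, Cmod v < / r -> Cmod (r * v) < 1).
  { intros v Hv. rewrite Cmod_mult, Cmod_R, Rabs_right by lra.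
    apply Rmult_lt_compat_l with (r := r) in Hv; [|lra]. rewrite Rinv_r in Hv by lra. exact Hv. }
  assert (Hsc : forall v, cdiff (fun v => r * v)%C v r).
  { intros v. eapply cdiff_eq; [|apply cdiff_scal, cdiff_id]. ring. }
  assert (Er : Cexp (RtoC (ln r)) = RtoC r).
  { unfold Cexp, RtoC. simpl. rewrite exp_ln, cos_0, sin_0 by lra. f_equal; ring. }
  assert (Hin : forall z, Cmod z <= m -> Cmod (z / r) < 1).
  { intros z Hz. rewrite Cmod_div, Cmod_R, Rabs_right by first [exact Nr|lra].
    apply Rmult_lt_reg_r with r; [lra|]. unfold Rdiv. rewrite Rmult_assoc, Rinv_l by lra. unfold r. lra. }
  assert (K : (z1 / r)%C = (z2 / r)%C).
  { apply (ozaki_injective_extended (fun v => g (r * v)%C) (fun v => RtoC (ln r) + G (r * v))%C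
      (fun v => r * G1 (r * v))%C (/ r)).
    - rewrite <- Rinv_1. apply Rinv_lt_contravar; lra.
    - intros v Hv. rewrite Cexp_plus, Er, Cmult_comm.
      apply (cdiff_comp g (fun v => r * v)%C); [apply Hg, Hdom, Hv|apply Hsc].
    - intros v Hv. eapply cdiff_eq; [|apply cdiff_plus; [apply cdiff_const|
        apply (cdiff_comp G (fun v => r * v)%C); [apply HG, Hdom, Hv|apply Hsc]]]. ring.
    - intros v Hv. apply (ccont_mult (fun _ => RtoC r)); [eapply cdiff_ccont, cdiff_const|].
      intros eps He. destruct (HG1 _ (Hdom v Hv) eps He) as [d1 [Hd1 K1]].
      destruct (cdiff_ccont _ _ _ (Hsc v) d1 Hd1) as [d2 [Hd2 K2]].
      exists d2. split; [exact Hd2|]. intros w Hw. apply K1, K2, Hw.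
    - intros v Hv. replace (v * (r * G1 (r * v)))%C with ((r * v) * G1 (r * v))%C by ring.
      apply HRe, Hdom, Hv.
    - apply Hin, M1.
    - apply Hin, M2.
    - replace (r * (z1 / r))%C with z1 by (field; exact Nr).
      replace (r * (z2 / r))%C with z2 by (field; exact Nr). exact E. }
  replace z1 with (r * (z1 / r))%C by (field; exact Nr). rewrite K. field. exact Nr.
Qed.

(** * The Cesaro transform *)

Lemma derivative_function (F : C -> C) (S : C -> Prop) :
  (forall v, S v -> exists d, cdiff F v d) ->
  exists F1 : C -> C, forall v, S v -> cdiff F v (F1 v).
Proof.
  intros H. destruct (functional_choice (fun v d => S v -> cdiff F v d)) as [F1 HF1].
  - intros v. destruct (Classical_Prop.classic (S v)) as [Hv|Hv].
    + destruct (H v Hv) as [d Hd]. exists d. intros _; exact Hd.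
    + exists (RtoC 0). intros K; contradiction.
  - exists F1. exact HF1.
Qed.

(** The logarithm is the primitive of q1 / q vanishing at 0, and q exp(-ell) has derivative zero.
    For q1 / q to have a primitive, [q1] must itself be differentiable, which
    [holomorphic_derivative] provides. *)
Lemma holomorphic_log (q q1 : C -> C) (R0 : R) :
  0 < R0 -> (forall v, Cmod v < R0 -> cdiff q v (q1 v)) ->
  (forall v, Cmod v < R0 -> q v <> RtoC 0) -> q 0 = RtoC 1 ->
  exists ell : C -> C, ell 0 = RtoC 0 /\
    forall v, Cmod v < R0 -> cdiff ell v (q1 v / q v)%C /\ q v = Cexp (ell v).
Proof.
  intros HR Hq Hne Hq0.
  set (F := fun v => (q1 v / q v)%C).
  assert (HF : forall v, Cmod v < R0 -> exists d, cdiff F v d).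
  { intros v Hv. destruct (holomorphic_derivative q q1 R0 Hq v Hv) as [d Hd].
    eexists. apply (cdiff_div q1 q); [apply Hne, Hv|exact Hd|apply Hq, Hv]. }
  assert (HFc : forall v, Cmod v < R0 -> ccont F v).
  { intros v Hv. destruct (HF v Hv) as [d Hd]. eapply cdiff_ccont, Hd. }
  assert (H0 : Cmod 0 < R0) by (rewrite Cmod_0; exact HR).
  pose proof (disk_primitive F 0 R0 H0 HFc (fun v Hv _ => HF v Hv)) as Hell.
  exists (segint F 0). split; [apply segint_refl, HFc, H0|].
  intros v Hv. split; [apply Hell, Hv|].
  assert (HE : (q v * Cexp (- segint F 0 v))%C = (q 0 * Cexp (- segint F 0 0))%C).
  { apply (cdiff_zero_const (fun v => q v * Cexp (- segint F 0 v))%C R0); [|exact Hv|exact H0].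
    intros w Hw. eapply cdiff_eq; [|apply cdiff_mult; [apply Hq, Hw|
      apply cdiff_exp_comp, cdiff_opp, Hell, Hw]].
    cbv beta. unfold F. field. apply Hne, Hw. }
  rewrite (segint_refl F 0 (HFc _ H0)), Hq0 in HE.
  replace (- 0)%C with (RtoC 0) in HE by ring. rewrite Cexp_0 in HE.
  pose proof (Cexp_opp (segint F 0 v)) as HO.
  transitivity (q v * (Cexp (segint F 0 v) * Cexp (- segint F 0 v)))%C; [rewrite HO; ring|].
  transitivity (Cexp (segint F 0 v) * (q v * Cexp (- segint F 0 v)))%C; [ring|].
  rewrite HE. ring.
Qed.

(** An angle that moves continuously from 0 cannot reach PI / 2, where the cosine vanishes. *)
Lemma angle_lt_PI2 (phi : R -> R) :
  (forall t, 0 <= t <= 1 -> continuity_pt phi t) -> phi 0 = 0 ->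
  (forall t, 0 <= t <= 1 -> 0 < cos (phi t)) -> phi 1 < PI / 2.
Proof.
  intros Hc H0 Hcos. pose proof PI_RGT_0.
  destruct (Rlt_dec (phi 1) (PI / 2)) as [|N]; [assumption|exfalso].
  apply Rnot_lt_le in N. destruct N as [N|N].
  - destruct (IVT_interv (fun t => phi t - PI / 2) 0 1) as [t [Ht Et]]; [|lra|lra|lra|].
    + intros t Ht. apply continuity_pt_minus; [apply Hc, Ht|].
      apply continuity_pt_const. intros x y; reflexivity.
    + specialize (Hcos t Ht). replace (phi t) with (PI / 2) in Hcos by lra.
      rewrite cos_PI2 in Hcos. lra.
  - specialize (Hcos 1 ltac:(lra)). rewrite <- N, cos_PI2 in Hcos. lra.
Qed.

(** This avoids differentiating the case definition of [Carg]. A holomorphic logarithm of 1 - v is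
    built first; as Re (1 - v) > 0, its imaginary part stays strictly between -PI / 2 and PI / 2
    along the ray from 0, so it is the principal one. *)
Lemma Clog_one_minus :
  exists ell : C -> C, ell 0 = RtoC 0 /\ forall v, Cmod v < 1 ->
    cdiff ell v (- (1) / (1 - v))%C /\ Clog (1 - v) = ell v.
Proof.
  assert (Hre : forall v, Cmod v < 1 -> 0 < Re (1 - v)%C).
  { intros v Hv. pose proof (re_le_Cmod v) as Hr. apply Rabs_le_between in Hr.
    destruct v as [x y]. simpl in *. lra. }
  destruct (holomorphic_log (fun v => 1 - v)%C (fun _ => - (1))%C 1) as [ell [E0 Hell]].
  - lra.
  - intros v _. eapply cdiff_eq; [|apply cdiff_minus; [apply cdiff_const|apply cdiff_id]]. ring.
  - intros v Hv E. specialize (Hre v Hv). rewrite E in Hre. simpl in Hre. lra.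
  - ring.
  - exists ell. split; [exact E0|]. intros v Hv. destruct (Hell v Hv) as [Hd Ev].
    split; [exact Hd|]. rewrite Ev. apply Clog_Cexp.
    assert (Hin : forall t, 0 <= t <= 1 -> Cmod (t * v) < 1).
    { intros t Ht. rewrite Cmod_mult, Cmod_R, Rabs_right by lra. pose proof (Cmod_ge_0 v). nra. }
    set (phi := fun t : R => Im (ell (t * v)%C)).
    assert (Hc : forall t, 0 <= t <= 1 -> continuity_pt phi t).
    { intros t Ht. apply derivable_continuous_pt. eexists. apply is_derive_Reals.
      apply (cdiff_Im (fun s => ell (s * v)%C)), (cdiff_comp ell (fun s => s * v)%C);
        [apply Hell, Hin, Ht|apply cdiff_mult; [apply cdiff_id|apply cdiff_const]]. }
    assert (H0 : phi 0 = 0).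
    { unfold phi. replace (0 * v)%C with (RtoC 0) by ring. rewrite E0. reflexivity. }
    assert (Hcos : forall t, 0 <= t <= 1 -> 0 < cos (phi t)).
    { intros t Ht. destruct (Hell _ (Hin t Ht)) as [_ Et]. pose proof (Hre _ (Hin t Ht)) as Hp.
      rewrite Et in Hp. unfold Cexp in Hp. cbn [Re fst] in Hp. fold (phi t) in Hp.
      pose proof (exp_pos (Re (ell (t * v)%C))) as He.
      apply Rmult_lt_reg_l with (exp (Re (ell (t * v)%C))); [exact He|]. lra. }
    assert (E1 : phi 1 = Im (ell v)) by (unfold phi; do 2 f_equal; ring).
    rewrite <- E1. split.
    + assert (K : - phi 1 < PI / 2); [|lra].
      apply (angle_lt_PI2 (fun t => - phi t)).
      * intros t Ht. apply continuity_pt_opp, Hc, Ht.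
      * rewrite H0. ring.
      * intros t Ht. rewrite cos_neg. apply Hcos, Ht.
    + apply angle_lt_PI2; assumption.
Qed.

(** Source of the loss beta / 2: the function v / (1 - v) sends the disk into the half plane to the
    right of -1/2. *)
Lemma Re_div_one_minus (v : C) :
  Cmod v < 1 -> (1 - v)%C <> RtoC 0 /\ - (1 / 2) < Re (v / (1 - v))%C.
Proof.
  intros Hv. pose proof (re_le_Cmod v) as Hr. apply Rabs_le_between in Hr.
  pose proof (Cmod2_alt v) as H2. pose proof (Cmod_ge_0 v) as H0.
  split.
  - intros E. assert (E1 : Re (1 - v)%C = 0) by (rewrite E; reflexivity).
    destruct v as [x y]. simpl in *. lra.
  - destruct v as [x y]. simpl in *.
    assert (Hx : 0 < 1 - x) by lra.
    assert (HD : 0 < (1 - x) * (1 - x) + y * y) by nra.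
    match goal with |- _ < ?e =>
      replace e with ((x * (1 - x) - y * y) / ((1 - x) * (1 - x) + y * y)) end.
    + apply Rmult_lt_reg_r with ((1 - x) * (1 - x) + y * y); [exact HD|].
      unfold Rdiv. rewrite (Rmult_assoc (x * (1 - x) - y * y)), Rinv_l by lra. nra.
    + field. repeat split; nra.
Qed.

Theorem theorem2p7 (lam beta : R) (f : C -> C) :
  -1/2 <= lam -> lam < 1 -> 0 <= beta -> beta <= 2 * lam + 1 ->
  starlike lam f -> classS (cesaro beta f).
Proof.
  intros Hlam _ Hbeta Hbl [[Han [Hf0 Hf0']] [Hfne Hst]].
  destruct (derivative_function f (fun v => Cmod v < 1)) as [f1 Hf1].
  { intros v Hv. destruct (Han v Hv) as [d Hd]. exists d. apply is_derive_cdiff, Hd. }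
  assert (H00 : Cmod 0 < 1) by (rewrite Cmod_0; lra).
  set (q := diffquot f f1 0).
  assert (Hq0 : q 0 = RtoC 1).
  { unfold q, diffquot. destruct (Ceq_dec 0 0) as [_|N]; [|congruence].
    apply (cdiff_unique f 0); [apply Hf1, H00|apply is_derive_cdiff, Hf0']. }
  assert (Hqv : forall v, v <> RtoC 0 -> q v = (f v / v)%C).
  { intros v Hv. unfold q, diffquot. destruct (Ceq_dec v 0) as [E|_]; [contradiction|].
    rewrite Hf0. field. exact Hv. }
  assert (Hqne : forall v, Cmod v < 1 -> q v <> RtoC 0).
  { intros v Hv. destruct (Ceq_dec v 0) as [->|N].
    - rewrite Hq0. intros E. apply RtoC_inj in E. lra.
    - rewrite Hqv by exact N. intros E. apply (Hfne v Hv N).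
      replace (f v) with (f v / v * v)%C by (field; exact N). rewrite E. ring. }
  assert (Hqd0 : forall v, Cmod v < 1 -> v <> RtoC 0 -> exists d, cdiff q v d).
  { intros v Hv N. eapply diffquot_diff; [exact N|apply Hf1, Hv]. }
  assert (Hqc : forall v, Cmod v < 1 -> ccont q v).
  { intros v Hv. destruct (Ceq_dec v 0) as [->|N]; [apply diffquot_cont, Hf1, Hv|].
    destruct (Hqd0 v Hv N) as [d Hd]. eapply cdiff_ccont, Hd. }
  (* [q] is holomorphic at 0 too, being the derivative of its primitive. *)
  destruct (derivative_function q (fun v => Cmod v < 1)) as [q1 Hq1].
  { exact (holomorphic_derivative (segint q 0) q 1 (disk_primitive q 0 1 H00 Hqc Hqd0)). }
  destruct (holomorphic_log q q1 1 Rlt_0_1 Hq1 Hqne Hq0) as [ell [Eell0 Hell]].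
  destruct Clog_one_minus as [el2 [Eel20 Hel2]].
  (* [G] is a logarithm of f(v) / (v (1 - v)^beta) with the principal power, as [Hh] confirms. *)
  set (G := fun v => (ell v - beta * el2 v)%C).
  set (G1 := fun v => (q1 v / q v + beta / (1 - v))%C).
  assert (HG : forall v, Cmod v < 1 -> cdiff G v (G1 v)).
  { intros v Hv. destruct (Re_div_one_minus v Hv) as [N _].
    eapply cdiff_eq; [|apply cdiff_minus; [apply Hell, Hv|apply cdiff_scal, Hel2, Hv]].
    unfold G1. field. split; [exact N|apply Hqne, Hv]. }
  assert (HG1 : forall v, Cmod v < 1 -> ccont G1 v).
  { intros v Hv. destruct (holomorphic_derivative G G1 1 HG v Hv) as [d Hd].
    eapply cdiff_ccont, Hd. }
  assert (HeG : forall v, Cmod v < 1 -> ccont (fun w => Cexp (G w)) v).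
  { intros v Hv. eapply cdiff_ccont, cdiff_exp_comp, HG, Hv. }
  assert (HG0 : Cexp (G 0) = RtoC 1).
  { unfold G. rewrite Eell0, Eel20. replace (0 - beta * 0)%C with (RtoC 0) by ring. apply Cexp_0. }
  assert (Hh : forall v, Cmod v < 1 -> (q v / Cpow_pr (1 - v) beta)%C = Cexp (G v)).
  { intros v Hv. destruct (Hell v Hv) as [_ E1]. destruct (Hel2 v Hv) as [_ E2].
    unfold Cpow_pr, G. rewrite E2, E1.
    replace (ell v) with (ell v - beta * el2 v + beta * el2 v)%C at 1 by ring.
    rewrite Cexp_plus. field. apply Cexp_neq_0. }
  assert (Hces : forall z, Cmod z < 1 -> cesaro beta f z = segint (fun w => Cexp (G w)) 0 z).
  { intros z Hz. unfold cesaro, segint.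
    apply (RInt_ext (V := C_R_CompleteNormedModule)). intros t Ht.
    (* Only 0 < t < 1 has to be compared, so the division by zero in the integrand of [cesaro] at t
       = 0 does no harm. *)
    rewrite Rmin_left, Rmax_right in Ht by lra.
    assert (Hseg : seg 0 z t = (t * z)%C) by (unfold seg; ring). rewrite Hseg.
    replace (z - 0)%C with z by ring.
    destruct (Ceq_dec z 0) as [->|N].
    { transitivity (RtoC 0); [|symmetry]; apply Cmult_0_r. }
    f_equal.
    assert (Ntz : (t * z)%C <> RtoC 0).
    { apply Cmult_neq_0; [|exact N]. intros E. apply RtoC_inj in E. lra. }
    rewrite <- Hh, Hqv by first [exact Ntz|
      rewrite Cmod_mult, Cmod_R, Rabs_right by lra; pose proof (Cmod_ge_0 z); nra].
    assert (NC : Cpow_pr (1 - t * z) beta <> RtoC 0) by apply Cexp_neq_0.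
    field. repeat split; first [exact NC|exact N|intros E; apply RtoC_inj in E; lra]. }
  pose proof (disk_primitive _ 0 1 H00 HeG
    (fun v Hv _ => ex_intro _ _ (cdiff_exp_comp G v (G1 v) (HG v Hv)))) as Hprim.
  assert (Hder : forall v, Cmod v < 1 -> cdiff (cesaro beta f) v (Cexp (G v))).
  { intros v Hv. apply (cdiff_ext (segint (fun w => Cexp (G w)) 0) _ _ _ (1 - Cmod v)); [lra| |apply Hprim, Hv].
    intros w Hw. symmetry. apply Hces. pose proof (Cmod_le_add w v). lra. }
  split.
  - split; [|split].
    + intros z Hz. exists (Cexp (G z)). apply is_derive_cdiff, Hder, Hz.
    + rewrite Hces by exact H00. apply segint_refl, HeG, H00.
    + apply is_derive_cdiff. rewrite <- HG0. apply Hder, H00.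
  - intros z w Hz Hw E. apply (ozaki_injective (cesaro beta f) G G1); try assumption.
    intros v Hv. destruct (Re_div_one_minus v Hv) as [N Hk].
    destruct (Ceq_dec v 0) as [->|Nv].
    (* The starlikeness condition is silent at the origin; the quantity equals 1 there. *)
    { replace (1 + 0 * G1 0)%C with (RtoC 1) by ring. simpl. lra. }
    assert (Eq1 : q1 v = ((f1 v * v - f v * 1) / (v * v))%C).
    { apply (cdiff_unique q v); [apply Hq1, Hv|].
      apply (cdiff_ext (fun w => f w / w)%C _ _ _ (Cmod v)).
      - apply Cmod_gt_0, Nv.
      - intros u Hu. symmetry. apply Hqv. intros ->.
        rewrite Cmod_sym in Hu. replace (v - 0)%C with v in Hu by ring. lra.
      - apply (cdiff_div f (fun w => w)); [exact Nv|apply Hf1, Hv|apply cdiff_id]. }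
    assert (Es : (1 + v * G1 v)%C = (v * f1 v / f v + beta * (v / (1 - v)))%C).
    { unfold G1. rewrite Eq1, Hqv by exact Nv. field. repeat split; try assumption. apply Hfne; assumption. }
    rewrite Es.
    pose proof (Hst v (f1 v) Hv Nv (proj2 (is_derive_cdiff _ _ _) (Hf1 v Hv))) as Hs.
    set (X := (v * f1 v / f v)%C) in *. set (Y := (v / (1 - v))%C) in *.
    replace (Re (X + beta * Y)%C) with (Re X + beta * Re Y) by (destruct X, Y; simpl; ring).
    (* Re X > lam, and Re Y > -1/2 with beta >= 0 gives beta Re Y >= - beta / 2; finally lam - beta
       / 2 >= -1/2. Strictness comes from [X], since [beta] may be 0. *)
    nra.
Qed.
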